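(* Let $G$ be the tetrahedral group of all rotations of $S^2$ preserving a fixed regular tetrahedron centered at the origin, and let $V_T,F_T,E_T,B_T(X)$, $V_I,F_I,E_I,B_I(X)$ and $V_O,F_O,E_O,B_O(X)$ be the orbits attached to this tetrahedron, to the regular dodecahedron and to the cube positioned relative to it as described in the context. For any finite subset $\alpha$ of $S^2$, $\mathcal{A}_\alpha=G\ (\simeq A_4)$ if and only if all of the three claims are true: 1. $\alpha$ is a union of certain elements in $\{V_T,F_T,E_T\}\cup\{B_T(X)\mid X\in S^2\setminus(V_T\cup F_T\cup E_T)\}$; 2. $\alpha$ is NOT a union of certain elements in $\{V_I,F_I,E_I\}\cup\{B_I(X)\mid X\in S^2\setminus(V_I\cup F_I\cup E_I)\}$; 3. $\alpha$ is NOT a union of certain elements in $\{V_O,F_O,E_O\}\cup\{B_O(X)\mid X\in S^2\setminus(V_O\cup F_O\cup E_O)\}$. Here, with the points $B,N,Q,R$ and the rotation $g_I$ of the dodecahedron, and the point $P$ and the rotation $g_O$ of the cube, as in the context, $$V_I=V_T\cup F_T\cup B_T(B),\quad F_I=B_T(N),\quad E_I=E_T\cup B_T(Q)\cup B_T(R),$$ $$B_I(X)=B_T(X)\cup B_T(g_I(X))\cup B_T(g_I^2(X))\cup B_T(g_I^3(X))\cup B_T(g_I^4(X))\quad\text{for } X\in S^2\setminus(V_I\cup F_I\cup E_I),$$ $$V_O=V_T\cup F_T,\quad F_O=E_T,\quad E_O=B_T(P),$$ $$B_O(X)=B_T(X)\cup B_T(g_O(X))\quad\text{for } X\in S^2\setminus(V_O\cup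 F_O\cup E_O).$$
   Context: $S^2$ is the unit sphere, identified with the extended complex plane $\widehat{\mathbb{C}}$ by stereographic projection; rotations of $S^2$ are thereby regarded as linear fractional transformations. For a finite subset $\alpha$, $\mathcal{A}_\alpha$ is the group of linear fractional transformations $h$ with $h(\alpha)=\alpha$. All polyhedra are inscribed in $S^2$ and centered at the origin. For such a polyhedron, $V$ denotes its set of vertices, $F$ and $E$ denote the projections from the origin to $S^2$ of the central points of its faces and of the middle points of its edges, respectively, and, for $X\in S^2\setminus(V\cup F\cup E)$, $B(X)$ denotes the orbit of $X$ under the rotation group of the polyhedron. These carry the subscript $T$ for the given tetrahedron (rotation group $G$), $I$ for the dodecahedron and $O$ for the cube below. Dodecahedron: one fixed regular dodecahedron whose vertex set contains the four vertices of the tetrahedron (so its rotation group contains $G$). One of its faces is labelled $ABCDE$ (consecutive vertices) with $A\in V_T$ and with the midpoint of $BC$ projecting to a point of $E_T$. $N$ is the center of this face and $Q,R$ are the midpoints of the edges $AB$ and $DE$ (all projected to $S^2$); $g_I$ is the rotation that preserves the pentagon $ABCDE$ and carries $A$ to $B$. Cube: the cube whose vertex set contains the four vertices of the tetrahedron. One of its faces is labelled $ABCD$ (consecutive vertices, independent of the labels of the dodecahedron) with $A\in V_T$; $P$ is the midpoint of the edge $AB$ (projected to $S^2$), and $g_O$ is the rotation that preserves the square $ABCD$ and carries $A$ to $B$.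
   Formalization: Claim 2 is required for every regular dodecahedron whose vertex set contains V_T (there are two, mirror images), not for one fixed dodecahedron: with one fixed, α = the vertex set of the other satisfies claims 1–3 although its stabilizer is larger than G. *)

(* Defs.v *)
(* MathComp world; the reals are a MathComp-Analysis [R : realType]. *)
From mathcomp Require Import all_boot all_order all_algebra all_fingroup.
From mathcomp Require Import all_solvable.
From mathcomp Require Import finmap all_classical all_reals.
From mathcomp Require Import complex.
Set Implicit Arguments.
Unset Strict Implicit.
Unset Printing Implicit Defensive.
Import Order.TTheory GRing.Theory Num.Theory.
Local Open Scope classical_set_scope.
Local Open Scope ring_scope.

Section Sphere.
Context {R : realType}.
Implicit Types (u v X : 'rV[R]_3) (r : 'M[R]_3) (V W F : set 'rV[R]_3).

Definition dot u v : R := \sum_(i < 3) u 0 i * v 0 i.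

Definition sphere : set 'rV[R]_3 := [set v | dot v v = 1].

Definition radial_proj v : 'rV[R]_3 := (Num.sqrt (dot v v))^-1 *: v.

Definition vec3 (x y z : R) : 'rV[R]_3 :=
  \row_(i < 3) nth 0 [:: x; y; z] i.

Definition is_rotation r := r *m r^T = 1%:M /\ \det r = 1.

(* A polyhedron inscribed in the sphere is given by its vertex set [V], the
   polyhedron itself being the convex hull of [V].  Points are row vectors, so
   a linear map [r] acts by [v *m r]. *)
Definition rotation_group V : set 'M[R]_3 :=
  [set r | is_rotation r /\ [set v *m r | v in V] = V].

Definition exposed V F :=
  exists (n : 'rV[R]_3) (c : R),
    [/\ n != 0, forall v, V v -> dot n v <= c
      & F = [set v | V v /\ dot n v = c]].

(* Distinct points of a sphere are never collinear in threes: when the points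
   of [V] lie on the sphere and are not coplanar, the faces of dimension 2 are
   therefore the exposed sets with at least three vertices, and the edges are
   those with exactly two. *)
Definition is_face V F :=
  exposed V F /\
  exists x y z, [/\ F x, F y & F z] /\ [/\ x != y, y != z & x != z].

Definition is_edge V u v := u != v /\ exposed V [set u; v].

Definition centroid F : 'rV[R]_3 :=
  (#|` fset_set F|%:R)^-1 *: \sum_(v \in F) v.

Definition midpoint u v : 'rV[R]_3 := 2^-1 *: (u + v).

Definition face_points V : set 'rV[R]_3 :=
  [set radial_proj (centroid F) | F in [set F | is_face V F]].

Definition edge_points V : set 'rV[R]_3 :=
  [set p | exists u v, is_edge V u v /\ p = radial_proj (midpoint u v)].

Definition rot_orbit V X : set 'rV[R]_3 :=
  [set X *m r | r in rotation_group V].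

Definition generic_point V : set 'rV[R]_3 :=
  sphere `\` (V `|` face_points V `|` edge_points V).

Definition orbit_family V : set (set 'rV[R]_3) :=
  [set V; face_points V; edge_points V] `|`
  [set rot_orbit V X | X in generic_point V].

Definition union_of_orbits V (alpha : set 'rV[R]_3) :=
  exists2 C : set (set 'rV[R]_3),
    C `<=` orbit_family V & alpha = \bigcup_(B in C) B.

(* [s] lists the vertices of a face of [V] in cyclic order. *)
Definition labelled_face V (s : seq 'rV[R]_3) :=
  [/\ is_face V [set` s], uniq s
    & path.cycle (fun u v => `[< is_edge V u v >]) s].

Definition face_rotation (s : seq 'rV[R]_3) (a b : 'rV[R]_3) r :=
  [/\ is_rotation r, [set v *m r | v in [set` s]] = [set` s] & a *m r = b].

End Sphere.

Section RegularPolyhedra.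
Context {R : realType}.
Implicit Types V W : set 'rV[R]_3.

(* Equality up to an isometry of R^3 fixing the origin. *)
Definition congruent V W :=
  exists2 q : 'M[R]_3, q *m q^T = 1%:M & W = [set v *m q | v in V].

Definition normalized V : set 'rV[R]_3 := [set (Num.sqrt 3)^-1 *: v | v in V].

Definition std_tetrahedron : set 'rV[R]_3 :=
  [set vec3 1 1 1; vec3 1 (-1) (-1); vec3 (-1) 1 (-1); vec3 (-1) (-1) 1].

Definition std_cube : set 'rV[R]_3 :=
  [set v | exists a b c : bool, v = vec3 ((-1) ^+ a) ((-1) ^+ b) ((-1) ^+ c)].

Definition golden : R := (1 + Num.sqrt 5) / 2.

Definition std_dodecahedron : set 'rV[R]_3 :=
  std_cube `|`
  [set v | exists a b : bool,
     let s := (-1) ^+ a * golden^-1 in let t := (-1) ^+ b * golden in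
     v \in [:: vec3 0 s t; vec3 t 0 s; vec3 s t 0]].

(* Regular polyhedra inscribed in the unit sphere and centered at the origin. *)
Definition regular_tetrahedron V := congruent (normalized std_tetrahedron) V.
Definition regular_cube V := congruent (normalized std_cube) V.
Definition regular_dodecahedron V := congruent (normalized std_dodecahedron) V.

End RegularPolyhedra.

Section Moebius.
Context {R : realType}.
Local Notation C := R[i].
Local Notation A4 := ('Alt_('I_4))%g.

(* The extended complex plane; [None] is the point at infinity. *)
Definition ext_plane := option C.

Definition moebius (a b c d : C) (w : ext_plane) : ext_plane :=
  match w with
  | None => if c == 0 then None else Some (a / c)
  | Some z => if c * z + d == 0 then None
              else Some ((a * z + b) / (c * z + d))
  end.

Definition lft : set (ext_plane -> ext_plane) :=
  [set h | exists a b c d : C, a * d - b * c != 0 /\ h = moebius a b c d].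

Definition stereo (v : 'rV[R]_3) : ext_plane :=
  let x := v 0 0 in let y := v 0 1 in let z := v 0 2%:R in
  if z == 1 then None else Some (Complex (x / (1 - z)) (y / (1 - z))).

Definition stereo_inv (w : ext_plane) : 'rV[R]_3 :=
  match w with
  | None => vec3 0 0 1
  | Some (Complex x y) =>
      (x ^+ 2 + y ^+ 2 + 1)^-1 *: vec3 (2 * x) (2 * y) (x ^+ 2 + y ^+ 2 - 1)
  end.

(* A rotation of the sphere regarded as a self-map of the extended plane. *)
Definition on_plane (r : 'M[R]_3) : ext_plane -> ext_plane :=
  fun w => stereo (stereo_inv w *m r).

Definition lft_stabilizer (alpha : set 'rV[R]_3) :
    set (ext_plane -> ext_plane) :=
  [set h | lft h /\ h @` (stereo @` alpha) = stereo @` alpha].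

Definition isomorphic_to_A4 (G : set (ext_plane -> ext_plane)) :=
  exists f : 'S_4 -> ext_plane -> ext_plane,
    [/\ forall s t, s \in A4 -> t \in A4 ->
          f (s * t)%g = f s \o f t,
        {in A4 &, injective f}
      & [set f s | s in [set` A4]] = G].

End Moebius.
Arguments ext_plane R : clear implicits.

(* Main.v *)
Require Import Defs.
From mathcomp Require Import all_boot all_order all_algebra all_fingroup all_solvable.
From mathcomp Require Import finmap all_classical all_reals.
From mathcomp Require Import complex ring lra.
Set Implicit Arguments.
Unset Strict Implicit.
Unset Printing Implicit Defensive.
Import Order.TTheory GRing.Theory Num.Theory.
Local Open Scope classical_set_scope.
Local Open Scope ring_scope.

(** Call G the tetrahedral group. The criterion rests on two facts about a
    nonempty finite set alpha that is invariant under G.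

    Its stabilizer among the linear fractional maps consists of rotations. Lift
    the stabilizer to matrices of determinant one. A linear fractional map is
    determined by three points, and alpha has three points, so the squared norm
    takes finitely many values on the lifted stabilizer; let [m] have the largest
    one. The Klein four-group in G acts irreducibly on C^2, hence the mean of
    [|m g m|^2] over its lifts [g] is [|m|^4 / 2] ([klein_average]). This mean is
    at most [|m|^2], so that [|m|^2 <= 2]. But a matrix of determinant one has
    squared norm at least 2, with equality on SU(2) only ([lnorm_ge2]): the whole
    stabilizer is unitary ([lft_stabilizer_rotation]).

    If a rotation outside G preserves alpha, then so does the rotation group of
    the cube or of a dodecahedron over the tetrahedron ([larger_stabilizer]).
    The quaternions of norm one that represent rotations preserving alpha form a
    group containing the 24 Hurwitz units, and have finitely many real parts. Let
    [h] have the largest real part [a] apart from 1. Some product of an outside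
    element and a Hurwitz unit lies within 45 degrees of 1 or -1, so
    [a ^+ 2 >= 1 / 2]. A commutator of [h] with a conjugate would be too close to
    1 if the angle of [h] were 30 degrees or less ([extremal_re_bound]), and
    between 30 and 45 degrees [- h ^ 5] is closer to 1 than [h] unless it equals 1
    ([extremal_re_values]). So the angle is 45 or 36 degrees. Comparing [h] with
    its products by Hurwitz units then determines its coordinates: it represents
    a quarter turn about a coordinate axis, or a turn by 72 degrees of one of the
    two dodecahedra. Together with G this generates the larger group.

    The three claims translate into these terms because the vertices, the face
    points and the edge points of each solid form single orbits, so that the
    unions of orbits are exactly the invariant sets ([union_of_orbitsP]), and
    because one cube and exactly two dodecahedra, mirror images of each other,
    contain the tetrahedron ([cube_position], [dodecahedron_position]). The faces
    and edges of a solid are found from one vertex: a plane supporting the solid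
    there has a normal in the cone of the three face normals
    ([exposed_at_corner]).

    G is the alternating group because it acts faithfully on the four vertices
    and the sign of the permutation is the determinant ([perm_rot_det]).

    Finally, the rotation group of the cube is the union of two cosets of G and
    that of the dodecahedron the union of the five cosets of the powers of a turn
    of one face ([cube_groupP], [dodecahedron_groupP]). Each orbit is therefore
    the union of two or five orbits of G; for vertices, face points and edge
    points the coincidences among these are read off in coordinates that make
    the labelled face a standard one ([labelled_square], [labelled_pentagon]). *)

Section TetrahedralSymmetry.
Context {R : realType}.

(** * Rotations of three-space *)

Section LinearAlgebra.
Implicit Types (u v w : 'rV[R]_3) (r s : 'M[R]_3).

Definition mx3 (a b c d e f g h i : R) : 'M[R]_3 :=
  \matrix_(j, k) nth 0 (nth [::] [:: [:: a; b; c]; [:: d; e; f]; [:: g; h; i]] j) k.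

Lemma ord3P (i : 'I_3) : [\/ i = 0, i = 1 | i = 2%:R].
Proof.
by case: i => [[|[|[|]]]] // hi; [apply: Or31|apply: Or32|apply: Or33]; apply: val_inj.
Qed.

Lemma vec3E (a b c : R) :
  (vec3 a b c 0 0 = a) * (vec3 a b c 0 1 = b) * (vec3 a b c 0 2%:R = c).
Proof. by rewrite !mxE. Qed.

Lemma vec3_eta v : v = vec3 (v 0 0) (v 0 1) (v 0 2%:R).
Proof.
by apply/rowP => i; rewrite mxE; case: (ord3P i) => ->.
Qed.

Lemma vec3_inj (a b c : R) a' b' c' :
  vec3 a b c = vec3 a' b' c' :> 'rV[R]_3 -> [/\ a = a', b = b' & c = c'].
Proof.
move=> e; have := (vec3E a b c, vec3E a' b' c'); rewrite e.
by case=> -[[-> ->] ->] [[-> ->] ->].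
Qed.

Lemma mx3_eta r : r = mx3 (r 0 0) (r 0 1) (r 0 2%:R) (r 1 0) (r 1 1) (r 1 2%:R)
   (r 2%:R 0) (r 2%:R 1) (r 2%:R 2%:R).
Proof.
by apply/matrixP => i j; rewrite mxE; case: (ord3P i) => ->; case: (ord3P j) => ->.
Qed.

Lemma vec3P v : exists x y z, v = vec3 x y z.
Proof. by exists (v 0 0), (v 0 1), (v 0 2%:R); exact: vec3_eta. Qed.

Lemma mx3P r : exists a b c d e f g h i, r = mx3 a b c d e f g h i.
Proof. by do 9!eexists; exact: mx3_eta. Qed.

Lemma sum3 (F : 'I_3 -> R) : \sum_(i < 3) F i = F 0 + F 1 + F 2%:R.
Proof.
rewrite !big_ord_recr big_ord0 /= add0r.
by congr (F _ + F _ + F _); apply: val_inj.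
Qed.

Lemma vec3_mul (x y z : R) a b c d e f g h i :
  vec3 x y z *m mx3 a b c d e f g h i =
  vec3 (x * a + y * d + z * g) (x * b + y * e + z * h) (x * c + y * f + z * i).
Proof.
by apply/rowP => k; rewrite mxE sum3; case: (ord3P k) => ->; rewrite !mxE.
Qed.

Lemma mx3_mul a b c d e f g h i a' b' c' d' e' f' g' h' i' :
  mx3 a b c d e f g h i *m mx3 a' b' c' d' e' f' g' h' i' =
  mx3 (a * a' + b * d' + c * g') (a * b' + b * e' + c * h') (a * c' + b * f' + c * i')
      (d * a' + e * d' + f * g') (d * b' + e * e' + f * h') (d * c' + e * f' + f * i')
      (g * a' + h * d' + i * g') (g * b' + h * e' + i * h') (g * c' + h * f' + i * i').
Proof.
apply/matrixP => j k; rewrite mxE sum3.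
by case: (ord3P j) => ->; case: (ord3P k) => ->; rewrite !mxE.
Qed.

Lemma mx3_tr a b c d e f g h i :
  (mx3 a b c d e f g h i)^T = mx3 a d g b e h c f i.
Proof.
by apply/matrixP => j k; case: (ord3P j) => ->; case: (ord3P k) => ->; rewrite !mxE.
Qed.

Lemma mx3_1 : 1%:M = mx3 1 0 0 0 1 0 0 0 1.
Proof.
by apply/matrixP => j k; case: (ord3P j) => ->; case: (ord3P k) => ->; rewrite !mxE.
Qed.

Lemma mx3_inj a b c d e f g h i a' b' c' d' e' f' g' h' i' :
  mx3 a b c d e f g h i = mx3 a' b' c' d' e' f' g' h' i' ->
  [/\ [/\ a = a', b = b' & c = c'], [/\ d = d', e = e' & f = f']
    & [/\ g = g', h = h' & i = i']].
Proof.
move=> /matrixP E.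
have E00 := E 0 0; have E01 := E 0 1; have E02 := E 0 2%:R.
have E10 := E 1 0; have E11 := E 1 1; have E12 := E 1 2%:R.
have E20 := E 2%:R 0; have E21 := E 2%:R 1; have E22 := E 2%:R 2%:R.
by rewrite !mxE /= in E00 E01 E02 E10 E11 E12 E20 E21 E22.
Qed.

Lemma mx3_det a b c d e f g h i :
  \det (mx3 a b c d e f g h i) =
  a * (e * i - f * h) - b * (d * i - f * g) + c * (d * h - e * g).
Proof.
rewrite (expand_det_row _ 0) sum3 /cofactor !(expand_det_row _ 0).
rewrite !big_ord_recr !big_ord0 /= /cofactor !det_mx11 !mxE /=.
rewrite ?expr0 ?expr1; ring.
Qed.

Lemma dotE (a b c : R) a' b' c' :
  dot (vec3 a b c) (vec3 a' b' c') = a * a' + b * b' + c * c' :> R.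
Proof. by rewrite /dot sum3 !mxE. Qed.

Lemma dotC u v : dot u v = dot v u.
Proof. by apply: eq_bigr => i _; rewrite mulrC. Qed.

Lemma dotDl u v w : dot (u + v) w = dot u w + dot v w.
Proof. by rewrite /dot -big_split; apply: eq_bigr => i _; rewrite mxE mulrDl. Qed.

Lemma dotZl a u v : dot (a *: u) v = a * dot u v.
Proof. by rewrite /dot mulr_sumr; apply: eq_bigr => i _; rewrite mxE mulrA. Qed.

Lemma dotDr u v w : dot w (u + v) = dot w u + dot w v.
Proof. by rewrite dotC dotDl !(dotC w). Qed.

Lemma dotZr a u v : dot u (a *: v) = a * dot u v.
Proof. by rewrite dotC dotZl dotC. Qed.

Lemma dotNl u v : dot (- u) v = - dot u v.
Proof. by rewrite -scaleN1r dotZl mulN1r. Qed.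

Lemma dot0l v : dot 0 v = 0.
Proof. by rewrite -(scale0r 0) dotZl mul0r. Qed.

Lemma dot_mxE u v : dot u v = (u *m v^T) 0 0.
Proof. by rewrite mxE; apply: eq_bigr => i _; rewrite mxE. Qed.

Lemma dot_eq0 v : dot v v = 0 -> v = 0.
Proof.
move=> e; apply/rowP => i; rewrite mxE; apply/eqP; rewrite -sqrf_eq0; apply/eqP.
by apply: (psumr_eq0P _ e) => // j _; exact: sqr_ge0.
Qed.

Definition orthogonal r := r *m r^T = 1%:M.

Lemma orthogonal_tr r : orthogonal r -> r^T *m r = 1%:M.
Proof. exact: mulmx1C. Qed.

Lemma orthogonalT r : orthogonal r -> orthogonal r^T.
Proof. by move=> or; rewrite /orthogonal trmxK orthogonal_tr. Qed.

Lemma orthogonalM r s : orthogonal r -> orthogonal s -> orthogonal (r *m s).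
Proof. by move=> or os; rewrite /orthogonal trmx_mul mulmxA -(mulmxA r) os mulmx1. Qed.

Lemma dot_orthogonal r u v : orthogonal r -> dot (u *m r) (v *m r) = dot u v.
Proof.
by move=> or; rewrite !dot_mxE trmx_mul mulmxA -(mulmxA u) or mulmx1.
Qed.

Lemma dot_mulmx_tr r u v : dot (u *m r) v = dot u (v *m r^T).
Proof. by rewrite !dot_mxE trmx_mul trmxK mulmxA. Qed.

Lemma orthogonalK r v : orthogonal r -> v *m r *m r^T = v.
Proof. by move=> or; rewrite -mulmxA or mulmx1. Qed.

Lemma orthogonalKV r v : orthogonal r -> v *m r^T *m r = v.
Proof. by move=> or; rewrite -mulmxA orthogonal_tr// mulmx1. Qed.

Lemma is_rotation1 : is_rotation (1%:M : 'M[R]_3).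
Proof. by split; rewrite ?trmx1 ?mulmx1 ?det1. Qed.

Lemma is_rotationT r : is_rotation r -> is_rotation r^T.
Proof. by move=> [/orthogonalT or dr]; split=> //; rewrite det_tr. Qed.

Lemma is_rotationM r s : is_rotation r -> is_rotation s -> is_rotation (r *m s).
Proof.
by move=> [or dr] [os ds]; split; [exact: orthogonalM|rewrite det_mulmx dr ds mul1r].
Qed.

Lemma is_rotation_conj q r :
  orthogonal q -> is_rotation r -> is_rotation (q^T *m r *m q).
Proof.
move=> oq [or dr]; split.
  by apply: orthogonalM => //; apply: orthogonalM => //; apply: orthogonalT.
by rewrite !det_mulmx dr mulr1 mulrC -det_mulmx oq det1.
Qed.

Lemma orthogonal_det r : orthogonal r -> \det r = 1 \/ \det r = -1.
Proof.
move=> or; have : \det r ^+ 2 == 1 by rewrite expr2 -{2}det_tr -det_mulmx or det1.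
by rewrite sqrf_eq1 => /orP[]/eqP; [left|right].
Qed.

(** The inverse of a rotation matrix is both its transpose and its adjugate. *)
Lemma rotation_cofactor a b c d e f g h i :
  is_rotation (mx3 a b c d e f g h i) ->
  [/\ [/\ a = e * i - f * h, b = f * g - d * i & c = d*h-e*g],
      [/\ d = c * h - b * i, e = a * i - c * g & f = b*g-a*h]
    & [/\ g = b*f-c*e, h = c*d-a*f & i = a*e-b*d]].
Proof.
move=> [or dr].
have cofE : mx3 (e * i - f * h) (c * h - b * i) (b*f-c*e) (f * g - d * i) (a * i - c * g) (c*d-a*f)
  (d*h-e*g) (b*g-a*h) (a*e-b*d) *m mx3 a b c d e f g h i = 1%:M.
  rewrite mx3_det in dr; rewrite mx3_mul mx3_1.
  congr mx3; first [ring | rewrite -dr; ring].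
have : mx3 (e * i - f * h) (c * h - b * i) (b*f-c*e) (f * g - d * i) (a * i - c * g) (c*d-a*f)
  (d*h-e*g) (b*g-a*h) (a*e-b*d) = (mx3 a b c d e f g h i)^T.
  by rewrite -[LHS]mulmx1 -or mulmxA cofE mul1mx.
by rewrite mx3_tr => /mx3_inj[[-> -> ->] [-> -> ->] [-> -> ->]].
Qed.

Definition cross u v : 'rV[R]_3 :=
  vec3 (u 0 1 * v 0 2%:R - u 0 2%:R * v 0 1) (u 0 2%:R * v 0 0 - u 0 0 * v 0 2%:R)
       (u 0 0 * v 0 1 - u 0 1 * v 0 0).

Lemma cross_rotation r u v :
  is_rotation r -> cross (u *m r) (v *m r) = cross u v *m r.
Proof.
have [a [b [c [d [e [f [g [h [i ->]]]]]]]]] := mx3P r.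
have [x [y [z ->]]] := vec3P u; have [x' [y' [z' ->]]] := vec3P v.
move=> /rotation_cofactor[[Ea Eb Ec] [Ed Ee Ef] [Eg Eh Ei]].
rewrite !vec3_mul /cross !vec3E.
by congr vec3; [rewrite Ea Ed Eg|rewrite Eb Ee Eh|rewrite Ec Ef Ei]; ring.
Qed.

(** The linear span of [u], [v] and their cross product is everything, so two
    independent fixed vectors leave no freedom to a rotation. *)
Lemma rotation_fix2 r u v :
  is_rotation r -> cross u v != 0 -> u *m r = u -> v *m r = v -> r = 1%:M.
Proof.
move=> rr uv0 ru rv; have rw := cross_rotation u v rr; rewrite ru rv in rw.
set w := cross u v in uv0 rw.
have dw : dot w w != 0 by apply: contra_neq uv0 => /dot_eq0.
have e (x : 'rV[R]_3) : dot w w *: x = (dot x u * dot v v - dot x v * dot u v) *: u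
    + (dot x v * dot u u - dot x u * dot u v) *: v + dot x w *: w.
  rewrite /w /cross (vec3_eta x) (vec3_eta u) (vec3_eta v).
  move: (x 0 0) (x 0 1) (x 0 2%:R) (u 0 0) (u 0 1) (u 0 2%:R).
  move: (v 0 0) (v 0 1) (v 0 2%:R) => v0 v1 v2 x0 x1 x2 u0 u1 u2.
  rewrite !dotE !vec3E; apply/rowP => k; rewrite !mxE.
  by case: (ord3P k) => -> /=; ring.
have rx (x : 'rV[R]_3) : x *m r = x.
  apply: (scalerI dw); rewrite scalemxAl (e x).
  by rewrite !mulmxDl -!scalemxAl ru rv -rw.
by apply/row_matrixP => k; rewrite rowE rx row1.
Qed.
End LinearAlgebra.

(** * Symmetries of a vertex set *)

Section RotationGroups.
Implicit Types (u v w n : 'rV[R]_3) (q r : 'M[R]_3) (V F : set 'rV[R]_3).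

Definition mulset V r := [set v *m r | v in V].

Lemma mulset1 V : mulset V 1%:M = V.
Proof.
apply/seteqP; split=> [v [u Vu <-]|v Vv]; first by rewrite mulmx1.
by exists v; rewrite ?mulmx1.
Qed.

Lemma mulsetM V q r : mulset (mulset V q) r = mulset V (q *m r).
Proof.
rewrite /mulset image_comp; apply: eq_imagel => v _ /=.
by rewrite mulmxA.
Qed.

Lemma finite_mulset V r : finite_set V -> finite_set (mulset V r).
Proof. exact: finite_image. Qed.

Lemma mulset_seq (s : seq 'rV[R]_3) r : mulset [set` s] r = [set` map (mulmxr r) s].
Proof.
apply/seteqP; split=> v /=; first by move=> [u us <-]; apply/mapP; exists u.
by move=> /mapP[u us ->]; exists u.
Qed.

Lemma rotation_group1 V : rotation_group V 1%:M.
Proof. by split; [exact: is_rotation1|exact: mulset1]. Qed.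

Lemma rotation_groupM V q r :
  rotation_group V q -> rotation_group V r -> rotation_group V (q *m r).
Proof.
move=> [rq Vq] [rr Vr]; split; first exact: is_rotationM.
by rewrite -/(mulset _ _) -mulsetM /mulset Vq.
Qed.

Lemma rotation_groupT V r : rotation_group V r -> rotation_group V r^T.
Proof.
move=> [rr Vr]; split; first exact: is_rotationT.
by rewrite -{1}Vr -!/(mulset _ _) mulsetM rr.1 mulset1.
Qed.

Lemma rotation_group_mem V r v : rotation_group V r -> V v -> V (v *m r).
Proof. by move=> [_ Vr] Vv; rewrite -Vr; exists v. Qed.

Lemma rotation_groupX V r k : rotation_group V r -> rotation_group V (r ^+ k).
Proof.
move=> rr; elim: k => [|k IH]; first by rewrite expr0; exact: rotation_group1.
by rewrite exprS; exact: rotation_groupM.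
Qed.

(** The inverse of an element of finite order is one of its powers, so one
    inclusion suffices. *)
Lemma rotation_group_order V r k : is_rotation r -> r ^+ k.+1 = 1 ->
  (forall v, V v -> V (v *m r)) -> rotation_group V r.
Proof.
move=> rr rk Vr; split=> //; apply/seteqP; split=> [_ [v Vv <-]|v Vv].
  exact: Vr.
exists (v *m r ^+ k); last by rewrite -mulmxA -[r ^+ k *m r]/(r ^+ k * r) -exprSr rk mulmx1.
elim: k {rk} => [|k IH]; first by rewrite expr0 mulmx1.
by rewrite exprSr mulmxA; exact: Vr.
Qed.

Lemma conj_mulmx q (a b : 'M[R]_3) : orthogonal q ->
  (q^T *m a *m q) *m (q^T *m b *m q) = q^T *m (a *m b) *m q.
Proof. by move=> oq; rewrite !mulmxA -(mulmxA _ q q^T) oq mulmx1. Qed.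

Lemma conjmxK q r : orthogonal q -> q *m (q^T *m r *m q) *m q^T = r.
Proof. by move=> oq; rewrite !mulmxA oq mul1mx -mulmxA oq mulmx1. Qed.

Lemma conjmxKV q r : orthogonal q -> q^T *m (q *m r *m q^T) *m q = r.
Proof. by move=> oq; rewrite !mulmxA orthogonal_tr // mul1mx -mulmxA orthogonal_tr // mulmx1. Qed.

Lemma rotation_group_similar V (s : R) q r : s != 0 -> orthogonal q ->
  rotation_group (mulset V (s *: q)) r <-> rotation_group V (q *m r *m q^T).
Proof.
move=> s0 oq; have oqT := orthogonalT oq.
rewrite -{1}(conjmxKV r oq); move: (q *m r *m q^T) => {}r.
have E : mulset (mulset V (s *: q)) (q^T *m r *m q) = mulset (mulset V r) (s *: q).
  rewrite !mulsetM; congr mulset.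
  by rewrite -scalemxAl !mulmxA oq mul1mx -scalemxAr.
split=> -[rr Vr]; last first.
  split; first exact: is_rotation_conj.
  by rewrite -/(mulset _ _) E /mulset Vr.
split.
  by have := is_rotation_conj oqT rr; rewrite trmxK conjmxK.
have := congr1 (fun W => mulset W (s^-1 *: q^T)) Vr.
rewrite -!/(mulset _ _) E !mulsetM -!scalemxAl -?scalemxAr !scalerA !divff //.
by rewrite !scale1r !oq mulset1 mulmx1.
Qed.

Lemma rot_orbitM V X r : rotation_group V r -> rot_orbit V (X *m r) = rot_orbit V X.
Proof.
move=> rr; apply/seteqP; split=> _ [t rt <-].
  by exists (r *m t); [exact: rotation_groupM|rewrite mulmxA].
exists (r^T *m t); first by apply: rotation_groupM => //; exact: rotation_groupT.
by rewrite !mulmxA -(mulmxA X) rr.1.1 mulmx1.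
Qed.

Lemma rot_orbit_refl V X : rot_orbit V X X.
Proof. by exists 1%:M; rewrite ?mulmx1 //; exact: rotation_group1. Qed.

Lemma rot_orbit_mem V X Y : rot_orbit V X Y -> rot_orbit V X = rot_orbit V Y.
Proof. by move=> [r rr <-]; rewrite rot_orbitM. Qed.

Lemma exposedM V F r : rotation_group V r -> exposed V F -> exposed V (mulset F r).
Proof.
move=> rr [n [c [n0 nV ->]]]; have or := rr.1.1.
exists (n *m r), c; split.
- apply: contra_neq n0 => /(congr1 (mulmx^~ r^T)).
  by rewrite orthogonalK // mul0mx.
- move=> v Vv; rewrite dot_mulmx_tr; apply: nV.
  by apply: rotation_group_mem Vv; exact: rotation_groupT.
apply/seteqP; split=> [_ [v [Vv vc] <-]|v [Vv vc]].
  by split; [exact: rotation_group_mem|rewrite dot_orthogonal].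
exists (v *m r^T); last exact: orthogonalKV.
split; last by rewrite -dot_mulmx_tr.
by apply: rotation_group_mem Vv; exact: rotation_groupT.
Qed.

Lemma orthogonal_inj r u v : orthogonal r -> u *m r = v *m r -> u = v.
Proof. by move=> or /(congr1 (mulmx^~ r^T)); rewrite !orthogonalK. Qed.

Lemma is_faceM V F r : rotation_group V r -> is_face V F -> is_face V (mulset F r).
Proof.
move=> rr [eF [x [y [z [[Fx Fy Fz] [xy yz xz]]]]]]; split; first exact: exposedM.
exists (x *m r), (y *m r), (z *m r); split; first by split; [exists x|exists y|exists z].
by split; [apply: contra_neq xy|apply: contra_neq yz|apply: contra_neq xz];
  exact: (orthogonal_inj rr.1.1).
Qed.

Lemma is_edgeM V u v r :
  rotation_group V r -> is_edge V u v -> is_edge V (u *m r) (v *m r).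
Proof.
move=> rr [uv eF]; split.
  by apply: contra_neq uv; exact: (orthogonal_inj rr.1.1).
have := exposedM rr eF; congr exposed; rewrite /mulset image_setU !image_set1 //.
Qed.

Lemma radial_projZ (s : R) v : 0 < s -> radial_proj (s *: v) = radial_proj v.
Proof.
move=> s0; rewrite /radial_proj dotZl dotZr mulrA -expr2.
rewrite sqrtrM ?sqr_ge0 // sqrtr_sqr gtr0_norm // scalerA invfM.
by rewrite mulrAC mulVf ?mul1r // gt_eqF.
Qed.

Lemma radial_proj_orthogonal r v :
  orthogonal r -> radial_proj (v *m r) = radial_proj v *m r.
Proof. by move=> or; rewrite /radial_proj dot_orthogonal // -scalemxAl. Qed.

Lemma radial_proj_similar (s : R) r v : 0 < s -> orthogonal r ->
  radial_proj (v *m (s *: r)) = radial_proj v *m r.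
Proof.
by move=> s0 or; rewrite -scalemxAr radial_projZ // radial_proj_orthogonal.
Qed.

Lemma midpointM u v r : midpoint (u *m r) (v *m r) = midpoint u v *m r.
Proof. by rewrite /midpoint -mulmxDl -scalemxAl. Qed.

Lemma midpointC u v : midpoint u v = midpoint v u.
Proof. by rewrite /midpoint addrC. Qed.

Lemma centroid_seq (s : seq 'rV[R]_3) : uniq s ->
  centroid [set` s] = (size s)%:R^-1 *: \sum_(v <- s) v.
Proof.
move=> us; rewrite /centroid -fsbig_seq //; congr (_%:R^-1 *: _).
have -> : [set` s] = [set` [fset x in s]%fset].
  by apply/seteqP; split=> x /=; rewrite inE.
by rewrite set_fsetK card_fseq undup_id.
Qed.

Lemma centroidM F r : finite_set F -> (forall u v, u *m r = v *m r -> u = v) ->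
  centroid (mulset F r) = centroid F *m r.
Proof.
move=> /finite_seqP[s0 ->] rI.
have -> : [set` s0] = [set` undup s0].
  by apply/seteqP; split=> v /=; rewrite mem_undup.
have := undup_uniq s0; move: (undup s0) => s us.
rewrite mulset_seq !centroid_seq //; last by rewrite map_inj_uniq.
by rewrite size_map big_map -scalemxAl mulmx_suml.
Qed.

End RotationGroups.

(** * Faces and edges seen from one vertex *)

Section Corner.
Implicit Types (u v w m n : 'rV[R]_3) (c q r : 'M[R]_3) (V F : set 'rV[R]_3).

(** A vertex [v0] of degree three: [c] turns the solid about [v0], [m] is the
    outward normal of a face at [v0], and [w] the neighbour of [v0] on the edge
    which that face shares with its image under [c]. By [corner_trans] these
    data determine all faces and edges. *)
Record regular_corner V v0 w m (d : R) c : Prop := RegularCorner {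
  corner_finite : finite_set V;
  corner_vertex : V v0;
  corner_neighbour : V w;
  corner_trans : forall v, V v -> exists2 r, rotation_group V r & v = v0 *m r;
  corner_rot : rotation_group V c;
  corner_cube : c *m c *m c = 1%:M;
  corner_fix : v0 *m c = v0;
  corner_le : forall v, V v -> dot m v <= d;
  corner_on : dot m v0 = d;
  corner_edge1 : dot m w = d;
  corner_edge2 : dot (m *m c) w = d;
  corner_off : dot (m *m c *m c) w < d;
  corner_meet : forall v, V v -> dot m v = d -> dot (m *m c) v = d -> v = v0 \/ v = w;
  corner_span : forall n, exists x y z,
    n = x *: m + y *: (m *m c) + z *: (m *m c *m c)
}.

Definition support_face V m d : set 'rV[R]_3 := [set v | V v /\ dot m v = d].

Lemma support_face_similar V m d (s : R) q : 0 < s -> orthogonal q ->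
  support_face (mulset V (s *: q)) (m *m q) (s * d) =
  mulset (support_face V m d) (s *: q).
Proof.
move=> s0 oq; have sn0 : s != 0 by rewrite gt_eqF.
have ds u v : dot (u *m q) (v *m (s *: q)) = s * dot u v.
  by rewrite -scalemxAr dotZr dot_orthogonal.
apply/seteqP; split=> [_ [[v Vv <-] E]|_ [v [Vv E] <-]].
  by exists v => //; split=> //; apply: (mulfI sn0); rewrite -ds.
by split; [exists v|rewrite ds E].
Qed.

Section FaceAtCorner.
Context (V : set 'rV[R]_3) (v0 w m : 'rV[R]_3) (d : R) (c : 'M[R]_3).
Context (C : regular_corner V v0 w m d c).

Let cT : c^T = c *m c.
Proof.
have oc := (corner_rot C).1.1.
by rewrite -[LHS]mul1mx -(corner_cube C) -(mulmxA _ c) oc mulmx1.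
Qed.

Let ccc v : v *m c *m c *m c = v.
Proof. by rewrite -!mulmxA (mulmxA c) (corner_cube C) mulmx1. Qed.

Let dotc u v : dot (u *m c) v = dot u (v *m c *m c).
Proof. by rewrite dot_mulmx_tr cT mulmxA. Qed.

Let dotcc u v : dot (u *m c) (v *m c) = dot u v.
Proof. by rewrite dotc ccc. Qed.

Let Vc v : V v -> V (v *m c).
Proof. by apply: rotation_group_mem; exact: corner_rot C. Qed.

Let mccc : m *m c *m c *m c = m. Proof. exact: ccc. Qed.

(** The three faces at [v0] play the same role. *)
Lemma corner_shift : regular_corner V v0 (w *m c) (m *m c) d c.
Proof.
case: C => fV Vv0 Vw tr rc c3 fx le on e1 e2 off meet span; split=> //.
- exact: Vc.
- by move=> v Vv; rewrite dotc; apply/le/Vc/Vc.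
- by rewrite -fx dotcc.
- by rewrite dotcc.
- by rewrite dotcc.
- by rewrite ccc -[X in dot X _]ccc dotcc.
- move=> v Vv; rewrite dotc => mv; rewrite dotc => mcv.
  by case: (meet _ (Vc (Vc Vv)) mv mcv) => E; [left|right]; rewrite -[v]ccc E ?fx.
- by move=> n; have [x [y [z ->]]] := span n; exists y, z, x; rewrite mccc [RHS]addrC addrA.
Qed.

Lemma corner_third : dot m (w *m c) < d.
Proof. by rewrite -2!dotcc ccc; exact: corner_off C. Qed.

Lemma support_faceM : mulset (support_face V m d) c = support_face V (m *m c) d.
Proof.
apply/seteqP; split=> [_ [v [Vv mv] <-]|v [Vv mv]].
  by split; [exact: Vc|rewrite dotcc].
by exists (v *m c *m c); [split; [exact/Vc/Vc|rewrite -dotc]|exact: ccc].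
Qed.

Lemma corner_distinct :
  [/\ v0 != w, w != w *m c *m c & v0 != w *m c *m c].
Proof.
have wv : v0 != w.
  apply/eqP => E; have := corner_third; rewrite -E (corner_fix C).
  by rewrite (corner_on C) ltxx.
split=> //.
  apply/eqP => E; have := corner_off C; rewrite E.
  by rewrite !dotcc (corner_edge1 C) ltxx.
apply: contra_neq wv => E; rewrite -(corner_fix C) E; exact: ccc.
Qed.

Lemma support_face_vertices : [/\ support_face V m d v0, support_face V m d w
  & support_face V m d (w *m c *m c)].
Proof.
split; split; rewrite ?(corner_on C) ?(corner_edge1 C) //.
- exact: corner_vertex C.
- exact: corner_neighbour C.
- by apply/Vc/Vc; exact: corner_neighbour C.
- by rewrite -dotc (corner_edge2 C).
Qed.

Lemma support_face_is_face : is_face V (support_face V m d).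
Proof.
have [wv ww vw] := corner_distinct; have [F0 F1 F2] := support_face_vertices.
split; last by exists v0, w, (w *m c *m c).
exists m, d; split=> //; last exact: corner_le C.
apply/eqP => m0; have := corner_third; have := corner_edge1 C.
by rewrite m0 !dot0l => <-; rewrite ltxx.
Qed.

(** The sum of the normals of two faces supports their common edge. *)
Lemma corner_is_edge : is_edge V v0 w.
Proof.
have [wv _ _] := corner_distinct; split=> //.
have lec v : V v -> dot (m *m c) v <= d by move=> Vv; rewrite dotc; apply/(corner_le C)/Vc/Vc.
exists (m + m *m c), (d + d); split.
- apply/eqP => m0; have := corner_third.
  have : dot (m + m *m c) (w *m c) < dot (m + m *m c) w.
    rewrite !dotDl (corner_edge1 C) (corner_edge2 C) dotcc (corner_edge1 C).
    by rewrite ltrD2r; exact: corner_third.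
  by rewrite m0 !dot0l ltxx.
- by move=> v Vv; rewrite dotDl; apply: lerD; [apply: (corner_le C)|apply: lec].
apply/seteqP; split=> [v [->|->]|v [Vv]].
- split; first exact: corner_vertex C.
  by rewrite dotDl -{2}(corner_fix C) dotcc (corner_on C).
- split; first exact: corner_neighbour C.
  by rewrite dotDl (corner_edge1 C) (corner_edge2 C).
rewrite dotDl => E; have L1 := corner_le C Vv; have L2 := lec _ Vv.
by apply: (corner_meet C) => //; lra.
Qed.

End FaceAtCorner.

Lemma corner_shiftX V v0 w m d c k : regular_corner V v0 w m d c ->
  regular_corner V v0 (w *m c ^+ k) (m *m c ^+ k) d c.
Proof.
move=> C; elim: k => [|k IH]; first by rewrite expr0 !mulmx1.
by rewrite exprSr -[_ * c]/(_ *m c) !mulmxA; exact: corner_shift IH.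
Qed.

Lemma corner_fixX V v0 w m d c k : regular_corner V v0 w m d c -> v0 *m c ^+ k = v0.
Proof.
move=> C; elim: k => [|k IH]; first by rewrite expr0 mulmx1.
by rewrite exprSr -[_ * c]/(_ *m c) mulmxA IH (corner_fix C).
Qed.

Lemma support_faceX V v0 w m d c k : regular_corner V v0 w m d c ->
  mulset (support_face V m d) (c ^+ k) = support_face V (m *m c ^+ k) d.
Proof.
move=> C; elim: k => [|k IH]; first by rewrite expr0 mulmx1 mulset1.
rewrite exprSr -[_ * c]/(_ *m c) -mulsetM mulmxA IH.
exact: (support_faceM (corner_shiftX k C)).
Qed.

(** A normal [n] of a supporting plane through [v0] is a combination of the
    three face normals at [v0]; testing it on the three neighbours of [v0] shows
    that the coefficients are nonnegative, so the plane meets [V] in the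
    intersection of those of the three faces whose coefficient is positive. *)
Lemma exposed_at_corner V v0 w m d c F :
  regular_corner V v0 w m d c -> exposed V F -> F v0 ->
  exists k, F = mulset (support_face V m d) (c ^+ k) \/
            F `<=` [set v0; w *m c ^+ k].
Proof.
move=> C [n [e [n0 nV FE]]] Fv0.
have [Vv0 nv0] : V v0 /\ dot n v0 = e by move: Fv0; rewrite FE.
have key x y z w' m' : regular_corner V v0 w' m' d c ->
    n = x *: m' + y *: (m' *m c) + z *: (m' *m c *m c) -> 0 <= z.
  move=> C' nE; have := nV _ (corner_neighbour C').
  have C2 := corner_shift C'; have C3 := corner_shift C2.
  have := nv0; rewrite nE !dotDl !dotZl (corner_on C') (corner_on C2) (corner_on C3).
  rewrite (corner_edge1 C') (corner_edge2 C') => <-; have := corner_off C'.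
  rewrite lerD2l => lt le; rewrite leNgt; apply/negP => z0.
  by move: le; rewrite ler_nM2l // leNgt lt.
have main w' m' : regular_corner V v0 w' m' d c -> forall x y z,
    n = x *: m' + y *: (m' *m c) + z *: (m' *m c *m c) -> 0 < x -> 0 <= y -> 0 <= z ->
    F = support_face V m' d \/ F `<=` [set v0; w'] \/ F `<=` [set v0; w' *m c *m c].
  move=> C' x y z nE x0 y0 z0.
  have C2 := corner_shift C'; have C3 := corner_shift C2.
  have eE : e = x * d + y * d + z * d.
    rewrite -nv0 nE !dotDl !dotZl (corner_on C') (corner_on C2) (corner_on C3) //.
  have Fon v : F v -> [/\ V v, dot m' v = d, 0 < y -> dot (m' *m c) v = d
      & 0 < z -> dot (m' *m c *m c) v = d].
    rewrite FE => -[Vv]; rewrite eE nE !dotDl !dotZl.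
    have := corner_le C' Vv; have := corner_le C2 Vv; have := corner_le C3 Vv.
    move: (dot m' v) (dot (m' *m c) v) (dot (m' *m c *m c) v) => p1 p2 p3 l3 l2 l1 E.
    have h1 : 0 <= x * (d - p1) by apply: mulr_ge0; lra.
    have h2 : 0 <= y * (d - p2) by apply: mulr_ge0; lra.
    have h3 : 0 <= z * (d - p3) by apply: mulr_ge0; lra.
    have k1 : x * (d - p1) = 0 by lra.
    have k2 : y * (d - p2) = 0 by lra.
    have k3 : z * (d - p3) = 0 by lra.
    split=> //.
    - by move/eqP: k1; rewrite mulf_eq0 gt_eqF //= subr_eq0 => /eqP.
    - by move=> y1; move/eqP: k2; rewrite mulf_eq0 gt_eqF //= subr_eq0 => /eqP.
    - by move=> z1; move/eqP: k3; rewrite mulf_eq0 gt_eqF //= subr_eq0 => /eqP.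
  move: y0; rewrite le_eqVlt => /orP[/eqP y0|y0]; last first.
    right; left=> v /Fon[Vv e1 e2 _].
    by apply: (corner_meet C' Vv e1); exact: e2.
  move: z0; rewrite le_eqVlt => /orP[/eqP z0|z0]; last first.
    right; right=> v /Fon[Vv e1 _ e2].
    apply: (corner_meet C3 Vv); first exact: e2.
    have -> : m' *m c *m c *m c = m' by rewrite -!mulmxA (mulmxA c) (corner_cube C') mulmx1.
    exact: e1.
  left; apply/seteqP; split=> [v /Fon[]//|v [Vv mv]].
  by rewrite FE; split=> //; rewrite nE eE -y0 -z0 !scale0r !mul0r !addr0 dotZl mv.
have [x [y [z nE]]] := corner_span C n.
have ccc (u : 'rV_3) : u *m c *m c *m c = u.
  by rewrite -!mulmxA (mulmxA c) (corner_cube C) mulmx1.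
have nE1 : n = y *: (m *m c) + z *: (m *m c *m c) + x *: (m *m c *m c *m c).
  by rewrite ccc nE [RHS]addrC addrA.
have nE2 : n = z *: (m *m c *m c) + x *: (m *m c *m c *m c)
    + y *: (m *m c *m c *m c *m c).
  by rewrite !ccc nE [RHS]addrC addrA [RHS]addrC addrA.
have C1 := corner_shift C; have C2 := corner_shift C1; have C3 := corner_shift C2.
have z0 := key _ _ _ _ _ C nE; have x0 := key _ _ _ _ _ C1 nE1.
have y0 := key _ _ _ _ _ C2 nE2.
have fin j : F = support_face V (m *m c ^+ j) d \/ F `<=` [set v0; w *m c ^+ j] \/
    F `<=` [set v0; w *m c ^+ j *m c *m c] ->
    exists k, F = mulset (support_face V m d) (c ^+ k) \/ F `<=` [set v0; w *m c ^+ k].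
  case=> [->|[h|h]].
  - by exists j; left; rewrite (support_faceX j C).
  - by exists j; right.
  - by exists j.+2; right; rewrite !exprSr -![_ * c]/(_ *m c) !mulmxA.
have [/eqP xe0|xn0] := boolP (x == 0); last first.
  apply: (fin 0%N); rewrite expr0 !mulmx1; apply: main nE _ _ _ => //.
  by rewrite lt_neqAle eq_sym xn0.
have [/eqP ye0|yn0] := boolP (y == 0); last first.
  apply: (fin 1%N); rewrite expr1; apply: main nE1 _ _ _ => //.
  by rewrite lt_neqAle eq_sym yn0.
have [/eqP ze0|zn0] := boolP (z == 0); last first.
  apply: (fin 2%N); rewrite expr2 -[c * c]/(c *m c) !mulmxA; apply: main nE2 _ _ _ => //.
  by rewrite lt_neqAle eq_sym zn0.
by move: n0; rewrite nE xe0 ye0 ze0 !scale0r !addr0 eqxx.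
Qed.

Section Orbits.
Context (V : set 'rV[R]_3) (v0 w m : 'rV[R]_3) (d : R) (c : 'M[R]_3).
Context (C : regular_corner V v0 w m d c).

Let rcX k : rotation_group V (c ^+ k).
Proof. by apply: rotation_groupX; exact: corner_rot C. Qed.

Lemma face_at_corner F : is_face V F -> F v0 ->
  exists k, F = mulset (support_face V m d) (c ^+ k).
Proof.
move=> [eF [x [y [z [[Fx Fy Fz] [xy yz xz]]]]]] Fv0.
have [k [->|sub]] := exposed_at_corner C eF Fv0; first by exists k.
move: xy yz xz.
by case: (sub _ Fx) => ->; case: (sub _ Fy) => ->; case: (sub _ Fz) => ->; rewrite eqxx.
Qed.

Lemma edge_at_corner u : is_edge V v0 u -> exists k, u = w *m c ^+ k.
Proof.
move=> [vu eF]; have [k [E|sub]] := exposed_at_corner C eF (or_introl erefl).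
  have [F1 F2 F3] := support_face_vertices C; have [n1 n2 n3] := corner_distinct C.
  have oc := (rcX k).1.1.
  have mem x : support_face V m d x -> [set v0; u] (x *m c ^+ k).
    by move=> Fx; rewrite E; exists x.
  have inj (x y : 'rV[R]_3) : x != y -> x *m c ^+ k != y *m c ^+ k.
    by apply: contra_neq; exact: (orthogonal_inj oc).
  move: (inj _ _ n1) (inj _ _ n2) (inj _ _ n3).
  by case: (mem _ F1) => ->; case: (mem _ F2) => ->; case: (mem _ F3) => ->; rewrite eqxx.
exists k; case: (sub u (or_intror erefl)) => // E; by rewrite E eqxx in vu.
Qed.

(** Transitivity on the vertices brings any face to [v0], where [c] permutes
    the faces. *)
Lemma is_faceP F : is_face V F <->
  exists2 r, rotation_group V r & F = mulset (support_face V m d) r.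
Proof.
split=> [fF|[r rr ->]]; last by apply: is_faceM => //; exact: support_face_is_face C.
have [[n [e [_ _ FE]]] [x [_ [_ [[Fx _ _] _]]]]] := fF.
have Vx : V x by move: Fx; rewrite FE => -[].
have [r rr xE] := corner_trans C Vx; have rrT := rotation_groupT rr.
have [|k E] := face_at_corner (is_faceM rrT fF).
  by exists x => //; rewrite xE; exact: (orthogonalK _ rr.1.1).
exists (c ^+ k *m r); first exact: rotation_groupM.
by rewrite -mulsetM -E mulsetM (orthogonal_tr rr.1.1) mulset1.
Qed.

Lemma is_edgeP u v : is_edge V u v <->
  exists2 r, rotation_group V r & u = v0 *m r /\ v = w *m r.
Proof.
split=> [eF|[r rr [-> ->]]]; last by apply: is_edgeM => //; exact: corner_is_edge C.
have Vu : V u.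
  have [_ [n [e [_ _ FE]]]] := eF.
  by have : [set u; v] u by [left]; rewrite FE => -[].
have [r rr uE] := corner_trans C Vu; have rrT := rotation_groupT rr.
have := is_edgeM rrT eF; rewrite uE (orthogonalK _ rr.1.1) => /edge_at_corner[k vE].
exists (c ^+ k *m r); first exact: rotation_groupM.
by rewrite !mulmxA -vE (orthogonalKV _ rr.1.1) (corner_fixX k C).
Qed.

Lemma face_pointsE :
  face_points V = rot_orbit V (radial_proj (centroid (support_face V m d))).
Proof.
have fF : finite_set (support_face V m d).
  by apply: sub_finite_set (corner_finite C) => v [].
have step r : rotation_group V r ->
  radial_proj (centroid (mulset (support_face V m d) r)) =
  radial_proj (centroid (support_face V m d)) *m r.
  move=> rr; rewrite -(radial_proj_orthogonal _ rr.1.1) centroidM // => x y.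
  exact: (orthogonal_inj rr.1.1).
apply/seteqP; split=> [_ [F /is_faceP[r rr ->] <-]|_ [r rr <-]].
  by exists r => //; rewrite step.
by exists (mulset (support_face V m d) r); [apply/is_faceP; exists r|rewrite step].
Qed.

Lemma edge_pointsE : edge_points V = rot_orbit V (radial_proj (midpoint v0 w)).
Proof.
apply/seteqP; split=> [_ [u [v [/is_edgeP[r rr [-> ->]] ->]]]|_ [r rr <-]].
  by exists r => //; rewrite midpointM (radial_proj_orthogonal _ rr.1.1).
exists (v0 *m r), (w *m r); split; first by apply/is_edgeP; exists r.
by rewrite midpointM (radial_proj_orthogonal _ rr.1.1).
Qed.

Lemma verticesE : V = rot_orbit V v0.
Proof.
apply/seteqP; split=> [v /(corner_trans C)[r rr ->]|_ [r rr <-]]; first by exists r.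
by apply: rotation_group_mem rr _; exact: corner_vertex C.
Qed.

(** Every member of the family of orbits is an orbit of the rotation group, so
    its unions are the invariant sets. *)
Lemma union_of_orbitsP alpha : alpha `<=` sphere ->
  union_of_orbits V alpha <->
  forall r x, rotation_group V r -> alpha x -> alpha (x *m r).
Proof.
move=> as_; split=> [[D DV ->] r x rr [B DB Bx]|inv].
  have [X BE] : exists X, B = rot_orbit V X.
    case: (DV _ DB) => [[[->|->]|->]|[X _ <-]]; last by exists X.
    - by eexists; exact: verticesE.
    - by eexists; exact: face_pointsE.
    - by eexists; exact: edge_pointsE.
  exists B => //; move: Bx; rewrite BE => -[s rs <-].
  by exists (s *m r); [exact: rotation_groupM|rewrite mulmxA].
exists [set rot_orbit V X | X in alpha]; last first.
  apply/seteqP; split=> [x ax|x [_ [X aX <-] [r rr <-]]]; last exact: inv.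
  by exists (rot_orbit V x); [exists x|exact: rot_orbit_refl].
move=> _ [X aX <-].
have orb (W : set 'rV[R]_3) Y : W = rot_orbit V Y -> W X -> rot_orbit V X = W.
  by move=> -> /rot_orbit_mem.
have [VX|nV] := pselect (V X); first by left; left; left; exact: orb verticesE VX.
have [FX|nF] := pselect (face_points V X).
  by left; left; right; exact: orb face_pointsE FX.
have [EX|nE] := pselect (edge_points V X).
  by left; right; exact: orb edge_pointsE EX.
by right; exists X => //; split; [exact: as_|case=> [[]|]].
Qed.

Lemma corner_similar (s : R) q : 0 < s -> orthogonal q ->
  regular_corner (mulset V (s *: q)) (v0 *m (s *: q)) (w *m (s *: q))
    (m *m q) (s * d) (q^T *m c *m q).
Proof.
move=> s0 oq; have sn0 : s != 0 by rewrite gt_eqF.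
have rg r : rotation_group V r -> rotation_group (mulset V (s *: q)) (q^T *m r *m q).
  by move=> rr; apply/(rotation_group_similar _ _ sn0 oq); rewrite conjmxK.
have cq r u : u *m (s *: q) *m (q^T *m r *m q) = u *m r *m (s *: q).
  by rewrite -!scalemxAr -!scalemxAl !mulmxA (orthogonalK u oq).
have mq r u : u *m q *m (q^T *m r *m q) = u *m r *m q.
  by rewrite !mulmxA (orthogonalK u oq).
have ds u v : dot (u *m q) (v *m (s *: q)) = s * dot u v.
  by rewrite -scalemxAr dotZr dot_orthogonal.
split.
- exact/finite_mulset/corner_finite/C.
- by exists v0 => //; exact: corner_vertex C.
- by exists w => //; exact: corner_neighbour C.
- move=> _ [v Vv <-]; have [r rr ->] := corner_trans C Vv.
  by exists (q^T *m r *m q); rewrite ?cq //; exact: rg.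
- exact/rg/corner_rot/C.
- by rewrite !conj_mulmx // (corner_cube C) mulmx1 orthogonal_tr.
- by rewrite cq (corner_fix C).
- by move=> _ [v Vv <-]; rewrite ds ler_pM2l //; exact: (corner_le C Vv).
- by rewrite ds (corner_on C).
- by rewrite ds (corner_edge1 C).
- by rewrite mq ds (corner_edge2 C).
- by rewrite !mq ds ltr_pM2l //; exact: corner_off C.
- move=> _ [v Vv <-]; rewrite mq !ds => /(mulfI sn0) e1 /(mulfI sn0) e2.
  by case: (corner_meet C Vv e1 e2) => ->; [left|right].
move=> n; have [x [y [z E]]] := corner_span C (n *m q^T); exists x, y, z.
by rewrite !mq -[LHS](orthogonalKV n oq) E !mulmxDl -!scalemxAl.
Qed.

End Orbits.

End Corner.

Local Notation phi := (golden : R).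
Local Notation T0 := (std_tetrahedron : set 'rV[R]_3).
Local Notation C0 := (std_cube : set 'rV[R]_3).
Local Notation D0 := (std_dodecahedron : set 'rV[R]_3).
Local Notation v111 := (vec3 1 1 1 : 'rV[R]_3).
Local Notation sc := ((Num.sqrt 3)^-1 : R).

(** * Coordinates of the three solids *)

Section Solids.
Implicit Types (u v w : 'rV[R]_3) (r : 'M[R]_3) (x y z s t : R).

Lemma golden_sqr : phi ^+ 2 = phi + 1.
Proof.
rewrite /golden; set s := Num.sqrt 5; have : s ^+ 2 = 5 by rewrite sqr_sqrtr.
by move=> e; field: e.
Qed.

Lemma golden_bounds : 8/5 < phi < 17/10.
Proof.
have s0 : 0 <= Num.sqrt 5 :> R by exact: sqrtr_ge0.
have s2 : Num.sqrt 5 ^+ 2 = 5 :> R by rewrite sqr_sqrtr.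
have : 22/10 < Num.sqrt 5 :> R by nra.
have : Num.sqrt 5 < 24/10 :> R by nra.
by rewrite /golden => *; lra.
Qed.

Lemma goldenV : phi^-1 = phi - 1.
Proof.
have /andP[p0 _] := golden_bounds; have pn : phi != 0 by rewrite gt_eqF //; lra.
by apply: (mulfI pn); rewrite divff //; have e := golden_sqr; ring: e.
Qed.

Lemma sqr_eq1 x : x ^+ 2 = 1 <-> x = 1 \/ x = -1.
Proof.
split=> [/eqP|[]->]; rewrite ?sqrrN ?expr1n //.
by rewrite sqrf_eq1 => /orP[]/eqP; [left|right].
Qed.

Lemma sqr_golden x : x ^+ 2 = phi + 1 <-> x = phi \/ x = - phi.
Proof.
rewrite -golden_sqr; split=> [/eqP|[]->]; rewrite ?sqrrN //.
by rewrite eqf_sqr => /orP[]/eqP; [left|right].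
Qed.

Lemma sqr_goldenV x : x ^+ 2 = 2 - phi <-> x = phi - 1 \/ x = - (phi - 1).
Proof.
have -> : 2 - phi = (phi - 1) ^+ 2 by have e := golden_sqr; ring: e.
split=> [/eqP|[]->]; rewrite ?sqrrN //.
by rewrite eqf_sqr => /orP[]/eqP; [left|right].
Qed.

Lemma std_tetrahedronE x y z : T0 (vec3 x y z) <->
  [/\ x ^+ 2 = 1, y ^+ 2 = 1, z ^+ 2 = 1 & x * y * z = 1].
Proof.
split.
  by case=> [[[]|]|] /vec3_inj[-> -> ->]; split; ring.
move=> [/sqr_eq1 hx /sqr_eq1 hy /sqr_eq1 hz].
case: hx hy hz => -> [] -> [] -> E; try (by exfalso; lra).
- by left; left; left.
- by left; left; right.
- by left; right.
- by right.
Qed.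

Lemma sign_bool x : x ^+ 2 = 1 -> exists a : bool, x = (-1) ^+ a.
Proof. by move=> /sqr_eq1[]->; [exists false|exists true]. Qed.

Lemma std_cubeE x y z : C0 (vec3 x y z) <-> [/\ x ^+ 2 = 1, y ^+ 2 = 1 & z ^+ 2 = 1].
Proof.
split=> [[a [b [c /vec3_inj[-> -> ->]]]]|[]]; first by rewrite !sqrr_sign.
by move=> /sign_bool[a ->] /sign_bool[b ->] /sign_bool[c ->]; exists a, b, c.
Qed.

Definition golden_triple x y z := [/\ x = 0, y ^+ 2 = 2 - phi & z ^+ 2 = phi + 1].

Lemma std_dodecahedronE x y z : D0 (vec3 x y z) <->
  [\/ [/\ x ^+ 2 = 1, y ^+ 2 = 1 & z ^+ 2 = 1], golden_triple x y z,
      golden_triple y z x | golden_triple z x y].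
Proof.
have e := golden_sqr.
have sg (a : bool) : ((-1) ^+ a * phi^-1) ^+ 2 = 2 - phi.
  by rewrite exprMn sqrr_sign mul1r goldenV; ring: e.
have tg (a : bool) : ((-1) ^+ a * phi) ^+ 2 = phi + 1.
  by rewrite exprMn sqrr_sign mul1r.
have gs t : t ^+ 2 = 2 - phi -> exists a : bool, t = (-1) ^+ a * phi^-1.
  rewrite goldenV => /sqr_goldenV[]->; [exists false|exists true].
    by rewrite mul1r.
  by rewrite mulN1r.
have gt t : t ^+ 2 = phi + 1 -> exists a : bool, t = (-1) ^+ a * phi.
  move=> /sqr_golden[]->; [exists false|exists true].
    by rewrite mul1r.
  by rewrite mulN1r.
split.
  case=> [/std_cubeE|[a [b]]]; first by apply: Or41.
  rewrite /= !inE => /or3P[]/eqP/vec3_inj[-> -> ->].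
  - by apply: Or42; split.
  - by apply: Or43; split.
  - by apply: Or44; split.
case=> [h|[-> /gs[a ->] /gt[b ->]]|[-> /gs[a ->] /gt[b ->]]|[-> /gs[a ->] /gt[b ->]]].
- by left; apply/std_cubeE.
- by right; exists a, b; rewrite /= !inE eqxx.
- by right; exists a, b; rewrite /= !inE eqxx orbT.
- by right; exists a, b; rewrite /= !inE eqxx !orbT.
Qed.

End Solids.

Ltac dodecahedron_cases :=
  move=> /std_dodecahedronE[[/sqr_eq1[]-> /sqr_eq1[]-> /sqr_eq1[]->]
    |[-> /sqr_goldenV[]-> /sqr_golden[]->]|[-> /sqr_goldenV[]-> /sqr_golden[]->]
    |[-> /sqr_goldenV[]-> /sqr_golden[]->]].

(** * Symmetries in coordinates *)

Section Symmetries.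
Implicit Types (u v w : 'rV[R]_3) (r : 'M[R]_3) (x y z s t : R).

Definition cyc3 : 'M[R]_3 := mx3 0 1 0 0 0 1 1 0 0.
Definition diag3 x y z : 'M[R]_3 := mx3 x 0 0 0 y 0 0 0 z.
Definition quarter3 : 'M[R]_3 := mx3 1 0 0 0 0 (-1) 0 1 0.
(** The turn by 72 degrees about (1, 0, phi). *)
Definition fifth3 : 'M[R]_3 :=
  mx3 (1/2) (phi/2) ((phi-1)/2) (-phi/2) ((phi-1)/2) (1/2) ((phi-1)/2) (-1/2) (phi/2).

Lemma cyc3E x y z : vec3 x y z *m cyc3 = vec3 z x y.
Proof. by rewrite vec3_mul; congr vec3; ring. Qed.

Lemma diag3E x y z a b c : vec3 x y z *m diag3 a b c = vec3 (x * a) (y * b) (z * c).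
Proof. by rewrite vec3_mul; congr vec3; ring. Qed.

Lemma quarter3E x y z : vec3 x y z *m quarter3 = vec3 x z (- y).
Proof. by rewrite vec3_mul; congr vec3; ring. Qed.

Lemma cyc3_rotation : is_rotation cyc3.
Proof.
by split; [rewrite mx3_tr mx3_mul mx3_1; congr mx3; ring|rewrite mx3_det; ring].
Qed.

Lemma cyc3_cube : cyc3 *m cyc3 *m cyc3 = 1%:M.
Proof. by rewrite !mx3_mul mx3_1; congr mx3; ring. Qed.

Lemma diag3_rotation x y z : x ^+ 2 = 1 -> y ^+ 2 = 1 -> z ^+ 2 = 1 ->
  x * y * z = 1 -> is_rotation (diag3 x y z).
Proof.
move=> hx hy hz h; split; first by rewrite mx3_tr mx3_mul mx3_1; congr mx3; ring: hx hy hz.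
by rewrite mx3_det; ring: h.
Qed.

Lemma diag3_sqr x y z : x ^+ 2 = 1 -> y ^+ 2 = 1 -> z ^+ 2 = 1 ->
  diag3 x y z *m diag3 x y z = 1%:M.
Proof. by move=> hx hy hz; rewrite mx3_mul mx3_1; congr mx3; ring: hx hy hz. Qed.

Lemma quarter3_rotation : is_rotation quarter3.
Proof.
by split; [rewrite mx3_tr mx3_mul mx3_1; congr mx3; ring|rewrite mx3_det; ring].
Qed.

Lemma fifth3_rotation : is_rotation fifth3.
Proof.
have e := golden_sqr.
split; first by rewrite mx3_tr mx3_mul mx3_1; congr mx3; field: e.
by rewrite mx3_det; field: e.
Qed.

Lemma fifth3_sqr : fifth3 *m fifth3 =
  mx3 (- (phi - 1) / 2) (1/2) (phi/2) (-1/2) (- phi/2) ((phi-1)/2)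
      (phi/2) (-(phi-1)/2) (1/2).
Proof. by have e := golden_sqr; rewrite mx3_mul; congr mx3; field: e. Qed.

Lemma fifth3_order : fifth3 ^+ 5 = 1.
Proof.
rewrite [fifth3 ^+ 5](exprD fifth3 4 1) (exprM fifth3 2 2) !expr2 expr1.
rewrite -![_ * _]/(_ *m _) fifth3_sqr.
have e := golden_sqr.
by rewrite !mx3_mul -[RHS]/(1%:M) mx3_1; congr mx3; field: e.
Qed.

Lemma cyc3_order : cyc3 ^+ 3 = 1.
Proof. by rewrite !exprS expr0 mulr1 mulrA -![_ * _]/(_ *m _) cyc3_cube. Qed.

Lemma quarter3_order : quarter3 ^+ 4 = 1.
Proof.
rewrite (exprM quarter3 2 2) !expr2 -![_ * _]/(_ *m _).
by rewrite !mx3_mul -[RHS]/(1%:M) mx3_1; congr mx3; ring.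
Qed.

Lemma cyc3_group : [/\ rotation_group T0 cyc3, rotation_group C0 cyc3
  & rotation_group D0 cyc3].
Proof.
split; apply: (rotation_group_order cyc3_rotation cyc3_order) => v;
  have [x [y [z ->]]] := vec3P v; rewrite cyc3E.
- by move=> /std_tetrahedronE[hx hy hz h]; apply/std_tetrahedronE; split=> //; ring: h.
- by move=> /std_cubeE[hx hy hz]; apply/std_cubeE.
- move=> /std_dodecahedronE[[hx hy hz]|h|h|h]; apply/std_dodecahedronE.
  + exact: Or41.
  + exact: Or43.
  + exact: Or44.
  + exact: Or42.
Qed.

Lemma diag3_group x y z : x ^+ 2 = 1 -> y ^+ 2 = 1 -> z ^+ 2 = 1 -> x * y * z = 1 ->
  [/\ rotation_group T0 (diag3 x y z), rotation_group C0 (diag3 x y z)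
  & rotation_group D0 (diag3 x y z)].
Proof.
move=> hx hy hz h; have rd := diag3_rotation hx hy hz h.
have od : diag3 x y z ^+ 2 = 1 by rewrite expr2 -[_ * _]/(_ *m _) diag3_sqr.
split; apply: (rotation_group_order rd od) => v;
  have [x' [y' [z' ->]]] := vec3P v; rewrite diag3E.
- move=> /std_tetrahedronE[hx' hy' hz' h']; apply/std_tetrahedronE.
  by split; rewrite ?exprMn ?hx ?hy ?hz ?hx' ?hy' ?hz' ?mulr1 //; ring: h h'.
- move=> /std_cubeE[hx' hy' hz']; apply/std_cubeE.
  by split; rewrite ?exprMn ?hx ?hy ?hz ?hx' ?hy' ?hz' ?mulr1.
have G (a b c a' b' c' : R) : a ^+ 2 = 1 -> b ^+ 2 = 1 -> c ^+ 2 = 1 ->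
    golden_triple a' b' c' -> golden_triple (a' * a) (b' * b) (c' * c).
  move=> ha hb hc [-> hb' hc']; split; first by rewrite mul0r.
    by rewrite exprMn hb hb' mulr1.
  by rewrite exprMn hc hc' mulr1.
move=> /std_dodecahedronE[[hx' hy' hz']|h'|h'|h']; apply/std_dodecahedronE.
- by apply: Or41; split; rewrite ?exprMn ?hx ?hy ?hz ?hx' ?hy' ?hz' ?mulr1.
- by apply: Or42; apply: G.
- by apply: Or43; apply: G.
- by apply: Or44; apply: G.
Qed.

Lemma quarter3_group : rotation_group C0 quarter3.
Proof.
apply: (rotation_group_order quarter3_rotation quarter3_order) => v.
have [x [y [z ->]]] := vec3P v; rewrite quarter3E.
by move=> /std_cubeE[hx hy hz]; apply/std_cubeE; split=> //; rewrite sqrrN.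
Qed.

Lemma fifth3_group : rotation_group D0 fifth3.
Proof.
apply: (rotation_group_order fifth3_rotation fifth3_order) => v.
have [x [y [z ->]]] := vec3P v; rewrite vec3_mul.
have e := golden_sqr.
dodecahedron_cases; apply/std_dodecahedronE;
  solve [ apply: Or41; by split; field: e | apply: Or42; by split; field: e
        | apply: Or43; by split; field: e | apply: Or44; by split; field: e ].
Qed.

End Symmetries.

(** * The corner at (1, 1, 1) *)

Section Corners.
Implicit Types (u v w m : 'rV[R]_3) (c q r : 'M[R]_3) (x y z s t d : R).
Implicit Types V F : set 'rV[R]_3.

Lemma finite_box (s : seq R) : finite_set [set v | exists x y z,
  [/\ x \in s, y \in s & z \in s] /\ v = vec3 x y z].
Proof.
have fs := finite_seq s.
have := finite_image (fun p : R * R * R => vec3 p.1.1 p.1.2 p.2)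
  (finite_setX (finite_setX fs fs) fs).
apply: sub_finite_set => _ [x [y [z [[xs ys zs] ->]]]].
by exists (x, y, z).
Qed.

Lemma finite_std : [/\ finite_set T0, finite_set C0 & finite_set D0].
Proof.
pose s : seq R := [:: 0; 1; -1; phi; - phi; phi - 1; - (phi - 1)].
have S1 x : x ^+ 2 = 1 -> x \in s by case/sqr_eq1=> ->; rewrite !inE eqxx ?orbT.
have S2 x : x ^+ 2 = phi + 1 -> x \in s by case/sqr_golden=> ->; rewrite !inE eqxx ?orbT.
have S3 x : x ^+ 2 = 2 - phi -> x \in s by case/sqr_goldenV=> ->; rewrite !inE eqxx ?orbT.
have S0 : 0 \in s by rewrite inE eqxx.
split; apply: sub_finite_set (finite_box s) => v; have [x [y [z ->]]] := vec3P v.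
- by move=> /std_tetrahedronE[hx hy hz _]; exists x, y, z; split=> //; split; exact: S1.
- by move=> /std_cubeE[hx hy hz]; exists x, y, z; split=> //; split; exact: S1.
- move=> /std_dodecahedronE[[hx hy hz]|[-> hy hz]|[-> hy hz]|[-> hy hz]].
  + by exists x, y, z; split=> //; split; exact: S1.
  + by exists 0, y, z; split=> //; split; [|exact: S3|exact: S2].
  + by exists x, 0, z; split=> //; split; [exact: S2| |exact: S3].
  + by exists x, y, 0; split=> //; split; [exact: S3|exact: S2|].
Qed.

Lemma vec3D x y z x' y' z' : vec3 x y z + vec3 x' y' z' = vec3 (x + x') (y + y') (z + z').
Proof. by apply/rowP => k; case: (ord3P k) => ->; rewrite !mxE. Qed.

Lemma vec3Z a x y z : a *: vec3 x y z = vec3 (a * x) (a * y) (a * z).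
Proof. by apply/rowP => k; case: (ord3P k) => ->; rewrite !mxE. Qed.

Lemma vec3_0 : vec3 0 0 0 = 0 :> 'rV[R]_3.
Proof. by apply/rowP => k; case: (ord3P k) => ->; rewrite !mxE. Qed.

Lemma corner_tetrahedron :
  regular_corner T0 v111 (vec3 (-1) (-1) 1) (vec3 (-1) 1 1) 1 cyc3.
Proof.
have [cT _ _] := cyc3_group; have [fT _ _] := finite_std.
split=> //.
- by apply/std_tetrahedronE; split; ring.
- by apply/std_tetrahedronE; split; ring.
- move=> v; have [x [y [z ->]]] := vec3P v => /std_tetrahedronE[hx hy hz h].
  exists (diag3 x y z); last by rewrite diag3E !mul1r.
  by have [] := diag3_group hx hy hz h.
- exact: cyc3_cube.
- by rewrite cyc3E.
- move=> v; have [x [y [z ->]]] := vec3P v.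
  move=> /std_tetrahedronE[/sqr_eq1 hx /sqr_eq1 hy /sqr_eq1 hz h]; rewrite dotE.
  by case: hx hy hz h => -> [] -> [] -> h; lra.
- by rewrite dotE; lra.
- by rewrite dotE; lra.
- by rewrite cyc3E dotE; lra.
- by rewrite !cyc3E dotE; lra.
- move=> v; have [x [y [z ->]]] := vec3P v.
  move=> /std_tetrahedronE[/sqr_eq1 hx /sqr_eq1 hy /sqr_eq1 hz h]; rewrite cyc3E !dotE.
  case: hx hy hz h => -> [] -> [] -> h h1 h2; try (by exfalso; lra).
    by left.
  by right.
- move=> v; have [x [y [z ->]]] := vec3P v.
  exists ((y + z) / 2), ((x + z) / 2), ((x + y) / 2).
  by rewrite !cyc3E !vec3Z !vec3D; congr vec3; field.
Qed.

Lemma corner_std_cube : regular_corner C0 v111 (vec3 1 1 (-1)) (vec3 1 0 0) 1 cyc3.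
Proof.
have [_ cC _] := cyc3_group; have [_ fC _] := finite_std.
split=> //.
- by apply/std_cubeE; split; ring.
- by apply/std_cubeE; split; ring.
- move=> v; have [x [y [z ->]]] := vec3P v => /std_cubeE[hx hy hz].
  have dg z' : z' ^+ 2 = 1 -> x * y * z' = 1 -> rotation_group C0 (diag3 x y z').
    by move=> hz' h; have [] := diag3_group hx hy hz' h.
  have /sqr_eq1[h|h] : (x * y * z) ^+ 2 = 1 by rewrite !exprMn hx hy hz !mulr1.
    by exists (diag3 x y z); rewrite ?diag3E ?mul1r //; exact: dg.
  exists (quarter3 *m diag3 x y (- z)).
    by apply: rotation_groupM; [exact: quarter3_group|apply: dg; rewrite ?sqrrN // mulrN h opprK].
  by rewrite mulmxA quarter3E diag3E; congr vec3; ring.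
- exact: cyc3_cube.
- by rewrite cyc3E.
- move=> v; have [x [y [z ->]]] := vec3P v.
  by move=> /std_cubeE[/sqr_eq1 hx _ _]; rewrite dotE; case: hx => ->; lra.
- by rewrite dotE; lra.
- by rewrite dotE; lra.
- by rewrite cyc3E dotE; lra.
- by rewrite !cyc3E dotE; lra.
- move=> v; have [x [y [z ->]]] := vec3P v.
  move=> /std_cubeE[_ _ /sqr_eq1 hz]; rewrite cyc3E !dotE !mul1r !mul0r !addr0 add0r => -> ->.
  by case: hz => ->; [left|right].
- move=> v; have [x [y [z ->]]] := vec3P v; exists x, y, z.
  by rewrite !cyc3E !vec3Z !vec3D; congr vec3; ring.
Qed.

Lemma corner_std_dodecahedron :
  regular_corner D0 v111 (vec3 phi 0 (phi - 1)) (vec3 1 0 phi) (phi + 1) cyc3.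
Proof.
have [_ _ cD] := cyc3_group; have [_ _ fD] := finite_std.
have e := golden_sqr; have /andP[b1 b2] := golden_bounds.
split=> //.
- by apply/std_dodecahedronE/Or41; split; ring.
- by apply/std_dodecahedronE/Or43; split; ring: e.
- move=> v; have [x [y [z ->]]] := vec3P v.
  have dg (a b c' : R) : a ^+ 2 = 1 -> b ^+ 2 = 1 -> c' ^+ 2 = 1 -> a * b * c' = 1 ->
      rotation_group D0 (diag3 a b c').
    by move=> ha hb hc h; have [] := diag3_group ha hb hc h.
  have g1 := fifth3_group.
  have v1 : v111 *m fifth3 = vec3 0 (phi - 1) phi by rewrite vec3_mul; congr vec3; field.
  have gold y' z' : y' ^+ 2 = 2 - phi -> z' ^+ 2 = phi + 1 ->
      exists2 r, rotation_group D0 r & vec3 0 y' z' = v111 *m r.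
    have D s t : s ^+ 2 = 1 -> t ^+ 2 = 1 -> exists2 r, rotation_group D0 r &
        vec3 0 (s * (phi - 1)) (t * phi) = v111 *m r.
      move=> hs ht; exists (fifth3 *m diag3 (s * t) s t).
        by apply: rotation_groupM => //; apply: dg; rewrite ?exprMn ?hs ?ht ?mulr1 //; ring: hs ht.
      by rewrite mulmxA v1 diag3E; congr vec3; ring.
    have o : (1 : R) ^+ 2 = 1 by ring.
    have o' : (-1 : R) ^+ 2 = 1 by ring.
    move=> /sqr_goldenV[->|->] /sqr_golden[->|->].
    - by have := D _ _ o o; rewrite !mul1r.
    - by have := D _ _ o o'; rewrite !mul1r !mulN1r.
    - by have := D _ _ o' o; rewrite !mul1r !mulN1r.
    - by have := D _ _ o' o'; rewrite !mulN1r.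
  move=> /std_dodecahedronE[[hx hy hz]|[-> hy hz]|[-> hz hx]|[-> hx hy]].
  + have /sqr_eq1[h|h] : (x * y * z) ^+ 2 = 1 by rewrite !exprMn hx hy hz !mulr1.
      by exists (diag3 x y z); rewrite ?diag3E ?mul1r //; exact: dg.
    exists (fifth3 *m fifth3 *m fifth3 *m diag3 x (- y) z).
      apply: rotation_groupM; last by apply: dg; rewrite ?sqrrN //; ring: h.
      by apply: rotation_groupM => //; exact: rotation_groupM.
    by rewrite !mulmxA v1 !vec3_mul; congr vec3; field: e.
  + exact: gold.
  + have [r rr E] := gold _ _ hz hx; exists (r *m cyc3); first exact: rotation_groupM.
    by rewrite mulmxA -E cyc3E.
  + have [r rr E] := gold _ _ hx hy; exists (r *m (cyc3 *m cyc3)).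
      by apply: rotation_groupM => //; exact: rotation_groupM.
    by rewrite !mulmxA -E !cyc3E.
- exact: cyc3_cube.
- by rewrite cyc3E.
- move=> v; have [x [y [z ->]]] := vec3P v; rewrite dotE.
  by dodecahedron_cases; lra.
- by rewrite dotE; lra.
- by rewrite dotE; lra.
- by rewrite cyc3E dotE; lra.
- by rewrite !cyc3E dotE; lra.
- move=> v; have [x [y [z ->]]] := vec3P v; rewrite cyc3E !dotE.
  dodecahedron_cases => h1 h2; try (by exfalso; lra); by [left|right].
- move=> v; have [x [y [z ->]]] := vec3P v.
  (* The inverse of the circulant matrix of the three normals. *)
  exists ((2 - phi) / 2 * (x - phi * y + (phi + 1) * z)),
    ((2 - phi) / 2 * (y - phi * z + (phi + 1) * x)),
    ((2 - phi) / 2 * (z - phi * x + (phi + 1) * y)).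
  by rewrite !cyc3E !vec3Z !vec3D; congr vec3; field: e.
Qed.

End Corners.

(** * Standard faces and the tetrahedral group *)

Section Groups.
Implicit Types (u v w m : 'rV[R]_3) (c q r : 'M[R]_3) (x y z s t d : R).
Implicit Types V F : set 'rV[R]_3.

Definition triangle : seq 'rV[R]_3 :=
  [:: vec3 1 1 1; vec3 (-1) (-1) 1; vec3 (-1) 1 (-1)].
Definition square : seq 'rV[R]_3 :=
  [:: vec3 1 1 1; vec3 1 1 (-1); vec3 1 (-1) (-1); vec3 1 (-1) 1].
Definition pentagon : seq 'rV[R]_3 :=
  [:: vec3 1 1 1; vec3 0 (phi - 1) phi; vec3 0 (- (phi - 1)) phi; vec3 1 (-1) 1;
      vec3 phi 0 (phi - 1)].

Lemma triangle_face : support_face T0 (vec3 (-1) 1 1) 1 = [set` triangle].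
Proof.
apply/seteqP; split=> v; have [x [y [z ->]]] := vec3P v.
  rewrite /= !inE => -[/std_tetrahedronE[/sqr_eq1 hx /sqr_eq1 hy /sqr_eq1 hz h]].
  rewrite dotE.
  by case: hx hy hz h => -> [] -> [] -> h e; rewrite ?eqxx ?orbT //; exfalso; lra.
rewrite /= !inE => /or3P[] /eqP ->; split; rewrite ?dotE; try ring;
  by apply/std_tetrahedronE; split; ring.
Qed.

Lemma square_face : support_face C0 (vec3 1 0 0) 1 = [set` square].
Proof.
apply/seteqP; split=> v; have [x [y [z ->]]] := vec3P v.
  rewrite /= !inE => -[/std_cubeE[/sqr_eq1 hx /sqr_eq1 hy /sqr_eq1 hz]].
  rewrite dotE.
  by case: hx hy hz => -> [] -> [] -> e; rewrite ?eqxx ?orbT //; exfalso; lra.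
rewrite /= !inE => /or4P[] /eqP ->; split; rewrite ?dotE; try ring;
  by apply/std_cubeE; split; ring.
Qed.

Lemma pentagon_face : support_face D0 (vec3 1 0 phi) (phi + 1) = [set` pentagon].
Proof.
have g := golden_sqr; have /andP[b1 b2] := golden_bounds.
apply/seteqP; split=> v; have [x [y [z ->]]] := vec3P v.
  rewrite /= !inE => -[Dv]; rewrite dotE; move: Dv.
  by dodecahedron_cases => e; rewrite ?eqxx ?orbT //; exfalso; lra.
rewrite /= !inE => /or4P[/eqP->|/eqP->|/eqP->|/orP[/eqP->|/eqP->]]; split;
  rewrite ?dotE; try ring: g.
- by apply/std_dodecahedronE/Or41; split; ring.
- by apply/std_dodecahedronE/Or42; split; ring: g.
- by apply/std_dodecahedronE/Or42; split; ring: g.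
- by apply/std_dodecahedronE/Or41; split; ring.
- by apply/std_dodecahedronE/Or43; split; ring: g.
Qed.

Lemma vec3_eqE x y z x' y' z' :
  (vec3 x y z == vec3 x' y' z') = [&& x == x', y == y' & z == z'].
Proof.
apply/eqP/and3P => [/vec3_inj[-> -> ->]|[/eqP-> /eqP-> /eqP->]] //.
Qed.

Lemma uniq_faces : [/\ uniq triangle, uniq square & uniq pentagon].
Proof.
have /andP[b1 b2] := golden_bounds.
have n1 : (1 == -1 :> R) = false by apply/eqP => h; lra.
have n2 : (-1 == 1 :> R) = false by apply/eqP => h; lra.
have n3 : (1 == 0 :> R) = false by apply/eqP => h; lra.
have n4 : (1 == phi) = false by apply/eqP => h; lra.
have n5 : (0 == 1 :> R) = false by apply/eqP => h; lra.
have n6 : (0 == phi) = false by apply/eqP => h; lra.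
have n7 : (phi - 1 == - (phi - 1)) = false by apply/eqP => h; lra.
by split; rewrite /= !inE !vec3_eqE ?n1 ?n2 ?n3 ?n4 ?n5 ?n6 ?n7 /= ?andbF ?orbF ?andbT.
Qed.

Lemma centroid_face_triangle : centroid [set` triangle] = 3^-1 *: vec3 (-1) 1 1.
Proof.
have [us _ _] := uniq_faces; rewrite (centroid_seq us) !big_cons big_nil addr0.
by rewrite [size _]/= !vec3D; congr (_ *: _); congr vec3; ring.
Qed.

Lemma centroid_face_square : centroid [set` square] = vec3 1 0 0.
Proof.
have [_ us _] := uniq_faces; rewrite (centroid_seq us) !big_cons big_nil addr0.
by rewrite [size _]/= !vec3D vec3Z; congr vec3; field.
Qed.

Lemma centroid_face_pentagon : centroid [set` pentagon] = ((phi + 2) / 5) *: vec3 1 0 phi.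
Proof.
have g := golden_sqr.
have [_ _ us] := uniq_faces; rewrite (centroid_seq us) !big_cons big_nil addr0.
by rewrite [size _]/= !vec3D !vec3Z; congr vec3; field: g.
Qed.

(** A rotation preserving a face fixes its centre, hence is determined by the
    image of one of its vertices. *)
Lemma face_rotation_fix (s : seq 'rV[R]_3) (k : R) m v r :
  centroid [set` s] = k *: m -> k != 0 -> cross v m != 0 ->
  is_rotation r -> mulset [set` s] r = [set` s] -> v *m r = v -> r = 1%:M.
Proof.
move=> cE k0 vm rr sr vr; apply: (rotation_fix2 rr vm vr).
have := centroidM (finite_seq s) (fun u v => orthogonal_inj rr.1 (u := u) (v := v)).
by rewrite sr cE -scalemxAl => /(scalerI k0).
Qed.

Lemma face_rotation_eq (s : seq 'rV[R]_3) (k : R) m v r r' :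
  centroid [set` s] = k *: m -> k != 0 -> cross v m != 0 ->
  is_rotation r -> mulset [set` s] r = [set` s] ->
  is_rotation r' -> mulset [set` s] r' = [set` s] -> v *m r = v *m r' -> r = r'.
Proof.
move=> cE k0 vm rr sr rr' sr' e.
have : r *m r'^T = 1%:M.
  apply: (face_rotation_fix cE k0 vm).
  - by apply: is_rotationM => //; exact: is_rotationT.
  - by rewrite -mulsetM sr -{1}sr' mulsetM rr'.1 mulset1.
  - by rewrite mulmxA e (orthogonalK _ rr'.1).
by move=> /(congr1 (mulmx^~ r')); rewrite -mulmxA (orthogonal_tr rr'.1) mulmx1 mul1mx.
Qed.

Lemma mulset_support V m d r : rotation_group V r ->
  mulset (support_face V m d) r = support_face V (m *m r) d.
Proof.
move=> rr; apply/seteqP; split=> [_ [v [Vv mv] <-]|v [Vv mv]].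
  by split; [exact: rotation_group_mem|rewrite (dot_orthogonal _ _ rr.1.1)].
exists (v *m r^T); last exact: (orthogonalKV _ rr.1.1).
split; last by rewrite -dot_mulmx_tr.
by apply: rotation_group_mem Vv; exact: rotation_groupT.
Qed.

Lemma cross_v111 : [/\ cross v111 (vec3 (-1) 1 1) != 0, cross v111 (vec3 1 0 0) != 0
  & cross v111 (vec3 1 0 phi) != 0].
Proof.
by split; rewrite /cross !vec3E -vec3_0; apply/eqP => /vec3_inj[e1 e2 e3]; lra.
Qed.

(** Sign changes of determinant one move (1, 1, 1) to any vertex; what is left
    is a rotation about (1, 1, 1), which permutes the three faces there. *)
Lemma tetrahedron_groupP r : rotation_group T0 r ->
  exists k x y z, [/\ x ^+ 2 = 1, y ^+ 2 = 1, z ^+ 2 = 1 & x * y * z = 1] /\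
    r = cyc3 ^+ k *m diag3 x y z.
Proof.
move=> rr; have C := corner_tetrahedron.
have := rotation_group_mem rr (corner_vertex C).
have [x [y [z vE]]] := vec3P (v111 *m r); rewrite vE => /std_tetrahedronE[hx hy hz h].
have [gT _ _] := diag3_group hx hy hz h.
have fix_v : v111 *m (r *m diag3 x y z) = v111.
  by rewrite mulmxA vE diag3E -!expr2 hx hy hz.
have rg := rotation_groupM rr gT.
have [k fE] := face_at_corner C (is_faceM rg (support_face_is_face C))
  (ex_intro2 _ _ _ (let: And3 a _ _ := support_face_vertices C in a) fix_v).
exists k, x, y, z; split=> //.
have rk := rotation_groupX k (corner_rot C).
have [cx _ _] := cross_v111.
have i3 : (3^-1 : R) != 0 by rewrite invr_eq0 pnatr_eq0.
have := face_rotation_fix centroid_face_triangle i3 cx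
  (rotation_groupM rg (rotation_groupT rk)).1.
rewrite -triangle_face -mulsetM fE mulsetM rk.1.1 mulset1 => /(_ erefl).
rewrite mulmxA fix_v.
have kv := corner_fixX k C.
rewrite -{1}kv (orthogonalK _ rk.1.1) => /(_ erefl) E.
rewrite -[LHS]mulmx1 -(diag3_sqr hx hy hz) mulmxA; congr (_ *m _).
by rewrite -[LHS]mulmx1 -(orthogonal_tr rk.1.1) mulmxA E mul1mx.
Qed.

Lemma tetrahedron_group_sub r : rotation_group T0 r ->
  rotation_group C0 r /\ rotation_group D0 r.
Proof.
move=> /tetrahedron_groupP[k [x [y [z [[hx hy hz h] ->]]]]].
have [_ cC cD] := cyc3_group; have [_ dC dD] := diag3_group hx hy hz h.
by split; apply: rotation_groupM => //; exact: rotation_groupX.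
Qed.

End Groups.

(** * The rotation groups of the cube and the dodecahedron *)

Section Positions.
Implicit Types (u v w m : 'rV[R]_3) (c q r s t : 'M[R]_3) (x y z d : R).
Implicit Types V F : set 'rV[R]_3.
Local Notation P5 := ([set` pentagon] : set 'rV[R]_3).

Definition tetra1 : 'rV[R]_3 := vec3 1 1 1.
Definition tetra2 : 'rV[R]_3 := vec3 1 (-1) (-1).
Definition tetra3 : 'rV[R]_3 := vec3 (-1) 1 (-1).
Definition tetra4 : 'rV[R]_3 := vec3 (-1) (-1) 1.

Lemma tetra_in : [/\ T0 tetra1, T0 tetra2, T0 tetra3 & T0 tetra4].
Proof. by split; apply/std_tetrahedronE; split; ring. Qed.

(** The vertices form a tight frame balanced around the origin; this restricts
    the possible products of a vector with them. *)
Lemma tetra_frame n :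
  dot n tetra1 + dot n tetra2 + dot n tetra3 + dot n tetra4 = 0 /\
  dot n tetra1 ^+ 2 + dot n tetra2 ^+ 2 + dot n tetra3 ^+ 2 + dot n tetra4 ^+ 2
    = 4 * dot n n.
Proof.
have [x [y [z ->]]] := vec3P n; rewrite !dotE; split; ring.
Qed.

Lemma cube_dot u v : C0 u -> C0 v -> dot u v ^+ 2 = 9 \/ dot u v ^+ 2 = 1.
Proof.
have [x [y [z ->]]] := vec3P u; have [x' [y' [z' ->]]] := vec3P v.
move=> /std_cubeE[hx hy hz] /std_cubeE[hx' hy' hz']; rewrite dotE.
have /sqr_eq1 h1 : (x * x') ^+ 2 = 1 by rewrite exprMn hx hx' mulr1.
have /sqr_eq1 h2 : (y * y') ^+ 2 = 1 by rewrite exprMn hy hy' mulr1.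
have /sqr_eq1 h3 : (z * z') ^+ 2 = 1 by rewrite exprMn hz hz' mulr1.
by case: h1 h2 h3 => -> [] -> [] ->; solve [left; ring | right; ring].
Qed.

Lemma dot_std_norm v : C0 v \/ D0 v -> dot v v = 3.
Proof.
have [x [y [z ->]]] := vec3P v; rewrite dotE -!expr2 => -[|].
  by move=> /std_cubeE[-> -> ->]; ring.
move=> /std_dodecahedronE[[-> -> ->]|[-> -> ->]|[-> -> ->]|[-> -> ->]]; ring.
Qed.

Lemma eq_of_dot u v : dot u u = 3 -> dot v v = 3 -> dot u v = 3 -> u = v.
Proof.
move=> uu vv uv; apply/subr0_eq/dot_eq0.
by rewrite !dotDl !dotDr -scaleN1r !dotZl !dotZr (dotC v u) uu vv uv; ring.
Qed.

Lemma std_cube_tetrahedra : C0 = T0 `|` [set - v | v in T0].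
Proof.
apply/seteqP; split=> v; have [x [y [z ->]]] := vec3P v.
  move=> /std_cubeE[hx hy hz].
  have /sqr_eq1[h|h] : (x * y * z) ^+ 2 = 1 by rewrite !exprMn hx hy hz !mulr1.
    by left; apply/std_tetrahedronE.
  right; exists (vec3 (- x) (- y) (- z)).
    by apply/std_tetrahedronE; rewrite !sqrrN !mulrNN mulrN h opprK.
  by rewrite -scaleN1r vec3Z; congr vec3; ring.
case=> [/std_tetrahedronE[hx hy hz _]|[w]]; first exact/std_cubeE.
have [x' [y' [z' ->]]] := vec3P w => /std_tetrahedronE[hx hy hz _].
rewrite -scaleN1r vec3Z !mulN1r => /vec3_inj[<- <- <-].
by apply/std_cubeE; rewrite !sqrrN.
Qed.

Lemma tetra_sub_cube : T0 `<=` C0.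
Proof. by rewrite std_cube_tetrahedra => v; left. Qed.

(** Equality in the Cauchy-Schwarz inequality makes [u] equal to [t] or [- t]. *)
Lemma cube_of_dot u (t : 'rV[R]_3) : dot u u = 3 -> T0 t -> dot u t ^+ 2 = 9 -> C0 u.
Proof.
move=> uu Tt; have tt : dot t t = 3 by apply: dot_std_norm; left; exact: tetra_sub_cube.
rewrite (_ : 9 = 3 ^+ 2) => [/eqP|]; last by ring.
rewrite eqf_sqr std_cube_tetrahedra => /orP[]/eqP e.
  by left; rewrite (eq_of_dot uu tt e).
right; exists t => //; apply/esym/(eq_of_dot uu); rewrite -scaleN1r ?dotZl dotZr ?tt ?e; ring.
Qed.

Lemma cube_parity u v : C0 u -> T0 v -> (dot u v = 3 \/ dot u v = -1) -> T0 u.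
Proof.
have [x [y [z ->]]] := vec3P u; have [x' [y' [z' ->]]] := vec3P v.
move=> /std_cubeE[/sqr_eq1 hx /sqr_eq1 hy /sqr_eq1 hz].
move=> /std_tetrahedronE[/sqr_eq1 hx' /sqr_eq1 hy' /sqr_eq1 hz'].
rewrite dotE => h h'; apply/std_tetrahedronE; split; try exact/sqr_eq1.
case: hx hy hz hx' hy' hz' h h' => -> [] -> [] -> [] -> [] -> [] -> h [] h';
  try lra.
Qed.

Lemma tetra_dot u v : T0 u -> T0 v -> dot u v = 3 \/ dot u v = -1.
Proof.
have [x [y [z ->]]] := vec3P u; have [x' [y' [z' ->]]] := vec3P v.
move=> /std_tetrahedronE[/sqr_eq1 hx /sqr_eq1 hy /sqr_eq1 hz h].
move=> /std_tetrahedronE[/sqr_eq1 hx' /sqr_eq1 hy' /sqr_eq1 hz' h']; rewrite dotE.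
case: hx hy hz hx' hy' hz' h h' => -> [] -> [] -> [] -> [] -> [] -> h h';
  (try by exfalso; lra); solve [left; ring|right; ring].
Qed.

Lemma tetra_group_of_cube r :
  rotation_group C0 r -> T0 (v111 *m r) -> rotation_group T0 r.
Proof.
move=> rr vr; have T1 : T0 v111 by have [] := tetra_in.
have fwd (s : 'M[R]_3) : rotation_group C0 s -> T0 (v111 *m s) -> forall v, T0 v -> T0 (v *m s).
  move=> rs vs v Tv; apply: (cube_parity _ vs).
    by apply: rotation_group_mem rs _; exact: tetra_sub_cube.
  by rewrite (dot_orthogonal _ _ rs.1.1); exact: tetra_dot.
have rrT := rotation_groupT rr.
split; first exact: rr.1.
apply/seteqP; split=> [_ [v Tv <-]|v Tv]; first exact: fwd.
exists (v *m r^T); last exact: (orthogonalKV _ rr.1.1).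
apply: fwd => //; apply: (cube_parity _ T1).
  by apply: rotation_group_mem rrT _; exact: tetra_sub_cube.
by rewrite dot_mulmx_tr trmxK; exact: tetra_dot.
Qed.

(** A rotation of the cube either preserves the tetrahedron or exchanges it
    with its opposite, as [quarter3] does. *)
Lemma cube_groupP r : rotation_group C0 r <->
  rotation_group T0 r \/ exists2 t, rotation_group T0 t & r = quarter3 *m t.
Proof.
have Cv : C0 v111 by apply/std_cubeE; split; ring.
have q3 := quarter3_group.
split=> [rr|[/tetrahedron_group_sub[]//|[t /tetrahedron_group_sub[rt _] ->]]]; last first.
  exact: rotation_groupM.
have := rotation_group_mem rr Cv; rewrite std_cube_tetrahedra => -[|[u Tu E]].
  by move=> vr; left; exact: tetra_group_of_cube.
right; exists (quarter3^T *m r); last by rewrite mulmxA q3.1.1 mul1mx.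
have rs : rotation_group C0 (quarter3^T *m r).
  by apply: rotation_groupM => //; exact: rotation_groupT.
apply: tetra_group_of_cube => //; apply: (cube_parity _ Tu).
  exact: rotation_group_mem rs _.
have -> : u = - (v111 *m r) by rewrite -E opprK.
rewrite dotC dotNl mulmxA (dot_orthogonal _ _ rr.1.1).
by right; rewrite /quarter3 mx3_tr vec3_mul dotE; ring.
Qed.

(** Each face of the dodecahedron has a vertex of the tetrahedron: against a
    face normal [n] the four vertices take values among [phi + 1], [phi - 1] and
    their opposites, and the frame identities leave only
    [phi + 1, phi - 1, 1 - phi, - phi - 1]. *)
Lemma face_meets_tetrahedron n : dot n n = phi + 2 ->
  (forall v, T0 v -> [\/ dot n v = phi + 1, dot n v = - (phi + 1),
      dot n v = phi - 1 | dot n v = - (phi - 1)]) ->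
  exists2 v, T0 v & dot n v = phi + 1.
Proof.
move=> nn vals; apply: contrapT => none.
have [s1 s2] := tetra_frame n; rewrite nn in s2.
have [T1 T2 T3 T4] := tetra_in.
have g := golden_sqr; have /andP[b1 b2] := golden_bounds.
have {none} vals v : T0 v -> [\/ dot n v = - (phi + 1),
      dot n v = phi - 1 | dot n v = - (phi - 1)].
  move=> Tv; case: (vals v Tv) => h; [|exact: Or31|exact: Or32|exact: Or33].
  by case: none; exists v.
move: (vals _ T1) (vals _ T2) (vals _ T3) (vals _ T4) s1 s2.
case=> -> [] -> [] -> [] -> s1 s2; lra.
Qed.

Lemma dodecahedron_normal_dot v : D0 v ->
  [\/ dot (vec3 1 0 phi) v = phi + 1, dot (vec3 1 0 phi) v = - (phi + 1),
      dot (vec3 1 0 phi) v = phi - 1 | dot (vec3 1 0 phi) v = - (phi - 1)].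
Proof.
have g := golden_sqr.
have [x [y [z ->]]] := vec3P v; rewrite dotE.
by dodecahedron_cases; solve [ apply: Or41; ring: g | apply: Or42; ring: g
  | apply: Or43; ring: g | apply: Or44; ring: g ].
Qed.

Lemma tetra_sub_dodecahedron : T0 `<=` D0.
Proof.
move=> v; have [x [y [z ->]]] := vec3P v => /std_tetrahedronE[hx hy hz _].
exact/std_dodecahedronE/Or41.
Qed.

Lemma fifth3_step : [/\ vec3 1 1 1 *m fifth3 = vec3 0 (phi - 1) phi,
  vec3 0 (phi - 1) phi *m fifth3 = vec3 0 (- (phi - 1)) phi,
  vec3 0 (- (phi - 1)) phi *m fifth3 = vec3 1 (-1) 1,
  vec3 1 (-1) 1 *m fifth3 = vec3 phi 0 (phi - 1) &
  vec3 phi 0 (phi - 1) *m fifth3 = vec3 1 1 1].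
Proof.
by have g := golden_sqr; split; rewrite vec3_mul; congr vec3; field: g.
Qed.

Lemma fifth3_normal : vec3 1 0 phi *m fifth3 = vec3 1 0 phi.
Proof. by have g := golden_sqr; rewrite vec3_mul; congr vec3; field: g. Qed.

Lemma pentagon_fifth3 k : mulset P5 (fifth3 ^+ k) = P5 /\
  vec3 1 0 phi *m fifth3 ^+ k = vec3 1 0 phi.
Proof.
rewrite -pentagon_face; elim: k => [|k [IH1 IH2]]; first by rewrite expr0 !mulmx1 mulset1.
rewrite exprSr -[_ * fifth3]/(_ *m fifth3) mulmxA IH2 fifth3_normal.
by rewrite -mulsetM IH1 (mulset_support _ _ fifth3_group) fifth3_normal.
Qed.

Lemma pentagon_orbit v : v \in pentagon ->
  exists2 k, (k < 5)%N & v = v111 *m fifth3 ^+ k.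
Proof.
have [e1 e2 e3 e4 _] := fifth3_step.
have S k : v111 *m fifth3 ^+ k.+1 = v111 *m fifth3 ^+ k *m fifth3.
  by rewrite exprSr -[_ * fifth3]/(_ *m fifth3) mulmxA.
rewrite !inE => /or4P[/eqP->|/eqP->|/eqP->|/orP[/eqP->|/eqP->]].
- by exists 0%N; rewrite ?expr0 ?mulmx1.
- by exists 1%N; rewrite ?expr1 ?e1.
- by exists 2%N; rewrite // !S expr0 mulmx1 e1 e2.
- by exists 3%N; rewrite // !S expr0 mulmx1 e1 e2 e3.
- by exists 4%N; rewrite // !S expr0 mulmx1 e1 e2 e3 e4.
Qed.

Lemma pentagon_rotation_eq v r r' : v = v111 ->
  is_rotation r -> mulset P5 r = P5 ->
  is_rotation r' -> mulset P5 r' = P5 ->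
  v *m r = v *m r' -> r = r'.
Proof.
move=> ->; apply: (face_rotation_eq centroid_face_pentagon).
  have /andP[b1 b2] := golden_bounds.
  by rewrite mulf_neq0 ?invr_eq0 ?pnatr_eq0 // gt_eqF //; lra.
by have [] := cross_v111.
Qed.

(** A rotation carries the pentagon to a face that has a vertex of the
    tetrahedron. A tetrahedral rotation brings this vertex, and then this face,
    back to the standard one; what is left turns the pentagon. *)
Lemma dodecahedron_groupP r : rotation_group D0 r <->
  exists k t, [/\ (k < 5)%N, rotation_group T0 t & r = fifth3 ^+ k *m t].
Proof.
have f5 := fifth3_group; have C := corner_std_dodecahedron.
split=> [rr|[k [t [_ /tetrahedron_group_sub[_ rt] ->]]]]; last first.
  by apply: rotation_groupM => //; exact: rotation_groupX.
have g := golden_sqr.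
have [||u Tu nu] := @face_meets_tetrahedron (vec3 1 0 phi *m r).
- by rewrite (dot_orthogonal _ _ rr.1.1) dotE; ring: g.
- move=> v Tv; rewrite dot_mulmx_tr; apply: dodecahedron_normal_dot.
  apply: rotation_group_mem (rotation_groupT rr) _; exact: tetra_sub_dodecahedron.
have [t rt uE] := corner_trans corner_tetrahedron Tu.
have [_ rtD] := tetrahedron_group_sub rt.
have rg := rotation_groupM rr (rotation_groupT rtD).
have [|j fE] := face_at_corner C (is_faceM rg (support_face_is_face C)).
  rewrite -mulsetM mulset_support //; exists u; last by rewrite uE (orthogonalK _ rt.1.1).
  by split=> //; exact: tetra_sub_dodecahedron.
have [cT _ cD] := cyc3_group.
have rj := rotation_groupX j cD; have rs := rotation_groupM rg (rotation_groupT rj).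
have sF : mulset P5 (r *m t^T *m (cyc3 ^+ j)^T) = P5.
  by rewrite -pentagon_face -mulsetM fE mulsetM rj.1.1 mulset1.
have [|k k5 kE] := @pentagon_orbit (v111 *m (r *m t^T *m (cyc3 ^+ j)^T)).
  by have : P5 (v111 *m (r *m t^T *m (cyc3 ^+ j)^T)) by
    rewrite -sF; exists v111 => //=; rewrite inE eqxx.
exists k, (cyc3 ^+ j *m t); split=> //.
  by apply: rotation_groupM => //; exact: rotation_groupX.
have [sk _] := pentagon_fifth3 k.
have <- := pentagon_rotation_eq erefl rs.1 sF (rotation_groupX k f5).1 sk kE.
rewrite !mulmxA -(mulmxA _ (cyc3 ^+ j)^T) (orthogonal_tr rj.1.1) mulmx1.
by rewrite -mulmxA (orthogonal_tr rt.1.1) mulmx1.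
Qed.

Definition swap3 : 'M[R]_3 := mx3 0 1 0 1 0 0 0 0 1.

Lemma swap3E x y z : vec3 x y z *m swap3 = vec3 y x z.
Proof. by rewrite vec3_mul; congr vec3; ring. Qed.

Lemma swap3_sqr : swap3 *m swap3 = 1%:M.
Proof. by rewrite mx3_mul mx3_1; congr mx3; ring. Qed.

Lemma swap3_tr : swap3^T = swap3.
Proof. by rewrite mx3_tr. Qed.

Lemma swap3_orthogonal : orthogonal swap3.
Proof. by rewrite /orthogonal swap3_tr swap3_sqr. Qed.

Lemma swap3_det : \det swap3 = -1.
Proof. by rewrite mx3_det; ring. Qed.

Lemma swap3_tetrahedron : mulset T0 swap3 = T0.
Proof.
have sub v : T0 v -> T0 (v *m swap3).
  have [x [y [z ->]]] := vec3P v => /std_tetrahedronE[hx hy hz h].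
  by rewrite swap3E; apply/std_tetrahedronE; split=> //; ring: h.
apply/seteqP; split=> [_ [v Tv <-]|v Tv]; first exact: sub.
by exists (v *m swap3); [exact: sub|rewrite -mulmxA swap3_sqr mulmx1].
Qed.

End Positions.

(** * The cube and the two dodecahedra over a tetrahedron *)

Section Inscribed.
Implicit Types (u v w m t : 'rV[R]_3) (c q r s : 'M[R]_3) (x y z d : R).
Implicit Types V F : set 'rV[R]_3.

Lemma sc_gt0 : 0 < sc.
Proof. by rewrite invr_gt0 sqrtr_gt0. Qed.

Lemma sc_neq0 : sc != 0.
Proof. by rewrite gt_eqF // sc_gt0. Qed.

Lemma congruent_normalizedP V W : congruent (normalized V) W ->
  exists q, orthogonal q /\ W = mulset V (sc *: q).
Proof.
move=> [q oq ->]; exists q; split=> //; rewrite /normalized /mulset image_comp.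
by apply: eq_imagel => v _ /=; rewrite -scalemxAl scalemxAr.
Qed.

Lemma mulset_inj_finite V r : finite_set V -> orthogonal r ->
  (forall v, V v -> V (v *m r)) -> mulset V r = V.
Proof.
move=> /finite_seqP[s0 VE] or sub.
have {}VE : V = [set` undup s0].
  by rewrite VE; apply/seteqP; split=> v /=; rewrite mem_undup.
move: (undup_uniq s0) VE; move: (undup s0) => s us VE.
have us' : uniq (map (mulmxr r) s).
  by rewrite map_inj_uniq // => u v; exact: orthogonal_inj.
have ss : {subset map (mulmxr r) s <= s}.
  by move=> _ /mapP[v vs ->]; move: (sub v); rewrite VE; apply.
have [_ E] := uniq_min_size us' ss (eq_leq (esym (size_map _ _))).
by rewrite VE mulset_seq; apply/seteqP; split=> v /=; rewrite E.
Qed.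

Lemma tetrahedron_position V : regular_tetrahedron V ->
  exists q, is_rotation q /\ V = mulset T0 (sc *: q).
Proof.
move=> /congruent_normalizedP[q [oq VE]].
case: (orthogonal_det oq) => dq; first by exists q.
exists (swap3 *m q); split.
  split; first exact: orthogonalM swap3_orthogonal oq.
  by rewrite det_mulmx swap3_det dq mulrNN mulr1.
by rewrite scalemxAr -mulsetM swap3_tetrahedron.
Qed.

(** Were all products with the vertices of the tetrahedron 1 or -1, their
    squares would add up to 4 and not to 12; so every vertex of the cube is a
    vertex of the tetrahedron or opposite to one. *)
Lemma cube_position V q : orthogonal q -> regular_cube V ->
  mulset T0 (sc *: q) `<=` V -> V = mulset C0 (sc *: q).
Proof.
move=> oq /congruent_normalizedP[q' [oq' ->]] sub.
have Tc t : T0 t -> exists2 c', C0 c' & t *m q = c' *m q'.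
  move=> Tt; have [|c' Cc E] := sub (t *m (sc *: q)); first by exists t.
  by exists c' => //; apply: (scalerI sc_neq0); rewrite !scalemxAr.
apply/seteqP; split=> _ [v Cv <-].
  exists (v *m q' *m q^T); last first.
    by rewrite -!scalemxAr (orthogonalKV _ oq).
  set u := v *m q' *m q^T.
  have ud t : T0 t -> dot u t ^+ 2 = 9 \/ dot u t ^+ 2 = 1.
    move=> /Tc[c' Cc E]; rewrite /u dot_mulmx_tr trmxK E dot_orthogonal //.
    exact: cube_dot.
  have uu : dot u u = 3.
    rewrite /u !dot_orthogonal //; last exact: orthogonalT.
    by apply: dot_std_norm; left.
  have [s1 s2] := tetra_frame u; rewrite uu in s2; have [T1 T2 T3 T4] := tetra_in.
  case: (ud _ T1) => [|h1]; first exact: cube_of_dot.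
  case: (ud _ T2) => [|h2]; first exact: cube_of_dot.
  case: (ud _ T3) => [|h3]; first exact: cube_of_dot.
  case: (ud _ T4) => [|h4]; first exact: cube_of_dot.
  by exfalso; rewrite h1 h2 h3 h4 in s2; lra.
have [Tv|[t Tt <-]] : (T0 `|` [set - v | v in T0]) v by rewrite -std_cube_tetrahedra.
  by apply: sub; exists v.
have [c' Cc E] := Tc _ Tt; exists (- c').
  have [x [y [z cE]]] := vec3P c'; move: Cc; rewrite cE -scaleN1r vec3Z.
  by move=> /std_cubeE[hx hy hz]; apply/std_cubeE; rewrite !mulN1r !sqrrN.
by rewrite !mulNmx -!scalemxAr E.
Qed.

End Inscribed.

Section InscribedDodecahedron.
Implicit Types (u v w m t : 'rV[R]_3) (c q r s : 'M[R]_3) (x y z d : R).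
Implicit Types V F : set 'rV[R]_3.

Definition golden_vertex v :=
  [\/ golden_triple (v 0 0) (v 0 1) (v 0 2%:R), golden_triple (v 0 1) (v 0 2%:R) (v 0 0)
    | golden_triple (v 0 2%:R) (v 0 0) (v 0 1)].

Lemma golden_vertexE x y z : golden_vertex (vec3 x y z) <->
  [\/ golden_triple x y z, golden_triple y z x | golden_triple z x y].
Proof. by rewrite /golden_vertex !vec3E. Qed.

Lemma std_dodecahedronU v : D0 v <-> C0 v \/ golden_vertex v.
Proof.
have [x [y [z ->]]] := vec3P v.
split=> [/std_dodecahedronE[h|h|h|h]|[/std_cubeE h|/golden_vertexE[]h]].
- by left; apply/std_cubeE.
- by right; apply/golden_vertexE/Or31.
- by right; apply/golden_vertexE/Or32.
- by right; apply/golden_vertexE/Or33.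
- exact/std_dodecahedronE/Or41.
- exact/std_dodecahedronE/Or42.
- exact/std_dodecahedronE/Or43.
- exact/std_dodecahedronE/Or44.
Qed.

(** By transitivity one of the vertices is (1, 1, 1). *)
Lemma dodecahedron_dot u v : D0 u -> D0 v ->
  [\/ dot u v ^+ 2 = 9, dot u v ^+ 2 = 5 | dot u v ^+ 2 = 1].
Proof.
move=> Du /(corner_trans corner_std_dodecahedron)[r rr ->].
rewrite dotC dot_mulmx_tr dotC.
have : D0 (u *m r^T) by apply: rotation_group_mem (rotation_groupT rr) Du.
have g := golden_sqr.
have [x [y [z ->]]] := vec3P (u *m r^T); rewrite dotE.
by dodecahedron_cases; solve [ apply: Or31; ring: g | apply: Or32; ring: g
  | apply: Or33; ring: g ].
Qed.

(** The squared products of vertices of the two mirror images are [3 * phi +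
    2], [5 - 3 * phi], 0 or 4, none of which occurs within one dodecahedron. *)
Lemma golden_vertex_chirality u v : golden_vertex u -> golden_vertex (v *m swap3) ->
  ~ [\/ dot u v ^+ 2 = 9, dot u v ^+ 2 = 5 | dot u v ^+ 2 = 1].
Proof.
have [x [y [z ->]]] := vec3P u; have [x' [y' [z' ->]]] := vec3P v.
rewrite swap3E dotE => /golden_vertexE hu /golden_vertexE hv.
have g := golden_sqr; have /andP[b1 b2] := golden_bounds.
have big a b : a ^+ 2 = phi + 1 -> b ^+ 2 = phi + 1 ->
    ~ [\/ (a * b) ^+ 2 = 9, (a * b) ^+ 2 = 5 | (a * b) ^+ 2 = 1].
  move=> ha hb; have -> : (a * b) ^+ 2 = 3 * phi + 2 by rewrite exprMn ha hb; ring: g.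
  by case; lra.
have small a b : a ^+ 2 = 2 - phi -> b ^+ 2 = 2 - phi ->
    ~ [\/ (a * b) ^+ 2 = 9, (a * b) ^+ 2 = 5 | (a * b) ^+ 2 = 1].
  move=> ha hb; have -> : (a * b) ^+ 2 = 5 - 3 * phi by rewrite exprMn ha hb; ring: g.
  by case; lra.
have mixed a b a' b' : a ^+ 2 = 2 - phi -> b ^+ 2 = phi + 1 ->
    a' ^+ 2 = 2 - phi -> b' ^+ 2 = phi + 1 ->
    ~ [\/ (a * b' + b * a') ^+ 2 = 9, (a * b' + b * a') ^+ 2 = 5
        | (a * b' + b * a') ^+ 2 = 1].
  move=> ha hb ha' hb'.
  have /sqr_eq1 h1 : (a * b') ^+ 2 = 1 by rewrite exprMn ha hb'; ring: g.
  have /sqr_eq1 h2 : (b * a') ^+ 2 = 1 by rewrite exprMn hb ha'; ring: g.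
  by case: h1 h2 => -> [] ->; case; lra.
case: hu => -[-> hu1 hu2]; case: hv => -[-> hv1 hv2];
  rewrite ?mul0r ?mulr0 ?add0r ?addr0.
- exact: big.
- exact: mixed.
- exact: small.
- rewrite addrC; exact: mixed.
- exact: small.
- exact: big.
- exact: small.
- exact: big.
- exact: mixed.
Qed.

Lemma sqr_eq5 (a : R) : a ^+ 2 = 5 -> a = 2 * phi - 1 \/ a = - (2 * phi - 1).
Proof.
have g := golden_sqr.
move=> /eqP; rewrite (_ : 5 = (2 * phi - 1) ^+ 2); last by ring: g.
by rewrite eqf_sqr => /orP[]/eqP; [left|right].
Qed.

(** If a product is 3 or -3 then [u] is a vertex of the cube. Otherwise the
    frame identities leave the products [2 * phi - 1], [1 - 2 * phi], 1, -1 in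
    some order, and they determine [u]. *)
Lemma dodecahedron_candidates u : dot u u = 3 ->
  (forall t, T0 t -> [\/ dot u t ^+ 2 = 9, dot u t ^+ 2 = 5 | dot u t ^+ 2 = 1]) ->
  [\/ C0 u, golden_vertex u | golden_vertex (u *m swap3)].
Proof.
move=> uu ud; have [s1 s2] := tetra_frame u; rewrite uu in s2.
have {}ud t : T0 t -> C0 u \/ [\/ dot u t = 2 * phi - 1, dot u t = - (2 * phi - 1),
    dot u t = 1 | dot u t = -1].
  move=> Tt; case: (ud t Tt) => [/(cube_of_dot uu Tt)|/sqr_eq5[]|/sqr_eq1[]] h; first by left.
  - by right; apply: Or41.
  - by right; apply: Or42.
  - by right; apply: Or43.
  - by right; apply: Or44.
have [T1 T2 T3 T4] := tetra_in.
case: (ud _ T1) => [|h1]; first exact: Or31.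
case: (ud _ T2) => [|h2]; first exact: Or31.
case: (ud _ T3) => [|h3]; first exact: Or31.
case: (ud _ T4) => [|h4]; first exact: Or31.
move: h1 h2 h3 h4 s1 s2 {ud uu}; have [x [y [z ->]]] := vec3P u; rewrite !dotE swap3E.
set y1 := x * 1 + _ + _; set y2 := x * 1 + _ + _.
set y3 := x * -1 + _ + _; set y4 := x * -1 + _ + _.
have -> : x = (y1 + y2 - y3 - y4) / 4 by rewrite /y1 /y2 /y3 /y4; field.
have -> : y = (y1 - y2 + y3 - y4) / 4 by rewrite /y1 /y2 /y3 /y4; field.
have -> : z = (y1 - y2 - y3 + y4) / 4 by rewrite /y1 /y2 /y3 /y4; field.
move: y1 y2 y3 y4 => y1 y2 y3 y4 {u x y z T1 T2 T3 T4}.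
have g := golden_sqr; have /andP[b1 b2] := golden_bounds.
case=> ->; case=> ->; case=> ->; case=> -> s1 s2;
  try (by exfalso; clear -b1 b2 s1; lra); try (by exfalso; clear -g b1 b2 s2; lra);
  solve [ by apply/Or32/golden_vertexE/Or31; split; field: g
        | by apply/Or32/golden_vertexE/Or32; split; field: g
        | by apply/Or32/golden_vertexE/Or33; split; field: g
        | by apply/Or33/golden_vertexE/Or31; split; field: g
        | by apply/Or33/golden_vertexE/Or32; split; field: g
        | by apply/Or33/golden_vertexE/Or33; split; field: g ].
Qed.

(** Each vertex belongs to the cube or to one of two mirror images, and by
    chirality a single mirror image serves all of them. *)
Lemma dodecahedron_position V q : orthogonal q -> regular_dodecahedron V ->
  mulset T0 (sc *: q) `<=` V ->
  V = mulset D0 (sc *: q) \/ V = mulset D0 (sc *: (swap3 *m q)).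
Proof.
move=> oq /congruent_normalizedP[q' [oq' ->]] sub.
have oqT := orthogonalT oq; have oswap := swap3_orthogonal.
have Tc t : T0 t -> exists2 c', D0 c' & t *m q = c' *m q'.
  move=> Tt; have [|c' Cc E] := sub (t *m (sc *: q)); first by exists t.
  by exists c' => //; apply: (scalerI sc_neq0); rewrite !scalemxAr.
pose k := q' *m q^T; have ok : orthogonal k by exact: orthogonalM.
have kq : k *m q = q' by rewrite /k -mulmxA (orthogonal_tr oq) mulmx1.
have cand v : D0 v -> [\/ C0 (v *m k), golden_vertex (v *m k)
    | golden_vertex (v *m k *m swap3)].
  move=> Dv; apply: dodecahedron_candidates.
    by rewrite dot_orthogonal //; apply: dot_std_norm; right.
  move=> t /Tc[c' Dc E]; rewrite /k mulmxA dot_mulmx_tr trmxK E dot_orthogonal //.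
  exact: dodecahedron_dot.
have [_ _ fD] := finite_std.
have [all0|] := pselect (forall v, D0 v -> D0 (v *m k)).
  by left; rewrite -{2}(mulset_inj_finite fD ok all0) mulsetM -scalemxAr kq.
move=> /existsNP[v0 /not_implyP[Dv0 nD]]; right.
have [n1 n2] : ~ C0 (v0 *m k) /\ ~ golden_vertex (v0 *m k).
  by split=> h; apply: nD; apply/std_dodecahedronU; [left|right].
have g0 : golden_vertex (v0 *m k *m swap3) by case: (cand _ Dv0).
have all1 v : D0 v -> D0 (v *m (k *m swap3)).
  move=> Dv; rewrite mulmxA; apply/std_dodecahedronU; case: (cand _ Dv) => h.
  - left; have [x [y [z vE]]] := vec3P (v *m k); move: h; rewrite vE swap3E.
    by move=> /std_cubeE[hx hy hz]; apply/std_cubeE.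
  - case: (golden_vertex_chirality h g0).
    by rewrite dot_orthogonal //; exact: dodecahedron_dot.
  - by right.
have oks : orthogonal (k *m swap3) by exact: orthogonalM.
rewrite -{2}(mulset_inj_finite fD oks all1) mulsetM -scalemxAr !mulmxA.
by rewrite -(mulmxA k) swap3_sqr mulmx1 kq.
Qed.

End InscribedDodecahedron.

(** * Unit quaternions *)

Section Quaternions.
Implicit Types (r : 'M[R]_3).

Record quat := Quat { qre : R; qi : R; qj : R; qk : R }.
Implicit Types x y : quat.

Definition qmul x y := Quat
  (qre x * qre y - qi x * qi y - qj x * qj y - qk x * qk y)
  (qre x * qi y + qi x * qre y + qj x * qk y - qk x * qj y)
  (qre x * qj y - qi x * qk y + qj x * qre y + qk x * qi y)
  (qre x * qk y + qi x * qj y - qj x * qi y + qk x * qre y).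

Definition qconj x := Quat (qre x) (- qi x) (- qj x) (- qk x).
Definition qnorm x := qre x ^+ 2 + qi x ^+ 2 + qj x ^+ 2 + qk x ^+ 2.
Definition qunit x := qnorm x = 1.

(** The matrix of [v |-> x^* v x] on pure quaternions. *)
Definition rho x : 'M[R]_3 :=
  let: Quat a b c d := x in
  mx3 (a^+2 + b^+2 - c^+2 - d^+2) (2 * (b*c - a*d)) (2 * (b*d + a*c))
      (2 * (b*c + a*d)) (a^+2 - b^+2 + c^+2 - d^+2) (2 * (c*d - a*b))
      (2 * (b*d - a*c)) (2 * (c*d + a*b)) (a^+2 - b^+2 - c^+2 + d^+2).

Lemma rhoM x y : rho (qmul x y) = rho x *m rho y.
Proof.
case: x => a b c d; case: y => a' b' c' d'.
by rewrite /rho /qmul /= mx3_mul; congr mx3; ring.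
Qed.

Lemma qnormM x y : qnorm (qmul x y) = qnorm x * qnorm y.
Proof.
by case: x => a b c d; case: y => a' b' c' d'; rewrite /qnorm /qmul /=; ring.
Qed.

Lemma qunitM x y : qunit x -> qunit y -> qunit (qmul x y).
Proof. by rewrite /qunit qnormM => -> ->; rewrite mulr1. Qed.

Lemma rho_conj x : rho (qconj x) = (rho x)^T.
Proof. by case: x => a b c d; rewrite /rho /= mx3_tr; congr mx3; ring. Qed.

Lemma qunit_conj x : qunit x -> qunit (qconj x).
Proof. by rewrite /qunit /qnorm /= !sqrrN. Qed.

Lemma rho_rotation x : qunit x -> is_rotation (rho x).
Proof.
case: x => a b c d; rewrite /qunit /qnorm /= => h.
have {h}ha : a ^+ 2 = 1 - b ^+ 2 - c ^+ 2 - d ^+ 2 by rewrite -h; ring.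
split; first by rewrite mx3_tr mx3_mul mx3_1; congr mx3; ring: ha.
by rewrite mx3_det; ring: ha.
Qed.

Lemma rhoZ (s : R) a b c d :
  rho (Quat (s * a) (s * b) (s * c) (s * d)) = s ^+ 2 *: rho (Quat a b c d).
Proof.
rewrite /rho; apply/matrixP => i j.
by case: (ord3P i) => ->; case: (ord3P j) => ->; rewrite !mxE /=; ring.
Qed.

(** If [r = rho x] then [4 x x^T] is a symmetric matrix linear in the entries
    of [r]; its rows are the four candidates below. For every rotation [r] this
    matrix has rank one and trace 4, so that a row with positive diagonal entry
    is a multiple of a quaternion representing [r]. *)
Lemma rotation_rho r : is_rotation r -> exists2 x, qunit x & rho x = r.
Proof.
have [a [b [c [d [e [f [g [h [i ->]]]]]]]]] := mx3P r => rr.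
have [or _] := rr; have oT := orthogonal_tr or.
have [[Ea Eb Ec] [Ed Ee Ef] [Eg Eh Ei]] := rotation_cofactor rr.
move: or oT; rewrite /orthogonal !mx3_tr !mx3_mul mx3_1.
move=> /mx3_inj[[o11 o12 o13] [_ o22 o23] [_ _ o33]].
move=> /mx3_inj[[p11 p12 p13] [_ p22 p23] [_ _ p33]] {rr}.
have fin k k0 k1 k2 k3 : 0 < k ->
    rho (Quat k0 k1 k2 k3) = (4 * k) *: mx3 a b c d e f g h i ->
    k0 ^+ 2 + k1 ^+ 2 + k2 ^+ 2 + k3 ^+ 2 = 4 * k ->
    exists2 x, qunit x & rho x = mx3 a b c d e f g h i.
  move=> kp rE nE; pose s := (Num.sqrt (4 * k))^-1.
  have s2 : s ^+ 2 = (4 * k)^-1.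
    by rewrite exprVn sqr_sqrtr // mulr_ge0 // ltW.
  have k0n : 4 * k != 0 by rewrite mulf_neq0 ?gt_eqF.
  exists (Quat (s * k0) (s * k1) (s * k2) (s * k3)).
    by rewrite /qunit /qnorm /= !exprMn -!mulrDr nE s2 mulVf.
  by rewrite rhoZ rE s2 scalerA mulVf // scale1r.
have scE k : k *: mx3 a b c d e f g h i = mx3 (k*a) (k*b) (k*c) (k*d) (k*e) (k*f) (k*g) (k*h) (k * i).
  by apply/matrixP => u v; case: (ord3P u) => ->; case: (ord3P v) => ->; rewrite !mxE.
have [k0|k0] := ltP 0 (1 + a + e + i).
  apply: (fin _ (1 + a + e + i) (h - f) (c - g) (d - b) k0); last by lra.
  by rewrite scE /rho; congr mx3; lra.
have [k1|k1] := ltP 0 (1 + a - e - i).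
  apply: (fin _ (h - f) (1 + a - e - i) (b + d) (c + g) k1); last by lra.
  by rewrite scE /rho; congr mx3; lra.
have [k2|k2] := ltP 0 (1 - a + e - i).
  apply: (fin _ (c - g) (b + d) (1 - a + e - i) (f + h) k2); last by lra.
  by rewrite scE /rho; congr mx3; lra.
have k3 : 0 < 1 - a - e + i by lra.
apply: (fin _ (d - b) (c + g) (f + h) (1 - a - e + i) k3); last by lra.
by rewrite scE /rho; congr mx3; lra.
Qed.

End Quaternions.

(** * Rotations as linear fractional maps *)

Section StereographicProjection.
Implicit Types (v : 'rV[R]_3) (r s : 'M[R]_3) (x : quat) (z w a b c d : R[i]).
Implicit Types p : ext_plane R.

Definition homog z w : ext_plane R := if w == 0 then None else Some (z / w).

Definition sqn z : R := complex.Re z ^+ 2 + complex.Im z ^+ 2.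

(** The Hopf map: the point of the sphere lying over [z / w]. *)
Definition hopf z w : 'rV[R]_3 :=
  let: Complex z1 z2 := z in let: Complex w1 w2 := w in
  (sqn z + sqn w)^-1 *: vec3 (2 * (z1 * w1 + z2 * w2)) (2 * (z2 * w1 - z1 * w2))
    (z1 ^+ 2 + z2 ^+ 2 - w1 ^+ 2 - w2 ^+ 2).

Lemma sqn_ge0 z : 0 <= sqn z.
Proof. by rewrite addr_ge0 ?sqr_ge0. Qed.

Lemma sqn_eq0 z : (sqn z == 0) = (z == 0).
Proof. by case: z => a b; rewrite paddr_eq0 ?sqr_ge0 // !sqrf_eq0 eq_complex. Qed.

Lemma sqn2_gt0 z w : (z != 0) || (w != 0) -> 0 < sqn z + sqn w.
Proof.
move=> h; rewrite lt_neqAle eq_sym addr_ge0 ?sqn_ge0 // andbT.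
by rewrite paddr_eq0 ?sqn_ge0 // !sqn_eq0 negb_and.
Qed.

Lemma sqnM z w : sqn (z * w) = sqn z * sqn w.
Proof. by case: z => a b; case: w => c d; rewrite /sqn /=; ring. Qed.

Lemma hopf_sphere z w : (z != 0) || (w != 0) -> sphere (hopf z w).
Proof.
move=> /sqn2_gt0; case: z => z1 z2; case: w => w1 w2; rewrite /hopf /sphere /sqn /= => n0.
rewrite dotZl dotZr dotE; field; by rewrite gt_eqF.
Qed.

Lemma homogP p : exists z w, (z != 0) || (w != 0) /\ p = homog z w.
Proof.
case: p => [z|].
  by exists z, 1; rewrite oner_neq0 orbT /homog oner_eq0 divr1.
by exists 1, 0; rewrite oner_neq0 /homog eqxx.
Qed.

Lemma stereo_hopf z w : (z != 0) || (w != 0) -> stereo (hopf z w) = homog z w.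
Proof.
move=> /[dup] /sqn2_gt0; case: z => z1 z2; case: w => w1 w2.
rewrite /hopf /sqn /= => n0 _; set n := (X in X^-1) in n0 *.
have nn : n != 0 by rewrite gt_eqF.
rewrite vec3Z /stereo !vec3E /homog eq_complex /=.
have -> : (n^-1 * (z1 ^+ 2 + z2 ^+ 2 - w1 ^+ 2 - w2 ^+ 2) == 1) = (w1 == 0) && (w2 == 0).
  have -> : (w1 == 0) && (w2 == 0) = (w1 ^+ 2 + w2 ^+ 2 == 0).
    by rewrite paddr_eq0 ?sqr_ge0 // !sqrf_eq0.
  rewrite mulrC -[1](divff nn) -subr_eq0 -mulrBl mulf_eq0 invr_eq0 (negbTE nn) orbF.
  have -> : z1 ^+ 2 + z2 ^+ 2 - w1 ^+ 2 - w2 ^+ 2 - n = - 2 * (w1 ^+ 2 + w2 ^+ 2).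
    by rewrite /n; ring.
  by rewrite mulf_eq0 oppr_eq0 pnatr_eq0.
case: ifPn => // wn0; congr Some.
have w0 : w1 ^+ 2 + w2 ^+ 2 != 0 by rewrite paddr_eq0 ?sqr_ge0 // !sqrf_eq0.
have -> : 1 - n^-1 * (z1 ^+ 2 + z2 ^+ 2 - w1 ^+ 2 - w2 ^+ 2) = n^-1 * (2 * (w1 ^+ 2 + w2 ^+ 2)).
  by rewrite /n; field.
have wc0 : Complex w1 w2 != 0 by rewrite eq_complex.
apply: (mulIf wc0); rewrite mulfVK //.
rewrite -[LHS]/(Complex _ _); congr Complex.
  by field; rewrite w0 nn.
by field; rewrite w0 nn.
Qed.

Lemma stereo_inv_homog z w :
  (z != 0) || (w != 0) -> stereo_inv (homog z w) = hopf z w.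
Proof.
move=> /sqn2_gt0; case: z => z1 z2; case: w => w1 w2; rewrite /homog eq_complex /=.
case: ifPn => [/andP[/eqP-> /eqP->]|wn0 _].
  rewrite /sqn /= => n0.
  by rewrite /stereo_inv vec3Z; congr vec3; field; rewrite gt_eqF //; lra.
have w0 : w1 ^+ 2 + w2 ^+ 2 != 0 by rewrite paddr_eq0 ?sqr_ge0 // !sqrf_eq0.
set u := _ / _; have uw : u * Complex w1 w2 = Complex z1 z2.
  by rewrite mulfVK // eq_complex.
case: u uw => x y /= -[<- <-]; rewrite /sqn /= !vec3Z.
have d1 : x ^+ 2 + y ^+ 2 + 1 != 0.
  by rewrite gt_eqF // ltr_wpDl // addr_ge0 ?sqr_ge0.
have d2 : (x * w1 - y * w2) ^+ 2 + (x * w2 + y * w1) ^+ 2 + (w1 ^+ 2 + w2 ^+ 2) =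
  (x ^+ 2 + y ^+ 2 + 1) * (w1 ^+ 2 + w2 ^+ 2) by ring.
rewrite d2; congr vec3; field; by rewrite d1 w0.
Qed.

Lemma sphere_hopf v : sphere v -> exists z w, (z != 0) || (w != 0) /\ v = hopf z w.
Proof.
have [x [y [z ->]]] := vec3P v; rewrite /sphere /= dotE => h.
have [/eqP z1|z1] := boolP (z == 1).
  exists 1, 0; rewrite oner_neq0; split=> //.
  have x0 : x ^+ 2 = 0 by have := sqr_ge0 x; have := sqr_ge0 y; rewrite z1 in h; nra.
  have y0 : y ^+ 2 = 0 by have := sqr_ge0 x; have := sqr_ge0 y; rewrite z1 in h; nra.
  move/eqP: x0; move/eqP: y0; rewrite !sqrf_eq0 => /eqP-> /eqP->; rewrite z1.
  by rewrite /hopf /sqn /= vec3Z; congr vec3; field.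
exists (Complex x y), (Complex (1 - z) 0).
have n0 : 1 - z != 0 by rewrite subr_eq0 eq_sym.
rewrite !eq_complex /= (negbTE n0) orbT; split=> //.
rewrite /hopf /sqn /= vec3Z.
have e : x ^+ 2 = 1 - y ^+ 2 - z ^+ 2 by rewrite -h; ring.
have -> : x ^+ 2 + y ^+ 2 + ((1 - z) ^+ 2 + 0 ^+ 2) = 2 * (1 - z) by ring: e.
congr vec3; first by field.
  by field.
by field: e.
Qed.

Lemma stereoK v : sphere v -> stereo_inv (stereo v) = v.
Proof.
by move=> /sphere_hopf[z [w [zw ->]]]; rewrite stereo_hopf // stereo_inv_homog.
Qed.

Lemma stereo_invK p : stereo (stereo_inv p) = p.
Proof.
by have [z [w [zw ->]]] := homogP p; rewrite stereo_inv_homog // stereo_hopf.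
Qed.

Lemma stereo_inv_sphere p : sphere (stereo_inv p).
Proof.
by have [z [w [zw ->]]] := homogP p; rewrite stereo_inv_homog //; exact: hopf_sphere.
Qed.

Lemma sphereM v r : orthogonal r -> sphere v -> sphere (v *m r).
Proof. by move=> or; rewrite /sphere /= dot_orthogonal. Qed.

Lemma on_plane_stereo r v : sphere v -> on_plane r (stereo v) = stereo (v *m r).
Proof. by move=> sv; rewrite /on_plane stereoK. Qed.

Lemma on_planeM r s : orthogonal r -> on_plane (r *m s) = on_plane s \o on_plane r.
Proof.
move=> or; apply/funext => p; rewrite /on_plane /= stereoK ?mulmxA //.
by apply: sphereM => //; exact: stereo_inv_sphere.
Qed.

Lemma on_plane1 : on_plane (1%:M : 'M[R]_3) = id.
Proof. by apply/funext => p; rewrite /on_plane mulmx1 stereo_invK. Qed.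

Lemma on_plane_inj r s : orthogonal r -> orthogonal s ->
  on_plane r = on_plane s -> r = s.
Proof.
move=> or os e; have E v : sphere v -> v *m r = v *m s.
  move=> sv; rewrite -[LHS]stereoK; last exact: sphereM.
  by rewrite -on_plane_stereo // e on_plane_stereo // stereoK //; exact: sphereM.
apply/row_matrixP => i; rewrite !rowE; apply: E.
rewrite /sphere /= dot_mxE trmx_delta mul_delta_mx mxE !eqxx //.
Qed.

Lemma moebius_homog a b c d z w : (z != 0) || (w != 0) ->
  moebius a b c d (homog z w) = homog (a * z + b * w) (c * z + d * w).
Proof.
have [->|w0 _] := eqVneq w 0.
  rewrite orbF => z0; rewrite /homog eqxx /= !mulr0 !addr0 mulf_eq0 (negbTE z0) orbF.
  by case: ifPn => // c0; rewrite -mulf_div divff // mulr1.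
have e1 : c * (z / w) + d = (c * z + d * w) / w by field.
have e2 : a * (z / w) + b = (a * z + b * w) / w by field.
rewrite /homog (negbTE w0) /= e1 e2 mulf_eq0 invr_eq0 (negbTE w0) orbF; case: ifPn => // n0.
by congr Some; field; rewrite ?w0 ?n0.
Qed.

Definition su_moebius x := let: Quat a b c d := x in
  moebius (Complex a (- d)) (Complex c (- b)) (Complex (- c) (- b)) (Complex a d).

(** Through the Hopf map, [rho x] becomes the unitary matrix of [x] acting on
    homogeneous coordinates. *)
Lemma on_plane_rho x : qunit x -> on_plane (rho x) = su_moebius x.
Proof.
case: x => a b c d ux; apply/funext => p; have [z [w [zw ->]]] := homogP p.
rewrite /su_moebius moebius_homog //.
set z' := (X in _ = homog X _); set w' := (X in _ = homog _ X).
have nE : sqn z' + sqn w' = sqn z + sqn w.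
  rewrite -[RHS]mul1r -ux /z' /w' /qnorm /=.
  by case: z {zw z' w'} => z1 z2; case: w => w1 w2; rewrite /sqn /=; ring.
have zw' : (z' != 0) || (w' != 0).
  move: (sqn2_gt0 zw); rewrite -nE; apply: contraTT; rewrite negb_or !negbK.
  by move=> /andP[/eqP-> /eqP->]; rewrite /sqn /= expr0n /= !addr0 ltxx.
rewrite /on_plane stereo_inv_homog // -stereo_hopf //; congr stereo.
have hopfE (u v : R[i]) : hopf u v = (sqn u + sqn v)^-1 *: vec3
   (2 * (complex.Re u * complex.Re v + complex.Im u * complex.Im v))
   (2 * (complex.Im u * complex.Re v - complex.Re u * complex.Im v))
   (complex.Re u ^+ 2 + complex.Im u ^+ 2 - complex.Re v ^+ 2 - complex.Im v ^+ 2).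
  by case: u => ? ?; case: v.
rewrite !hopfE nE -scalemxAl; congr (_ *: _).
rewrite /z' /w' /rho vec3_mul {hopfE nE zw' zw z' w'}; case: z => z1 z2; case: w => w1 w2 /=.
by congr vec3; ring.
Qed.

End StereographicProjection.

(** * Finite sets *)

Section FiniteSets.

(** A map preserving [alpha] induces one of finitely many maps from [alpha] to
    itself, and the induced map determines [val]. *)
Lemma finite_stabilizer_values (M U : Type) (T : eqType) (alpha : set T) (S : set M)
    (act : M -> T -> T) (val : M -> U) :
  finite_set alpha ->
  (forall m p, S m -> alpha p -> alpha (act m p)) ->
  (forall m n, S m -> S n -> (forall p, alpha p -> act m p = act n p) ->
     val m = val n) ->
  finite_set (val @` S).
Proof.
move=> fa stab inj; have [s aE] : exists s : seq T, alpha = [set` s].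
  exact/finite_seqP.
have fin t : {subset t <= s} -> finite_set ((fun m => [seq act m p | p <- t]) @` S).
  elim: t => [|p t IH] sub.
    by apply: sub_finite_set (finite_set1 (@nil T)) => _ [m _ <-].
  apply: (@finite_image11 _ _ _ _ S cons (act^~ p) (fun m => [seq act m q | q <- t])).
    apply: sub_finite_set fa => _ [m Sm <-]; apply: stab => //.
    by rewrite aE /=; apply: sub; rewrite inE eqxx.
  by apply: IH => q qt; apply: sub; rewrite inE qt orbT.
have [[m0 Sm0]|S0] := pselect (exists m, S m); last first.
  by apply: sub_finite_set (@finite_set0 U) => u [m Sm _]; case: S0; exists m.
(* [val m0] is a default for the sequences that no map induces. *)
pose G t := if pselect (exists m, S m /\ [seq act m p | p <- s] = t) is left h
  then val (projT1 (cid h)) else val m0.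
have fs := finite_image G (fin s (fun _ h => h)).
apply: sub_finite_set fs.
move=> _ [m Sm <-]; exists [seq act m p | p <- s]; first by exists m.
rewrite /G; case: pselect => [h|[]]; last by exists m.
case: (cid h) => n /= [Sn E]; apply: inj => // p.
by rewrite aE /= => ps; move/eq_in_map: E; apply.
Qed.

Lemma finite_set_max (A : set R) a : finite_set A -> A a ->
  exists2 m, A m & forall b, A b -> b <= m.
Proof.
move=> /finite_seqP[s ->]; elim: s a => [|x s IH] a //.
case: s IH => [_|y s IH] _.
  by exists x => /= [|b]; rewrite !inE // => /eqP->.
have [|m ms mM] := IH y; first by rewrite /= inE eqxx.
have [xm|mx] := leP x m.
  exists m; first by rewrite /= inE ms orbT.
  by move=> b; rewrite /= inE => /orP[/eqP->//|]; exact: mM.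
exists x; first by rewrite /= inE eqxx.
move=> b; rewrite /= inE => /orP[/eqP->//|/mM bm].
exact: le_trans bm (ltW mx).
Qed.
End FiniteSets.

(** * Matrices of linear fractional maps *)

Section LinearFractional.
Implicit Types (v : 'rV[R]_3) (r s : 'M[R]_3) (x : quat) (z w : R[i]).
Implicit Types (p : ext_plane R) (alpha : set 'rV[R]_3).

Record lfm := Lfm { la : R[i]; lb : R[i]; lc : R[i]; ld : R[i] }.
Implicit Types m n : lfm.

Definition ldet m := la m * ld m - lb m * lc m.
Definition lapp m := moebius (la m) (lb m) (lc m) (ld m).
Definition lmul m n := Lfm (la m * la n + lb m * lc n) (la m * lb n + lb m * ld n)
  (lc m * la n + ld m * lc n) (lc m * lb n + ld m * ld n).
Definition lnorm m := sqn (la m) + sqn (lb m) + sqn (lc m) + sqn (ld m).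

Lemma ldetM m n : ldet (lmul m n) = ldet m * ldet n.
Proof. by case: m => a b c d; case: n => e f g h; rewrite /ldet /=; ring. Qed.

Lemma lapp_nonzero m z w : ldet m != 0 -> (z != 0) || (w != 0) ->
  (la m * z + lb m * w != 0) || (lc m * z + ld m * w != 0).
Proof.
case: m => a b c d; rewrite /ldet /= => m0; apply: contraTT.
rewrite !negb_or !negbK => /andP[/eqP e1 /eqP e2].
have z0 : (a * d - b * c) * z = 0.
  have -> : (a * d - b * c) * z = d * (a * z + b * w) - b * (c * z + d * w) by ring.
  by rewrite e1 e2; ring.
have w0 : (a * d - b * c) * w = 0.
  have -> : (a * d - b * c) * w = a * (c * z + d * w) - c * (a * z + b * w) by ring.
  by rewrite e1 e2; ring.
by move/eqP: z0; move/eqP: w0; rewrite !mulf_eq0 (negbTE m0) /= => -> ->.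
Qed.

Lemma lappM m n : ldet n != 0 -> lapp (lmul m n) = lapp m \o lapp n.
Proof.
move=> n0; apply/funext => p; have [z [w [zw ->]]] := homogP p.
rewrite /lapp /= !moebius_homog //; last exact: lapp_nonzero.
by congr homog; ring.
Qed.

Lemma lft_lfm h : lft h -> exists m, ldet m = 1 /\ h = lapp m.
Proof.
move=> [a [b [c [d [dn0 ->]]]]]; pose s := sqrtc (a * d - b * c).
have s2 : s ^+ 2 = a * d - b * c by rewrite sqr_sqrtc.
have s0 : s != 0 by apply: contraNneq dn0 => s0; rewrite -s2 s0 expr0n.
exists (Lfm (a / s) (b / s) (c / s) (d / s)); split.
  rewrite /ldet /= !mulf_div -mulrBl -expr2 s2 divff //.
apply/funext => p; have [z [w [zw ->]]] := homogP p.
rewrite /lapp /= !moebius_homog // /homog.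
have e1 (u v : R[i]) : u / s * z + v / s * w = (u * z + v * w) / s by ring.
rewrite !e1 mulf_eq0 invr_eq0 (negbTE s0) orbF; case: ifPn => // n0.
by congr Some; field; rewrite ?s0 ?n0.
Qed.

Lemma homog_inj z w z' w' : (z != 0) || (w != 0) -> (z' != 0) || (w' != 0) ->
  homog z w = homog z' w' <-> z * w' = z' * w.
Proof.
rewrite /homog => zw zw'.
have [w0|w0] := eqVneq w 0.
  move: zw; rewrite w0 eqxx orbF => z0; rewrite mulr0.
  have [w0'|w0'] := eqVneq w' 0; first by rewrite w0' mulr0.
  by split=> // /eqP; rewrite mulf_eq0 (negbTE z0) (negbTE w0').
have [w0'|w0'] := eqVneq w' 0.
  move: zw'; rewrite w0' eqxx orbF => z0; rewrite mulr0; split=> // /esym/eqP.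
  by rewrite mulf_eq0 (negbTE z0) (negbTE w0).
split=> [[e]|e]; last by congr Some; apply/eqP; rewrite eqr_div // e.
by apply/eqP; rewrite -eqr_div // e.
Qed.

(** Lagrange interpolation at three points of the projective line. *)
Lemma quadratic_form_zero (A B C z1 w1 z2 w2 z3 w3 : R[i]) :
  A * z1 ^+ 2 + B * (z1 * w1) + C * w1 ^+ 2 = 0 ->
  A * z2 ^+ 2 + B * (z2 * w2) + C * w2 ^+ 2 = 0 ->
  A * z3 ^+ 2 + B * (z3 * w3) + C * w3 ^+ 2 = 0 ->
  z1 * w2 != z2 * w1 -> z1 * w3 != z3 * w1 -> z2 * w3 != z3 * w2 ->
  [/\ A = 0, B = 0 & C = 0].
Proof.
set Q1 := _ + C * w1 ^+ 2; set Q2 := _ + C * w2 ^+ 2; set Q3 := _ + C * w3 ^+ 2.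
move=> e1 e2 e3; rewrite -subr_eq0 => d12; rewrite -subr_eq0 => d13; rewrite -subr_eq0 => d23.
pose D := (z1 * w2 - z2 * w1) * (z1 * w3 - z3 * w1) * (z2 * w3 - z3 * w2).
have Dn0 : D != 0 by rewrite !mulf_neq0.
have EA : A * D = Q1 * (w2 * w3 * (z2 * w3 - z3 * w2))
  - Q2 * (w1 * w3 * (z1 * w3 - z3 * w1)) + Q3 * (w1 * w2 * (z1 * w2 - z2 * w1)).
  by rewrite /D /Q1 /Q2 /Q3; ring.
have EC : C * D = Q1 * (z2 * z3 * (z2 * w3 - z3 * w2))
  - Q2 * (z1 * z3 * (z1 * w3 - z3 * w1)) + Q3 * (z1 * z2 * (z1 * w2 - z2 * w1)).
  by rewrite /D /Q1 /Q2 /Q3; ring.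
have EB : B * D = - Q1 * ((z2 * w3 + z3 * w2) * (z2 * w3 - z3 * w2))
  + Q2 * ((z1 * w3 + z3 * w1) * (z1 * w3 - z3 * w1))
  - Q3 * ((z1 * w2 + z2 * w1) * (z1 * w2 - z2 * w1)).
  by rewrite /D /Q1 /Q2 /Q3; ring.
rewrite !e1 !e2 !e3 ?oppr0 !mul0r ?subr0 ?addr0 in EA EB EC.
by split; apply: (mulIf Dn0); rewrite mul0r.
Qed.

(** Two linear fractional maps agree at the zeros of a binary quadratic form.
    Three zeros make the matrices proportional, and equal determinants make the
    factor 1 or -1. *)
Lemma lapp_three_points m n p1 p2 p3 : ldet m = 1 -> ldet n = 1 ->
  p1 != p2 -> p1 != p3 -> p2 != p3 ->
  lapp m p1 = lapp n p1 -> lapp m p2 = lapp n p2 -> lapp m p3 = lapp n p3 ->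
  lnorm m = lnorm n.
Proof.
have [z1 [w1 [h1 ->]]] := homogP p1; have [z2 [w2 [h2 ->]]] := homogP p2.
have [z3 [w3 [h3 ->]]] := homogP p3 => dm dn.
have neq z w z' w' : (z != 0) || (w != 0) -> (z' != 0) || (w' != 0) ->
    homog z w != homog z' w' -> z * w' != z' * w.
  by move=> h h'; apply: contra_neq => e; apply/homog_inj.
have dm0 : ldet m != 0 by rewrite dm oner_neq0.
have dn0 : ldet n != 0 by rewrite dn oner_neq0.
move=> /(neq _ _ _ _ h1 h2) n12 /(neq _ _ _ _ h1 h3) n13 /(neq _ _ _ _ h2 h3) n23.
have zero z w : (z != 0) || (w != 0) -> lapp m (homog z w) = lapp n (homog z w) ->
    (la m * lc n - la n * lc m) * z ^+ 2 +
    (la m * ld n + lb m * lc n - la n * ld m - lb n * lc m) * (z * w) +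
    (lb m * ld n - lb n * ld m) * w ^+ 2 = 0.
  move=> h; rewrite /lapp !moebius_homog //.
  move=> /(homog_inj (lapp_nonzero dm0 h) (lapp_nonzero dn0 h))/eqP.
  by rewrite -subr_eq0 => /eqP <-; ring.
move=> /(zero _ _ h1) q1 /(zero _ _ h2) q2 /(zero _ _ h3) q3.
have [eA0 eB0 eC0] := quadratic_form_zero q1 q2 q3 n12 n13 n23.
move: dm dn eA0 eB0 eC0; case: m {dm0 dn0 zero q1 q2 q3} => a b c d; case: n => a' b' c' d'.
rewrite /ldet /lnorm /= => dm dn eA0 eB0 eC0.
have eA : a * c' = a' * c by apply/subr0_eq.
have eC : b * d' = b' * d by apply/subr0_eq.
pose l := d * a' - b * c'.
have lE : l = a * d' - b' * c.
  by apply/subr0_eq; rewrite -oppr0 -eB0 /l; ring.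
have ea : a' = l * a.
  rewrite -[LHS]mulr1 -dm /l.
  have -> : (d * a' - b * c') * a = d * a' * a - b * (a * c') by ring.
  by rewrite eA; ring.
have eb : b' = l * b.
  rewrite -[LHS]mulr1 -dm lE.
  have -> : (a * d' - b' * c) * b = a * (b * d') - b' * c * b by ring.
  by rewrite eC; ring.
have ec : c' = l * c.
  rewrite -[LHS]mulr1 -dm /l.
  have -> : (d * a' - b * c') * c = d * (a' * c) - b * c' * c by ring.
  by rewrite -eA; ring.
have ed : d' = l * d.
  rewrite -[LHS]mulr1 -dm lE.
  have -> : (a * d' - b' * c) * d = a * d' * d - c * (b' * d) by ring.
  by rewrite -eC; ring.
have l2 : l ^+ 2 = 1.
  have -> : l ^+ 2 = l ^+ 2 * (a * d - b * c) by rewrite dm mulr1.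
  by rewrite -dn ea eb ec ed; ring.
have : sqn l ^+ 2 == 1 by rewrite expr2 -sqnM -expr2 l2 /sqn /=; apply/eqP; ring.
rewrite sqrf_eq1 => /orP[/eqP sl|/eqP sl]; last first.
  by have := sqn_ge0 l; rewrite sl ler0N1.
by rewrite ea eb ec ed !sqnM sl !mul1r.
Qed.

End LinearFractional.

(** * Stabilizers of finite sets are unitary *)

Section UnitaryStabilizer.
Implicit Types (v : 'rV[R]_3) (r s : 'M[R]_3) (x : quat) (m n : lfm).
Implicit Types (alpha : set 'rV[R]_3).

Definition invariant_under V alpha :=
  forall r v, rotation_group V r -> alpha v -> alpha (v *m r).

Lemma sphere_neq0 v : sphere v -> v != 0.
Proof. by move=> sv; apply/eqP => v0; move: sv; rewrite v0 /sphere /= dot0l => /eqP; rewrite eq_sym oner_eq0. Qed.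

(** The cyclic shifts of a point are distinct unless its coordinates are equal,
    and then sign changes move it. *)
Lemma tetra_invariant_three_points alpha v : invariant_under T0 alpha ->
  alpha `<=` sphere -> alpha v ->
  exists v1 v2 v3, [/\ alpha v1, alpha v2 & alpha v3] /\ [/\ v1 != v2, v1 != v3 & v2 != v3].
Proof.
move=> inv as_ av; have := sphere_neq0 (as_ _ av).
have [cT _ _] := cyc3_group.
have [x [y [z vE]]] := vec3P v.
have o : (1 : R) ^+ 2 = 1 by ring.
have o' : (-1 : R) ^+ 2 = 1 by ring.
have e1 : 1 * -1 * -1 = 1 :> R by ring.
have e2 : -1 * 1 * -1 = 1 :> R by ring.
have [d1 _ _] := diag3_group o o' o' e1; have [d2 _ _] := diag3_group o' o o' e2.
have a1 := inv _ _ cT av; have a2 := inv _ _ cT a1.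
have b1 := inv _ _ d1 av; have b2 := inv _ _ d2 av.
rewrite vE !cyc3E !diag3E in av a1 a2 b1 b2 *.
have [/andP[/eqP xy /eqP yz]|ne] := boolP ((x == y) && (y == z)).
  rewrite -vec3_0 vec3_eqE xy yz !andbb => z0; rewrite xy yz in av b1 b2.
  eexists; eexists; eexists; split; first by split; [exact: av|exact: b1|exact: b2].
  have zn : (z == z * -1) = false.
    by rewrite mulrN1 -subr_eq0 opprK -mulr2n mulrn_eq0 (negbTE z0).
  by rewrite !vec3_eqE !mulr1 (eq_sym (z * -1)) zn /= ?andbF.
move=> _; exists (vec3 x y z), (vec3 z x y), (vec3 y z x); split=> //.
have key (a b c : R) : ~~ ((a == b) && (b == c)) -> vec3 a b c != vec3 c a b.
  rewrite vec3_eqE; apply: contra => /and3P[/eqP-> /eqP-> _].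
  by rewrite !eqxx.
split; first exact: key.
  by rewrite eq_sym; apply: key; apply: contra ne => /andP[/eqP-> /eqP->]; rewrite !eqxx.
by apply: key; apply: contra ne => /andP[/eqP-> /eqP->]; rewrite !eqxx.
Qed.

Definition lift_quat x : lfm := let: Quat a b c d := x in
  Lfm (Complex a (- d)) (Complex c (- b)) (Complex (- c) (- b)) (Complex a d).

Lemma ldet_lift x : qunit x -> ldet (lift_quat x) = 1.
Proof.
case: x => a b c d; rewrite /qunit /qnorm /ldet /= => h.
by rewrite -[LHS]/(Complex _ _) -[1]/(Complex 1 0); congr Complex; [rewrite -h|]; ring.
Qed.

Lemma lapp_lift x : qunit x -> lapp (lift_quat x) = on_plane (rho x).
Proof. by move=> ux; rewrite on_plane_rho //; case: x ux. Qed.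

Definition qi1 : quat := Quat 0 1 0 0.
Definition qj1 : quat := Quat 0 0 1 0.
Definition qk1 : quat := Quat 0 0 0 1.

Lemma qunit_ijk : [/\ qunit qi1, qunit qj1 & qunit qk1].
Proof. by split; rewrite /qunit /qnorm /=; ring. Qed.

Lemma rho_ijk : [/\ rotation_group T0 (rho qi1), rotation_group T0 (rho qj1)
  & rotation_group T0 (rho qk1)].
Proof.
have o : (1 : R) ^+ 2 = 1 by ring.
have o' : (-1 : R) ^+ 2 = 1 by ring.
have D (a b c : R) : a ^+ 2 = 1 -> b ^+ 2 = 1 -> c ^+ 2 = 1 -> a * b * c = 1 ->
    rotation_group T0 (diag3 a b c).
  by move=> h1 h2 h3 h4; have [] := diag3_group h1 h2 h3 h4.
split.
- have -> : rho qi1 = diag3 1 (-1) (-1) by rewrite /rho /=; congr mx3; ring.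
  by apply: D => //; ring.
- have -> : rho qj1 = diag3 (-1) 1 (-1) by rewrite /rho /=; congr mx3; ring.
  by apply: D => //; ring.
- have -> : rho qk1 = diag3 (-1) (-1) 1 by rewrite /rho /=; congr mx3; ring.
  by apply: D => //; ring.
Qed.

(** The four matrices of the Klein group act irreducibly, so averaging
    [g N g^*] over them gives a scalar matrix; with [N = m m^*] this evaluates
    the mean of the squared norms of [m g m]. *)
Lemma klein_average m :
  lnorm (lmul m m) + lnorm (lmul m (lmul (lift_quat qi1) m)) +
  lnorm (lmul m (lmul (lift_quat qj1) m)) + lnorm (lmul m (lmul (lift_quat qk1) m))
  = 2 * lnorm m ^+ 2.
Proof.
case: m => [[a1 a2] [b1 b2] [c1 c2] [d1 d2]].
rewrite /lnorm /sqn /=; ring.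
Qed.

(** For determinant one, [lnorm m - 2] is the sum of [|a - d^*|^2] and [|b +
    c^*|^2], which vanishes exactly on SU(2). *)
Lemma lnorm_ge2 m : ldet m = 1 -> 2 <= lnorm m /\
  (lnorm m <= 2 -> exists2 x, qunit x & m = lift_quat x).
Proof.
case: m => [[a1 a2] [b1 b2] [c1 c2] [d1 d2]].
rewrite /ldet /lnorm /sqn /= => -[re im].
have E : a1 ^+ 2 + a2 ^+ 2 + (b1 ^+ 2 + b2 ^+ 2) + (c1 ^+ 2 + c2 ^+ 2) + (d1 ^+ 2 + d2 ^+ 2)
  = 2 + ((a1 - d1) ^+ 2 + (a2 + d2) ^+ 2 + (b1 + c1) ^+ 2 + (b2 - c2) ^+ 2).
  have -> : 2 = 2 * (a1 * d1 - a2 * d2 - (b1 * c1 - b2 * c2)) by rewrite re mulr1.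
  by ring.
have s1 := sqr_ge0 (a1 - d1); have s2 := sqr_ge0 (a2 + d2).
have s3 := sqr_ge0 (b1 + c1); have s4 := sqr_ge0 (b2 - c2).
split; first by lra.
move=> le2.
have z1 : a1 - d1 = 0 by apply/eqP; rewrite -sqrf_eq0 eq_le s1 andbT; lra.
have z2 : a2 + d2 = 0 by apply/eqP; rewrite -sqrf_eq0 eq_le s2 andbT; lra.
have z3 : b1 + c1 = 0 by apply/eqP; rewrite -sqrf_eq0 eq_le s3 andbT; lra.
have z4 : b2 - c2 = 0 by apply/eqP; rewrite -sqrf_eq0 eq_le s4 andbT; lra.
exists (Quat a1 (- b2) b1 (- a2)); rewrite /qunit /qnorm /=.
  move: re; have -> : d1 = a1 by lra.
  have -> : d2 = - a2 by lra.
  have -> : c1 = - b1 by lra.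
  have -> : c2 = b2 by lra.
  by move=> <-; ring.
by rewrite !opprK; congr (Lfm (Complex _ _) (Complex _ _) (Complex _ _) (Complex _ _)); lra.
Qed.

(** An element [m] of maximal norm of the stabilizer satisfies
    [2 |m|^4 <= 4 |m|^2] by the averaging identity, hence [|m|^2 <= 2]: the whole
    stabilizer is unitary. *)
Lemma lft_stabilizer_rotation alpha v h : finite_set alpha -> alpha `<=` sphere ->
  alpha v -> invariant_under T0 alpha -> lft_stabilizer alpha h ->
  exists2 x, qunit x & h = on_plane (rho x) /\ mulset alpha (rho x) = alpha.
Proof.
move=> fa as_ av inv [/lft_lfm[m0 [dm0 hE]] hst].
pose S : set lfm := [set m | ldet m = 1 /\ lapp m @` (stereo @` alpha) = stereo @` alpha].
have S0 : S m0 by split; rewrite -?hE.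
have SM m n : S m -> S n -> S (lmul m n).
  move=> [dm sm] [dn sn]; split; first by rewrite ldetM dm dn mulr1.
  by rewrite lappM ?dn ?oner_neq0 // image_comp -[RHS]sm -[in RHS]sn !image_comp.
have SG x : qunit x -> rotation_group T0 (rho x) -> S (lift_quat x).
  move=> ux rx; split; first exact: ldet_lift.
  rewrite lapp_lift //; apply/seteqP; split=> [_ [_ [u au <-] <-]|_ [u au <-]].
    exists (u *m rho x); first exact: inv.
    by rewrite on_plane_stereo //; exact: as_.
  have rT := rotation_groupT rx.
  exists (stereo (u *m (rho x)^T)); first by exists (u *m (rho x)^T) => //; exact: inv.
  by rewrite on_plane_stereo ?(orthogonalKV _ rx.1.1) //; apply/as_/inv.
have fin : finite_set (lnorm @` S).
  have [v1 [v2 [v3 [[a1 a2 a3] [n12 n13 n23]]]]] := tetra_invariant_three_points inv as_ av.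
  have sneq u w : alpha u -> alpha w -> u != w -> stereo u != stereo w.
    move=> au aw; apply: contra_neq => e.
    by rewrite -(stereoK (as_ _ au)) e stereoK //; exact: as_.
  apply: (finite_stabilizer_values (act := lapp) (finite_image stereo fa)).
    by move=> m p [_ E] sp; rewrite -E; exists p.
  move=> m n [dm _] [dn _] E.
  by apply: (lapp_three_points dm dn (sneq _ _ a1 a2 n12) (sneq _ _ a1 a3 n13)
    (sneq _ _ a2 a3 n23)); apply: E; [exists v1|exists v2|exists v3].
have [|_ [m Sm <-] mmax] := finite_set_max fin (a := lnorm m0); first by exists m0.
have [ui uj uk] := qunit_ijk; have [ri rj rk] := rho_ijk.
have le m' : S m' -> lnorm m' <= lnorm m by move=> Sm'; apply: mmax; exists m'.
have L1 := le _ (SM _ _ Sm Sm).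
have L2 := le _ (SM _ _ Sm (SM _ _ (SG _ ui ri) Sm)).
have L3 := le _ (SM _ _ Sm (SM _ _ (SG _ uj rj) Sm)).
have L4 := le _ (SM _ _ Sm (SM _ _ (SG _ uk rk) Sm)).
have avg := klein_average m.
have [ge2 _] := lnorm_ge2 Sm.1.
have m2 : lnorm m <= 2.
  have : 2 * lnorm m ^+ 2 <= 4 * lnorm m by rewrite -avg; lra.
  rewrite expr2; nra.
have [_ /(_ (le_trans (le _ S0) m2))[x ux m0E]] := lnorm_ge2 dm0.
have hx : h = on_plane (rho x) by rewrite hE m0E lapp_lift.
exists x => //; split=> //.
have or := (rho_rotation ux).1.
have st u : alpha u -> exists2 w, alpha w & u *m rho x = w.
  move=> au; have : (stereo @` alpha) (h (stereo u)).
    by rewrite -hst; exists (stereo u) => //; exists u.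
  rewrite hx on_plane_stereo; last exact: as_.
  move=> [w aw e]; exists w => //; rewrite -(stereoK (as_ _ aw)) e stereoK //.
  by apply: sphereM => //; exact: as_.
apply: mulset_inj_finite => // u au; by have [w aw ->] := st u au.
Qed.

End UnitaryStabilizer.

(** * Elements of maximal real part *)

Section FiniteQuaternionGroups.
Implicit Types (v : 'rV[R]_3) (r s : 'M[R]_3) (x y u h : quat).

Definition qone : quat := Quat 1 0 0 0.
Definition qopp x : quat := Quat (- qre x) (- qi x) (- qj x) (- qk x).
Definition qconjg u x := qmul (qmul u x) (qconj u).
Definition hurwitz (e f g : R) : quat := Quat (1/2) (e/2) (f/2) (g/2).

Lemma quat_eta x : x = Quat (qre x) (qi x) (qj x) (qk x).
Proof. by case: x. Qed.

Lemma quat_ext x y : qre x = qre y -> qi x = qi y -> qj x = qj y -> qk x = qk y -> x = y.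
Proof. by case: x; case: y => * /=; congr Quat. Qed.

Lemma qmulV x : qunit x -> qmul x (qconj x) = qone.
Proof.
by case: x => a b c d; rewrite /qunit /qnorm /= => h; apply: quat_ext => /=; rewrite -?h; ring.
Qed.

Lemma qmul_eq1 x y : qunit y -> qmul x y = qone -> x = qconj y.
Proof.
move=> uy E; have e : qmul (qmul x y) (qconj y) = x.
  have {}uy : qre y ^+ 2 = 1 - qi y ^+ 2 - qj y ^+ 2 - qk y ^+ 2.
    by rewrite -uy /qnorm; ring.
  by case: x y uy {E} => a b c d [a' b' c' d'] /= h; apply: quat_ext => /=; ring: h.
by rewrite -e E; case: y {uy E e} => a b c d; apply: quat_ext => /=; ring.
Qed.

Lemma qunit_re1 x : qunit x -> qre x = 1 -> x = qone.
Proof.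
case: x => a b c d; rewrite /qunit /qnorm /= => h a1.
have s1 := sqr_ge0 b; have s2 := sqr_ge0 c; have s3 := sqr_ge0 d.
have z1 : b = 0 by apply/eqP; rewrite -sqrf_eq0 eq_le s1 andbT; rewrite a1 in h; lra.
have z2 : c = 0 by apply/eqP; rewrite -sqrf_eq0 eq_le s2 andbT; rewrite a1 in h; lra.
have z3 : d = 0 by apply/eqP; rewrite -sqrf_eq0 eq_le s3 andbT; rewrite a1 in h; lra.
by rewrite a1 z1 z2 z3.
Qed.

Lemma qunit_re_bounds x : qunit x -> -1 <= qre x <= 1.
Proof.
case: x => a b c d; rewrite /qunit /qnorm /= => h.
have s1 := sqr_ge0 b; have s2 := sqr_ge0 c; have s3 := sqr_ge0 d.
apply/andP; split; nra.
Qed.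

(** The Chebyshev polynomials of degree 2 to 5. *)
Lemma qre_powers x : qunit x ->
  [/\ qre (qmul x x) = 2 * qre x ^+ 2 - 1,
      qre (qmul (qmul x x) x) = 4 * qre x ^+ 3 - 3 * qre x,
      qre (qmul (qmul x x) (qmul x x)) = 8 * qre x ^+ 4 - 8 * qre x ^+ 2 + 1 &
      qre (qmul (qmul (qmul x x) (qmul x x)) x)
        = 16 * qre x ^+ 5 - 20 * qre x ^+ 3 + 5 * qre x].
Proof.
case: x => a b c d; rewrite /qunit /qnorm /= => h.
have {}h : b ^+ 2 = 1 - a ^+ 2 - c ^+ 2 - d ^+ 2 by rewrite -h; ring.
split; ring: h.
Qed.

(** The distance of a commutator from 1 is governed by the cross product of the
    imaginary parts, hence it is small when the axes are close or the angles
    small. *)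
Lemma qre_commutator x y : qunit x -> qunit y ->
  qre (qmul (qmul x y) (qmul (qconj x) (qconj y))) =
  1 - 2 * ((qj x * qk y - qk x * qj y) ^+ 2 + (qk x * qi y - qi x * qk y) ^+ 2
    + (qi x * qj y - qj x * qi y) ^+ 2).
Proof.
case: x => a b c d; case: y => a' b' c' d'; rewrite /qunit /qnorm /= => h h'.
have {}h : b ^+ 2 = 1 - a ^+ 2 - c ^+ 2 - d ^+ 2 by rewrite -h; ring.
have {}h' : b' ^+ 2 = 1 - a' ^+ 2 - c' ^+ 2 - d' ^+ 2 by rewrite -h'; ring.
ring: h h'.
Qed.

Lemma qconjg_i x : qconjg qi1 x = Quat (qre x) (qi x) (- qj x) (- qk x).
Proof. by case: x => a b c d; apply: quat_ext => /=; ring. Qed.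

Lemma qconjg_j x : qconjg qj1 x = Quat (qre x) (- qi x) (qj x) (- qk x).
Proof. by case: x => a b c d; apply: quat_ext => /=; ring. Qed.

Lemma qconjg_k x : qconjg qk1 x = Quat (qre x) (- qi x) (- qj x) (qk x).
Proof. by case: x => a b c d; apply: quat_ext => /=; ring. Qed.

Lemma qconjg_hurwitz x : qconjg (hurwitz 1 1 1) x = Quat (qre x) (qk x) (qi x) (qj x).
Proof. by case: x => a b c d; apply: quat_ext => /=; field. Qed.

(** What a finite group of unit quaternions containing the Hurwitz units
    provides for the angle estimates below. *)
Record extremal (A : set quat) h : Prop := Extremal {
  extremal_unit : forall x, A x -> qunit x;
  extremal_mul : forall x y, A x -> A y -> A (qmul x y);
  extremal_conj : forall x, A x -> A (qconj x);
  extremal_opp : forall x, A x -> A (qopp x);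
  extremal_i : A qi1;
  extremal_j : A qj1;
  extremal_k : A qk1;
  extremal_hurwitz : forall e f g, e ^+ 2 = 1 -> f ^+ 2 = 1 -> g ^+ 2 = 1 -> A (hurwitz e f g);
  extremal_mem : A h;
  extremal_ge0 : 0 <= qre h;
  extremal_lt1 : qre h < 1;
  extremal_max : forall x, A x -> x <> qone -> qre x <= qre h
}.

Section Maximal.
Context (A : set quat) (h : quat) (H : extremal A h).

Lemma extremal_conjg u x : A u -> A x -> A (qconjg u x).
Proof. by move=> Au Ax; apply: extremal_mul H _ _ _ _; [exact: extremal_mul H _ _ _ _|exact: extremal_conj H _ _]. Qed.

Lemma extremal_cyc x : A x -> A (Quat (qre x) (qk x) (qi x) (qj x)).
Proof.
by move=> Ax; rewrite -qconjg_hurwitz; apply: extremal_conjg => //; apply: extremal_hurwitz H _ _ _ _ _ _; ring.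
Qed.

Lemma extremal_signs x : A x -> [/\ A (Quat (qre x) (qi x) (- qj x) (- qk x)),
  A (Quat (qre x) (- qi x) (qj x) (- qk x)) & A (Quat (qre x) (- qi x) (- qj x) (qk x))].
Proof.
move=> Ax; rewrite -qconjg_i -qconjg_j -qconjg_k.
by split; apply: extremal_conjg => //; [exact: extremal_i H|exact: extremal_j H|exact: extremal_k H].
Qed.

(** The commutator of [h] with a conjugate that has another axis differs from
    1, so its real part is at most that of [h]. This bounds the angle of the
    quaternion [h] from below, by a little more than 30 degrees. *)
Lemma extremal_re_bound : qre h < 86 / 100.
Proof.
have uh := extremal_unit H (extremal_mem H); have hA := extremal_mem H.
have comm k : A k -> qre k = qre h ->
    0 < (qj h * qk k - qk h * qj k) ^+ 2 + (qk h * qi k - qi h * qk k) ^+ 2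
    + (qi h * qj k - qj h * qi k) ^+ 2 ->
    qre h < 86 / 100.
  move=> Ak kre; have uk := extremal_unit H Ak; have E := qre_commutator uh uk.
  set N := (X in 0 < X) in E *; move=> N0.
  have le : 1 - 2 * N <= qre h.
    rewrite -E; apply: extremal_max H _ _ _.
      by apply: extremal_mul H _ _ _ _; apply: extremal_mul H _ _ _ _ => //; exact: extremal_conj H _ _.
    by move=> e; rewrite e in E; change (1 = 1 - 2 * N) in E; lra.
  have Nle : N <= (1 - qre h ^+ 2) ^+ 2.
    have -> : (1 - qre h ^+ 2) ^+ 2 = (qi h ^+ 2 + qj h ^+ 2 + qk h ^+ 2) *
      (qi k ^+ 2 + qj k ^+ 2 + qk k ^+ 2).
      rewrite expr2; congr (_ * _); first by rewrite -uh /qnorm; ring.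
      by rewrite -kre -uk /qnorm; ring.
    rewrite -subr_ge0 /N.
    have -> : (qi h ^+ 2 + qj h ^+ 2 + qk h ^+ 2) * (qi k ^+ 2 + qj k ^+ 2 + qk k ^+ 2) -
      ((qj h * qk k - qk h * qj k) ^+ 2 + (qk h * qi k - qi h * qk k) ^+ 2
    + (qi h * qj k - qj h * qi k) ^+ 2) = (qi h * qi k + qj h * qj k + qk h * qk k) ^+ 2 by ring.
    exact: sqr_ge0.
  have lt1 := extremal_lt1 H; have ge0 := extremal_ge0 H.
  move: (qre h) le Nle lt1 ge0 => a le Nle lt1 ge0.
  rewrite ltNge; apply/negP => big.
  have : 1 - a <= 2 * (1 - a ^+ 2) ^+ 2 by lra.
  have -> : 2 * (1 - a ^+ 2) ^+ 2 = (1 - a) * (2 * (1 - a) * (1 + a) ^+ 2) by ring.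
  rewrite -{1}[1 - a]mulr1 ler_pM2l; last by lra.
  rewrite leNgt => /negP; apply.
  nra.
have [si sj _] := extremal_signs hA; have sw := extremal_cyc hA.
have := comm _ sw erefl; have := comm _ sj erefl; have := comm _ si erefl => /=.
have lt1 := extremal_lt1 H; have ge0 := extremal_ge0 H.
move: uh lt1 ge0; rewrite /qunit /qnorm; case: (h) => a b c d /= uh lt1 ge0 K1 K2 K3.
(* If all three conjugates have the axis of [h], then its imaginary part is zero. *)
rewrite ltNge; apply/negP => big.
have nK (P : Prop) : (P -> a < 86 / 100) -> ~ P by move=> K /K; lra.
have {}K1 := nK _ K1; have {}K2 := nK _ K2; have {}K3 := nK _ K3.
have z (s : R) : ~ 0 < s -> 0 <= s -> s = 0.
  by move=> /negP; rewrite -leNgt => s1 s2; apply/eqP; rewrite eq_le s1 s2.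
have {}K1 := z _ K1 (addr_ge0 (addr_ge0 (sqr_ge0 _) (sqr_ge0 _)) (sqr_ge0 _)).
have {}K2 := z _ K2 (addr_ge0 (addr_ge0 (sqr_ge0 _) (sqr_ge0 _)) (sqr_ge0 _)).
have {}K3 := z _ K3 (addr_ge0 (addr_ge0 (sqr_ge0 _) (sqr_ge0 _)) (sqr_ge0 _)).
have p1 := sqr_ge0 (b * c); have p2 := sqr_ge0 (b * d); have p3 := sqr_ge0 (c * d).
have bc0 : (b * c) ^+ 2 = 0 by lra.
have bd0 : (b * d) ^+ 2 = 0 by lra.
have cd0 : (c * d) ^+ 2 = 0 by lra.
have bc : b * c = 0 by apply/eqP; rewrite -sqrf_eq0 bc0.
have bd : b * d = 0 by apply/eqP; rewrite -sqrf_eq0 bd0.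
have cd : c * d = 0 by apply/eqP; rewrite -sqrf_eq0 cd0.
have : b ^+ 4 + c ^+ 4 + d ^+ 4 = 0.
  rewrite -K3; ring: bc bd cd.
have q1' := sqr_ge0 (b ^+ 2); have q2' := sqr_ge0 (c ^+ 2); have q3' := sqr_ge0 (d ^+ 2).
rewrite -!exprM in q1' q2' q3' => q0.
have b0 : b ^+ 4 = 0 by lra.
have c0 : c ^+ 4 = 0 by lra.
have d0 : d ^+ 4 = 0 by lra.
move/eqP: b0; rewrite expf_eq0 => /eqP b0; move/eqP: c0; rewrite expf_eq0 => /eqP c0.
move/eqP: d0; rewrite expf_eq0 => /eqP d0; rewrite b0 c0 d0 in uh; nra.
Qed.

End Maximal.
End FiniteQuaternionGroups.

Section ExtremalElement.
Implicit Types (v : 'rV[R]_3) (r s : 'M[R]_3) (x y u h : quat).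
Context (A : set quat) (h : quat) (H : extremal A h).

(** Strictly between 30 and 45 degrees, [- h ^ 5] has a smaller angle than [h];
    so the angle of [h] is 45 degrees unless [- h ^ 5 = 1]. *)
Lemma extremal_re_values : 1 / 2 <= qre h ^+ 2 -> qre h ^+ 2 = 1 / 2 \/ qre h = phi / 2.
Proof.
move=> big; have uh := extremal_unit H (extremal_mem H); have small := extremal_re_bound H.
have ge0 := extremal_ge0 H; have hA := extremal_mem H.
have [_ _ _ r5] := qre_powers uh.
set h5 := qmul _ h in r5.
have A5 : A (qopp h5) by apply: extremal_opp H _ _; rewrite /h5; do 3?[apply: extremal_mul H _ _ _ _ => //].
have re : qre (qopp h5) = - (16 * qre h ^+ 5 - 20 * qre h ^+ 3 + 5 * qre h) by rewrite -r5.
have [e|ne] := pselect (qopp h5 = qone).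
  right; rewrite e in re; change (1 = - (16 * qre h ^+ 5 - 20 * qre h ^+ 3 + 5 * qre h)) in re.
  move: (qre h) ge0 re {big small} => a ge0 re.
  have : (a + 1) * (4 * a ^+ 2 - 2 * a - 1) ^+ 2 = 0.
    have -> : (a + 1) * (4 * a ^+ 2 - 2 * a - 1) ^+ 2 =
      16 * a ^+ 5 - 20 * a ^+ 3 + 5 * a + 1 by ring.
    lra.
  move/eqP; rewrite mulf_eq0 gt_eqF ?ltr_wpDl //= sqrf_eq0 => /eqP e2.
  have g := golden_sqr; have /andP[b1 b2] := golden_bounds.
  have : (2 * a - phi) * (2 * a + phi - 1) = 0.
    have -> : (2 * a - phi) * (2 * a + phi - 1) = 4 * a ^+ 2 - 2 * a - 1 by ring: g.
    exact: e2.
  move/eqP; rewrite mulf_eq0 => /orP[]/eqP; lra.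
left; have := extremal_max H A5 ne; rewrite re.
move: (qre h) ge0 big small => a ge0 big small le.
have a0 : 0 < a by rewrite lt_neqAle ge0 andbT eq_sym; apply: contraTneq big => ->; lra.
have : a * ((3 - 4 * a ^+ 2) * (2 * a ^+ 2 - 1)) <= 0.
  have -> : a * ((3 - 4 * a ^+ 2) * (2 * a ^+ 2 - 1)) =
    ((- (16 * a ^+ 5 - 20 * a ^+ 3 + 5 * a)) - a) / 2 by field.
  lra.
rewrite pmulr_rle0 // pmulr_rle0; first by move=> *; lra.
nra.
Qed.

(** When [h] has angle 45 degrees, comparison with the products of [h] by the
    units [(1 +- i +- j +- k) / 2] forces the axis of [h] onto a coordinate axis. *)
Lemma extremal_quarter_turn : qre h ^+ 2 = 1 / 2 -> exists2 x, A x & rho x = quarter3.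
Proof.
move=> a2; have uh := extremal_unit H (extremal_mem H); have ge0 := extremal_ge0 H; have hA := extremal_mem H.
have an : qre h <> 1 / 2 by move=> e; rewrite e in a2; lra.
have bnd e f g : e ^+ 2 = 1 -> f ^+ 2 = 1 -> g ^+ 2 = 1 ->
    - (e * qi h + f * qj h + g * qk h) <= qre h.
  move=> he hf hg; have Au := extremal_hurwitz H he hf hg; have uu := extremal_unit H Au.
  have Ahu := extremal_mul H hA Au.
  have ne : qmul h (hurwitz e f g) <> qone.
    by move=> E; apply: an; rewrite (qmul_eq1 uu E).
  by have := extremal_max H Ahu ne; rewrite /=; lra.
have o : (1 : R) ^+ 2 = 1 by ring.
have o' : (-1 : R) ^+ 2 = 1 by ring.
have B1 := bnd _ _ _ o o o; have B2 := bnd _ _ _ o o o'; have B3 := bnd _ _ _ o o' o.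
have B4 := bnd _ _ _ o o' o'; have B5 := bnd _ _ _ o' o o; have B6 := bnd _ _ _ o' o o'.
have B7 := bnd _ _ _ o' o' o; have B8 := bnd _ _ _ o' o' o'.
have main b c d : b ^+ 2 = qre h ^+ 2 -> c = 0 -> d = 0 -> A (Quat (qre h) b c d) ->
    exists2 x, A x & rho x = quarter3.
  move=> hb c0 d0 Ax.
  have /orP[/eqP b0|/eqP b0] : (b == qre h) || (b == - qre h).
  - by rewrite -eqf_sqr hb.
  - exists (Quat (qre h) b c d) => //.
    by rewrite b0 c0 d0 /rho /quarter3; congr mx3; lra.
  have [_ As _] := extremal_signs H Ax; rewrite /= in As; eexists; first exact: As.
  by rewrite b0 c0 d0 /rho /quarter3; congr mx3; lra.
have [b [c [d hE]]] : exists b c d, h = Quat (qre h) b c d.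
  by exists (qi h), (qj h), (qk h); exact: quat_eta.
have Ab : A (Quat (qre h) b c d) by rewrite -hE.
have Ac := extremal_cyc H Ab; have Ad := extremal_cyc H Ac; rewrite /= in Ac Ad.
move: uh B1 B2 B3 B4 B5 B6 B7 B8; rewrite hE /qunit /qnorm /=.
move: (qre h) a2 ge0 main Ab Ac Ad {hE an bnd} => a a2 ge0 main Ab Ac Ad uh B1 B2 B3 B4 B5 B6 B7 B8.
have P (s : R) : s <= a -> - s <= a -> s ^+ 2 <= a ^+ 2.
  by move=> s1 s2; rewrite -subr_ge0 subr_sqr mulr_ge0 //; lra.
have P1 := P (b + c + d); have P2 := P (b + c - d); have P3 := P (b - c + d).
have P4 := P (- b + c + d).
have {P}P1 : (b + c + d) ^+ 2 <= a ^+ 2 by apply: P1; lra.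
have {}P2 : (b + c - d) ^+ 2 <= a ^+ 2 by apply: P2; lra.
have {}P3 : (b - c + d) ^+ 2 <= a ^+ 2 by apply: P3; lra.
have {}P4 : (- b + c + d) ^+ 2 <= a ^+ 2 by apply: P4; lra.
clear B1 B2 B3 B4 B5 B6 B7 B8.
have bc : b * c = 0 by lra.
have bd : b * d = 0 by lra.
have cd : c * d = 0 by lra.
have [b0|b0] := eqVneq b 0.
  have [c0|c0] := eqVneq c 0.
    by apply: (main d b c) => //; rewrite b0 c0 in uh; lra.
  have d0 : d = 0 by apply: (mulfI c0); rewrite cd mulr0.
  by apply: (main c d b) => //; rewrite b0 d0 in uh; lra.
have c0 : c = 0 by apply: (mulfI b0); rewrite bc mulr0.
have d0 : d = 0 by apply: (mulfI b0); rewrite bd mulr0.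
by apply: (main b c d) => //; rewrite c0 d0 in uh; lra.
Qed.

(** When [h] has angle 36 degrees, an element of real part at most [sin 36] in
    absolute value has angle 60, 72 or 90 degrees up to sign: otherwise its
    square or its cube would be too close to [-1]. *)
Lemma extremal_golden_re y : qre h = phi / 2 -> A y -> qre y ^+ 2 <= (3 - phi) / 4 ->
  [\/ qre y ^+ 2 = 0, qre y ^+ 2 = (2 - phi) / 4 | qre y ^+ 2 = 1 / 4].
Proof.
move=> hE Ay y1; have g := golden_sqr; have /andP[b1 b2] := golden_bounds.
have main x : A x -> 0 <= qre x -> qre x ^+ 2 <= (3 - phi) / 4 -> [\/ qre x ^+ 2 = 0,
    qre x ^+ 2 = (2 - phi) / 4 | qre x ^+ 2 = 1 / 4].
  move=> Ax x0 x1; have ux := extremal_unit H Ax; have [r2 r3 _ _] := qre_powers ux.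
  have A2 : A (qmul x x) by exact: extremal_mul H _ _ _ _.
  have M z (s : R) : A z -> qre z = s -> s = -1 \/ - s <= phi / 2.
    move=> Az zs; have [e|ne] := pselect (qopp z = qone).
      by left; have := congr1 qre e; rewrite /= zs => <-; rewrite opprK.
    by right; rewrite -hE -zs; apply: extremal_max H _ _ ne; exact: extremal_opp H _ _.
  have [m2|m2] := M _ _ A2 r2; first by apply: Or31; lra.
  have [m3|m3] := M _ _ (extremal_mul H A2 Ax) r3.
    apply: Or33; move: (qre x) x0 m3 {x1 m2 r2 r3} => s s0 m3.
    have : (s + 1) * (2 * s - 1) ^+ 2 = 0.
      have -> : (s + 1) * (2 * s - 1) ^+ 2 = 4 * s ^+ 3 - 3 * s + 1 by ring.
      lra.
    move/eqP; rewrite mulf_eq0 gt_eqF ?ltr_wpDl //= sqrf_eq0 subr_eq0 => /eqP e.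
    have -> : s = 1 / 2 by lra.
    by field.
  move: (qre x) x0 x1 m2 m3 {r2 r3} => s s0 s1 m2 m3.
  apply: Or32; apply/eqP; rewrite eq_le; apply/andP; split; last by lra.
  rewrite leNgt; apply/negP => gt; pose q := (phi - 1) / 2.
  have q2 : q ^+ 2 = (2 - phi) / 4 by rewrite /q; field: g.
  have q0 : 0 < q by rewrite /q; lra.
  have sq : 0 < s - q by rewrite subr_gt0 ltNge; apply/negP => le; nra.
  have small : s < 6/10 by rewrite ltNge; apply/negP => big; nra.
  have neg : 4 * s ^+ 2 + 4 * q * s - (1 + phi) < 0 by rewrite /q; nra.
  have : (s - q) * (4 * s ^+ 2 + 4 * q * s - (1 + phi)) < 0 by rewrite pmulr_rlt0.
  have -> : (s - q) * (4 * s ^+ 2 + 4 * q * s - (1 + phi)) = 4 * s ^+ 3 - 3 * s + phi / 2.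
    by rewrite /q; field: g.
  lra.
have [x0|x0] := leP 0 (qre y); first exact: main.
have := main _ (extremal_opp H Ay); rewrite /= sqrrN oppr_ge0; apply => //.
exact: ltW.
Qed.

(** The coordinates of [h] are real parts of its products with [i], [j], [k];
    the length of the axis then leaves the permutations of [0, 1/2, (phi-1)/2]
    with signs, two classes under the conjugations by the tetrahedral group. *)
Lemma extremal_fifth_turn : qre h = phi / 2 ->
  exists2 x, A x & rho x = fifth3 \/ rho x = swap3 *m fifth3 *m swap3.
Proof.
move=> hE; have g := golden_sqr; have /andP[b1 b2] := golden_bounds.
have uh := extremal_unit H (extremal_mem H); have hA := extremal_mem H.
have V : qi h ^+ 2 + qj h ^+ 2 + qk h ^+ 2 = (3 - phi) / 4.
  have -> : qi h ^+ 2 + qj h ^+ 2 + qk h ^+ 2 = 1 - qre h ^+ 2 by rewrite -uh /qnorm; ring.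
  by rewrite hE; field: g.
have si := sqr_ge0 (qi h); have sj := sqr_ge0 (qj h); have sk := sqr_ge0 (qk h).
have Vi := extremal_golden_re hE (extremal_mul H hA (extremal_i H)).
have Vj := extremal_golden_re hE (extremal_mul H hA (extremal_j H)).
have Vk := extremal_golden_re hE (extremal_mul H hA (extremal_k H)).
have ri : qre (qmul h qi1) = - qi h by rewrite /=; ring.
have rj : qre (qmul h qj1) = - qj h by rewrite /=; ring.
have rk : qre (qmul h qk1) = - qk h by rewrite /=; ring.
rewrite ri sqrrN in Vi; rewrite rj sqrrN in Vj; rewrite rk sqrrN in Vk.
have {}Vi : [\/ qi h ^+ 2 = 0, qi h ^+ 2 = (2 - phi) / 4 | qi h ^+ 2 = 1 / 4].
  by apply: Vi; rewrite -V; lra.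
have {}Vj : [\/ qj h ^+ 2 = 0, qj h ^+ 2 = (2 - phi) / 4 | qj h ^+ 2 = 1 / 4].
  by apply: Vj; rewrite -V; lra.
have {}Vk : [\/ qk h ^+ 2 = 0, qk h ^+ 2 = (2 - phi) / 4 | qk h ^+ 2 = 1 / 4].
  by apply: Vk; rewrite -V; lra.
clear ri rj rk si sj sk.
have root4 (s t : R) : s ^+ 2 = t ^+ 2 -> s = t \/ s = - t.
  by move=> /eqP; rewrite eqf_sqr => /orP[]/eqP; [left|right].
have rb (s : R) : s ^+ 2 = (2 - phi) / 4 -> s = (phi - 1) / 2 \/ s = - ((phi - 1) / 2).
  by move=> e; apply: root4; rewrite e; field: g.
have rc (s : R) : s ^+ 2 = 1 / 4 -> s = 1 / 2 \/ s = - (1 / 2).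
  by move=> e; apply: root4; rewrite e; field.
have r0 (s : R) : s ^+ 2 = 0 -> s = 0 by move=> /eqP; rewrite sqrf_eq0 => /eqP.
have even b c d : A (Quat (phi / 2) b c d) -> b ^+ 2 = (2 - phi) / 4 -> c ^+ 2 = 0 ->
    d ^+ 2 = 1 / 4 -> exists2 x, A x & rho x = fifth3 \/ rho x = swap3 *m fifth3 *m swap3.
  move=> Ax /rb hb /r0 c0 /rc hd; have [Ai Aj Ak] := extremal_signs H Ax; rewrite /= in Ai Aj Ak.
  have fin : rho (Quat (phi / 2) (- ((phi - 1) / 2)) 0 (- (1 / 2))) = fifth3.
    by rewrite /rho /fifth3; congr mx3; field: g.
  exists (Quat (phi / 2) (- ((phi - 1) / 2)) 0 (- (1 / 2))); last by left.
  by case: hb hd Ax Ai Aj Ak => -> [] ->; rewrite c0 ?opprK ?oppr0.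
have odd b c d : A (Quat (phi / 2) b c d) -> b ^+ 2 = 0 -> c ^+ 2 = (2 - phi) / 4 ->
    d ^+ 2 = 1 / 4 -> exists2 x, A x & rho x = fifth3 \/ rho x = swap3 *m fifth3 *m swap3.
  move=> Ax /r0 b0 /rb hc /rc hd; have [Ai Aj Ak] := extremal_signs H Ax; rewrite /= in Ai Aj Ak.
  have fin : rho (Quat (phi / 2) 0 ((phi - 1) / 2) (1 / 2)) = swap3 *m fifth3 *m swap3.
    by rewrite /rho /fifth3 /swap3 !mx3_mul; congr mx3; field: g.
  exists (Quat (phi / 2) 0 ((phi - 1) / 2) (1 / 2)); last by right.
  by case: hc hd Ax Ai Aj Ak => -> [] ->; rewrite b0 ?opprK ?oppr0.
have [b [c [d Eh]]] : exists b c d, h = Quat (phi / 2) b c d.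
  by exists (qi h), (qj h), (qk h); rewrite -hE; exact: quat_eta.
have Ab : A (Quat (phi / 2) b c d) by rewrite -Eh.
have Ac := extremal_cyc H Ab; have Ad := extremal_cyc H Ac; rewrite /= in Ac Ad.
move: V Vi Vj Vk; rewrite Eh /= => V.
case=> eb; case=> ec; case=> ed; try (by exfalso; rewrite eb ec ed in V; lra).
- exact: (odd b c d).
- exact: (even d b c).
- exact: (even b c d).
- exact: (odd d b c).
- exact: (odd c d b).
- exact: (even c d b).
Qed.

End ExtremalElement.

(** * Rotation groups containing the tetrahedral group *)

Section LargerStabilizer.
Implicit Types (v : 'rV[R]_3) (r s : 'M[R]_3) (x y u h : quat).
Implicit Types (alpha V : set 'rV[R]_3).

Definition tetra_quat : set quat := [set x | qunit x /\ rotation_group T0 (rho x)].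

Lemma tetra_quatM x y : tetra_quat x -> tetra_quat y -> tetra_quat (qmul x y).
Proof.
move=> [ux rx] [uy ry]; split; first exact: qunitM.
by rewrite rhoM; exact: rotation_groupM.
Qed.

Lemma tetra_quatV x : tetra_quat x -> tetra_quat (qconj x).
Proof.
move=> [ux rx]; split; first exact: qunit_conj.
by rewrite rho_conj; exact: rotation_groupT.
Qed.

Lemma tetra_quat_ijk : [/\ tetra_quat qi1, tetra_quat qj1 & tetra_quat qk1].
Proof. by have [ui uj uk] := qunit_ijk; have [ri rj rk] := rho_ijk. Qed.

Lemma tetra_quat_hurwitz e f g : e ^+ 2 = 1 -> f ^+ 2 = 1 -> g ^+ 2 = 1 ->
  tetra_quat (hurwitz e f g).
Proof.
have w : tetra_quat (hurwitz 1 1 1).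
  split; first by rewrite /qunit /qnorm /=; field.
  have [cT _ _] := cyc3_group.
  have -> : rho (hurwitz 1 1 1) = cyc3 *m cyc3 :> 'M[R]_3.
    by rewrite /rho /hurwitz mx3_mul; congr mx3; field.
  exact: rotation_groupM.
have [hi hj hk] := tetra_quat_ijk.
have cj u x : tetra_quat u -> tetra_quat x -> tetra_quat (qconjg u x).
  by move=> tu tx; apply: tetra_quatM; [exact: tetra_quatM|exact: tetra_quatV].
have wi := cj _ _ hi w; have wj := cj _ _ hj w; have wk := cj _ _ hk w.
have V := tetra_quatV w; have Vi := tetra_quatV wi; have Vj := tetra_quatV wj.
have Vk := tetra_quatV wk.
rewrite qconjg_i /qconj /= in wi Vi; rewrite qconjg_j /qconj /= in wj Vj.
rewrite qconjg_k /qconj /= in wk Vk; rewrite /qconj /= in V.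
move=> /sqr_eq1 he /sqr_eq1 hf /sqr_eq1 hg.
have E (e' f' g' b c d : R) : b = e' / 2 -> c = f' / 2 -> d = g' / 2 ->
    tetra_quat (Quat (1/2) b c d) -> tetra_quat (hurwitz e' f' g').
  by move=> -> -> ->.
case: he hf hg => -> [] -> [] ->.
- exact: w.
- by apply: E Vk; ring.
- by apply: E Vj; ring.
- by apply: E wi; ring.
- by apply: E Vi; ring.
- by apply: E wj; ring.
- by apply: E wk; ring.
- by apply: E V; ring.
Qed.

(** Multiplication by one of the 24 Hurwitz units brings any unit quaternion
    within 45 degrees of [1] or [-1]: if the largest coordinate [M] and the sum
    [L] of the absolute values satisfied [2 M^2 < 1] and [L^2 < 2], then
    [|x|^2 <= M L < 1]. *)
Lemma tetra_quat_reduce x : qunit x ->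
  exists2 u, tetra_quat u & 1 / 2 <= qre (qmul x u) ^+ 2.
Proof.
case: x => a b c d; rewrite /qunit /qnorm /= => n1.
apply: contrapT => none.
have [hi hj hk] := tetra_quat_ijk.
have small u : tetra_quat u -> qre (qmul (Quat a b c d) u) ^+ 2 < 1 / 2.
  by move=> tu; rewrite ltNge; apply/negP => big; apply: none; exists u.
have h1 : tetra_quat qone.
  split; first by rewrite /qunit /qnorm /=; ring.
  have -> : rho qone = 1%:M :> 'M[R]_3 by rewrite mx3_1 /rho; congr mx3; ring.
  exact: rotation_group1.
have sa : a ^+ 2 < 1 / 2 by have := small _ h1; rewrite /= !mulr0 mulr1 !subr0.
have sb : b ^+ 2 < 1 / 2.
  by have := small _ hi; rewrite /= !mulr0 mulr1 !subr0 sub0r sqrrN.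
have s3 : c ^+ 2 < 1 / 2.
  by have := small _ hj; rewrite /= !mulr0 mulr1 !subr0 sub0r sqrrN.
have sd : d ^+ 2 < 1 / 2.
  by have := small _ hk; rewrite /= !mulr0 mulr1 !subr0 sub0r sqrrN.
have sgn (t : R) : exists2 s : R, s ^+ 2 = 1 & t = s * `|t|.
  have [t0|t0] := leP 0 t; first by exists 1; rewrite ?expr1n // mul1r ger0_norm.
  by exists (-1); rewrite ?sqrrN ?expr1n // ltr0_norm // mulrNN mul1r.
have [ea ea2 aE] := sgn a; have [eb eb2 bE] := sgn b.
have [ec ec2 cE] := sgn c; have [ed ed2 dE] := sgn d.
have u1 (s t : R) : s ^+ 2 = 1 -> t ^+ 2 = 1 -> (- (s * t)) ^+ 2 = 1 :> R.
  by move=> hs ht; rewrite sqrrN exprMn hs ht mulr1.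
have := small _ (tetra_quat_hurwitz (u1 _ _ ea2 eb2) (u1 _ _ ea2 ec2) (u1 _ _ ea2 ed2)).
pose L : R := `|a| + `|b| + `|c| + `|d|.
have -> : qre (qmul (Quat a b c d) (hurwitz (- (ea * eb)) (- (ea * ec)) (- (ea * ed)))) =
    ea * (L / 2).
  rewrite /= {1}aE {1}bE {1}cE {1}dE /L.
  have -> : eb * `|b| * (- (ea * eb) / 2) = - (ea * `|b| * eb ^+ 2 / 2) by field.
  have -> : ec * `|c| * (- (ea * ec) / 2) = - (ea * `|c| * ec ^+ 2 / 2) by field.
  have -> : ed * `|d| * (- (ea * ed) / 2) = - (ea * `|d| * ed ^+ 2 / 2) by field.
  by rewrite eb2 ec2 ed2; field.
rewrite exprMn ea2 => sL0; have sL : (L / 2) ^+ 2 < 1 / 2 by lra.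
pose m : R := Num.sqrt (1 / 2).
have m2 : m ^+ 2 = 1 / 2 by rewrite sqr_sqrtr; lra.
have m0 : 0 <= m by exact: sqrtr_ge0.
have lt (t : R) : 0 <= t -> t ^+ 2 < 1 / 2 -> t < m.
  by move=> t0; rewrite -m2 => e; rewrite ltNge; apply/negP => le; nra.
have L0 : 0 <= L / 2 by apply: divr_ge0; rewrite ?ler0n // /L !addr_ge0 // normr_ge0.
have Lm := lt _ L0 sL.
have nt (t : R) : t ^+ 2 < 1 / 2 -> t ^+ 2 <= m * `|t|.
  move=> st; rewrite -real_normK ?num_real // expr2 ler_wpM2r // ltW //.
  by apply: lt => //; rewrite real_normK ?num_real.
have := nt _ sa; have := nt _ sb; have := nt _ s3; have := nt _ sd.
have : m * (L / 2) < 1 / 2.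
  by rewrite -m2 expr2 ltr_pM2l // lt_neqAle m0 andbT eq_sym -sqrf_eq0 m2 gt_eqF //; lra.
by rewrite /L => *; lra.
Qed.

Lemma le_of_sqr (a b : R) : 0 <= a -> b ^+ 2 <= a ^+ 2 -> b <= a.
Proof. by move=> a0 ab; rewrite leNgt; apply/negP => lt; nra. Qed.

Lemma mulsetX alpha r k : mulset alpha r = alpha -> mulset alpha (r ^+ k) = alpha.
Proof.
move=> e; elim: k => [|k IH]; first by rewrite expr0 mulset1.
by rewrite exprSr -[_ * r]/(_ *m r) -mulsetM IH.
Qed.

Lemma mulset_mem alpha r v : mulset alpha r = alpha -> alpha v -> alpha (v *m r).
Proof. by move=> e av; rewrite -e; exists v. Qed.

Lemma invariant_mulset V alpha r :
  invariant_under V alpha -> rotation_group V r -> mulset alpha r = alpha.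
Proof.
move=> inv rr; apply/seteqP; split=> [_ [v av <-]|v av]; first exact: inv.
exists (v *m r^T); first by apply: inv => //; exact: rotation_groupT.
exact: (orthogonalKV _ rr.1.1).
Qed.

Lemma invariant_cube alpha : invariant_under T0 alpha ->
  mulset alpha quarter3 = alpha -> invariant_under C0 alpha.
Proof.
move=> inv q r v /cube_groupP[rT|[t rt ->]] av; first exact: inv.
by rewrite mulmxA; apply: inv => //; exact: mulset_mem.
Qed.

Lemma invariant_dodecahedron alpha : invariant_under T0 alpha ->
  mulset alpha fifth3 = alpha -> invariant_under D0 alpha.
Proof.
move=> inv q r v /dodecahedron_groupP[k [t [_ rt ->]]] av.
by rewrite mulmxA; apply: inv => //; apply: mulset_mem => //; exact: mulsetX.
Qed.

Lemma swap3_scale V : mulset V swap3 = mulset V (1 *: swap3).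
Proof. by rewrite scale1r. Qed.

Lemma rotation_group_swap V r : rotation_group (mulset V swap3) r <->
  rotation_group V (swap3 *m r *m swap3).
Proof.
rewrite swap3_scale.
have := rotation_group_similar V r (oner_neq0 R) (swap3_orthogonal).
by rewrite swap3_tr.
Qed.

(** The reflection [swap3] transports the case of the other dodecahedron. *)
Lemma invariant_dodecahedron_swap alpha : invariant_under T0 alpha ->
  mulset alpha (swap3 *m fifth3 *m swap3) = alpha ->
  invariant_under (mulset D0 swap3) alpha.
Proof.
move=> inv q r v /rotation_group_swap rr av.
have invs : invariant_under T0 (mulset alpha swap3).
  move=> t _ rt [w aw <-]; exists (w *m (swap3 *m t *m swap3)).
    by apply: inv => //; apply/rotation_group_swap; rewrite swap3_tetrahedron.
  by rewrite !mulmxA -[LHS]mulmxA swap3_sqr mulmx1.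
have qs : mulset (mulset alpha swap3) fifth3 = mulset alpha swap3.
  by rewrite -{2}q !mulsetM -(mulmxA _ swap3 swap3) swap3_sqr mulmx1.
have [|w aw E] := @invariant_dodecahedron _ invs qs _ (v *m swap3) rr; first by exists v.
have -> : v *m r = w; last by [].
have ss (p : 'rV[R]_3) : p *m swap3 *m swap3 = p by rewrite -mulmxA swap3_sqr mulmx1.
by rewrite -[w]ss E !mulmxA !ss.
Qed.

Lemma cross_sphere (p q : 'rV[R]_3) : sphere p -> sphere q -> cross p q = 0 ->
  q = p \/ q = - p.
Proof.
move=> sp sq c0.
have pq : dot p q ^+ 2 = 1.
  have : dot (cross p q) (cross p q) = dot p p * dot q q - dot p q ^+ 2.
    have [x [y [z ->]]] := vec3P p; have [x' [y' [z' ->]]] := vec3P q.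
    by rewrite /cross !vec3E !dotE; ring.
  rewrite c0 dot0l [dot p p]sp [dot q q]sq mulr1 => /eqP.
  by rewrite eq_sym subr_eq0 => /eqP.
move/sqr_eq1: pq => -[e|e]; [left|right]; apply/subr0_eq/dot_eq0.
  rewrite -scaleN1r !dotDl !dotDr !dotZl !dotZr (dotC q p) [dot p p]sp [dot q q]sq e.
  by ring.
rewrite opprK !dotDl !dotDr (dotC q p) [dot p p]sp [dot q q]sq e.
by ring.
Qed.

Lemma invariant_rotation_eq alpha v r s : alpha `<=` sphere -> alpha v ->
  invariant_under T0 alpha -> is_rotation r -> is_rotation s ->
  (forall w, alpha w -> w *m r = w *m s) -> r = s.
Proof.
move=> as_ av inv rr rs E.
have [p1 [p2 [p3 [[a1 a2 a3] [n12 n13 n23]]]]] := tetra_invariant_three_points inv as_ av.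
have fin p q : alpha p -> alpha q -> cross p q != 0 -> r = s.
  move=> ap aq c0; have : r *m s^T = 1%:M.
    apply: rotation_fix2 c0 _ _; first by apply: is_rotationM => //; exact: is_rotationT.
      by rewrite mulmxA E // (orthogonalK _ rs.1).
    by rewrite mulmxA E // (orthogonalK _ rs.1).
  move=> /(congr1 (mulmx^~ s)).
  by rewrite -mulmxA (orthogonal_tr rs.1) mulmx1 mul1mx.
have [c12|] := eqVneq (cross p1 p2) 0; last exact: fin.
have [c13|] := eqVneq (cross p1 p3) 0; last exact: fin.
move: n12 n13 n23; case: (cross_sphere (as_ _ a1) (as_ _ a2) c12) => ->;
  case: (cross_sphere (as_ _ a1) (as_ _ a3) c13) => ->; rewrite ?eqxx //.
Qed.

Lemma qre_sqr_rho x y : qunit x -> qunit y -> rho x = rho y ->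
  qre x ^+ 2 = qre y ^+ 2.
Proof.
case: x => a b c d; case: y => a' b' c' d'; rewrite /qunit /qnorm /= => h h'.
by move=> /mx3_inj[[e1 _ _] [_ e2 _] [_ _ e3]]; lra.
Qed.

(** The quaternions representing rotations that preserve [alpha] form a group
    with finitely many squared real parts. An element of maximal real part
    exists, and with the tetrahedral group it generates one of the three larger
    groups. *)
Lemma larger_stabilizer alpha v x0 : finite_set alpha -> alpha `<=` sphere ->
  alpha v -> invariant_under T0 alpha -> qunit x0 -> mulset alpha (rho x0) = alpha ->
  ~ rotation_group T0 (rho x0) ->
  [\/ invariant_under C0 alpha, invariant_under D0 alpha
    | invariant_under (mulset D0 swap3) alpha].
Proof.
move=> fa as_ av inv ux0 sx0 nx0.
pose A : set quat := [set x | qunit x /\ mulset alpha (rho x) = alpha].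
have UA x : tetra_quat x -> A x.
  by move=> [ux rx]; split=> //; exact: invariant_mulset inv rx.
have AM x y : A x -> A y -> A (qmul x y).
  move=> [ux sx] [uy sy]; split; first exact: qunitM.
  by rewrite rhoM -mulsetM sx.
have AV x : A x -> A (qconj x).
  move=> [ux sx]; split; first exact: qunit_conj.
  by rewrite rho_conj -{1}sx mulsetM (rho_rotation ux).1 mulset1.
have AN x : A x -> A (qopp x).
  move=> [ux sx]; split; first by move: ux; rewrite /qunit /qnorm /= !sqrrN.
  suff -> : rho (qopp x) = rho x by [].
  by case: x {ux sx} => a b c d; rewrite /rho /qopp /=; congr mx3; ring.
pose S : set quat := [set x | A x /\ (x <> qone /\ qopp x <> qone)].
have fin : finite_set ((fun x => qre x ^+ 2) @` S).
  apply: (finite_stabilizer_values (act := fun x w => w *m rho x) fa).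
    by move=> x w [[_ sx] _] aw; exact: mulset_mem.
  move=> x y [[ux _] _] [[uy _] _] E; apply: qre_sqr_rho => //.
  by apply: (invariant_rotation_eq as_ av inv) => //; exact: rho_rotation.
have [u tu ubig] := tetra_quat_reduce ux0.
have uu := tu.1.
have nU y : tetra_quat y -> qmul x0 u <> y.
  move=> ty e; apply: nx0.
  have : tetra_quat (qmul y (qconj u)) by apply: tetra_quatM => //; exact: tetra_quatV.
  case=> _; rewrite -e !rhoM -mulmxA rho_conj (rho_rotation uu).1 mulmx1 //.
have tu1 : tetra_quat qone.
  by rewrite -(qmulV uu); apply: tetra_quatM => //; exact: tetra_quatV.
have S0 : S (qmul x0 u).
  split; first by apply: AM; [split|exact: UA].
  split; first exact: nU.
  move=> e; apply: (nU (qopp qone)).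
    split; first by rewrite /qunit /qnorm /=; ring.
    have -> : rho (qopp qone) = 1%:M :> 'M[R]_3 by rewrite mx3_1 /rho /qopp; congr mx3; rewrite /=; ring.
    exact: rotation_group1.
  rewrite -e; case: (qmul x0 u) => a b c d; rewrite /qopp /=; congr Quat; ring.
have [|_ [h1 [Ah1 [h1n h1o]] <-] hmax] := finite_set_max fin (a := qre (qmul x0 u) ^+ 2).
  by exists (qmul x0 u).
have qoppK x : qopp (qopp x) = x by case: x => a b c d; rewrite /qopp /= !opprK.
have [h [Ah hn ho h0 hE]] : exists h, [/\ A h, h <> qone, qopp h <> qone, 0 <= qre h
    & qre h ^+ 2 = qre h1 ^+ 2].
  have [h0|h0] := leP 0 (qre h1); first by exists h1.
  by exists (qopp h1); split=> //=; rewrite ?qoppK ?sqrrN ?oppr_ge0 ?ltW //; exact: AN.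
have {}hmax x : S x -> qre x ^+ 2 <= qre h ^+ 2 by move=> Sx; rewrite hE; apply: hmax; exists x.
have [hi hj hk] := tetra_quat_ijk.
have F : extremal A h.
  split=> //; try exact: UA.
  - by move=> x [].
  - by move=> e f g he hf hg; apply/UA/tetra_quat_hurwitz.
  - have /andP[_ le1] := qunit_re_bounds Ah.1; rewrite lt_neqAle le1 andbT.
    by apply/eqP => e; apply: hn; exact: qunit_re1 Ah.1 e.
  move=> x Ax xn; have [xo|xo] := pselect (qopp x = qone).
    have := congr1 qre xo; rewrite /= => e.
    by apply: le_trans h0; rewrite -oppr_ge0 e ler01.
  have := hmax x (conj Ax (conj xn xo)).
  exact: le_of_sqr.
have big : 1 / 2 <= qre h ^+ 2 by apply: le_trans ubig _; exact: hmax.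
case: (extremal_re_values F big) => e.
  have [x [_ sx] xE] := extremal_quarter_turn F e; apply: Or31.
  by apply: invariant_cube; rewrite -?xE.
have [x [_ sx] [xE|xE]] := extremal_fifth_turn F e; rewrite xE in sx.
  by apply: Or32; exact: invariant_dodecahedron.
by apply: Or33; exact: invariant_dodecahedron_swap.
Qed.

End LargerStabilizer.

(** * The tetrahedral group as the alternating group *)

Section AlternatingGroup.
Implicit Types (v : 'rV[R]_3) (r : 'M[R]_3) (s t : 'S_4).

Definition tetra_vertex (i : 'I_4) : 'rV[R]_3 :=
  nth 0 [:: tetra1; tetra2; tetra3; tetra4] i.

Definition tetra_mx : 'M[R]_(4, 3) := \matrix_(i, j) tetra_vertex i 0 j.
Local Notation U := tetra_mx.

(** As [U^T U = 4], this is the linear map permuting the rows of [U]. *)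
Definition perm_rot s : 'M[R]_3 := 4^-1 *: (U^T *m perm_mx s^-1 *m U).

Lemma tetra_vertexP v : T0 v <-> exists i, v = tetra_vertex i.
Proof.
split=> [[[[->|->]|->]|->]|[[[|[|[|[|i]]]] // hi] ->]].
- by exists (Ordinal (isT : 0 < 4)%N).
- by exists (Ordinal (isT : 1 < 4)%N).
- by exists (Ordinal (isT : 2 < 4)%N).
- by exists (Ordinal (isT : 3 < 4)%N).
all: by have [] := tetra_in.
Qed.

Lemma tetra_vertex_inj : injective tetra_vertex.
Proof.
have n : (1 == -1 :> R) = false by apply/eqP => h; lra.
have n' : (-1 == 1 :> R) = false by apply/eqP => h; lra.
move=> [[|[|[|[|i]]]] // hi] [[|[|[|[|j]]]] // hj] /eqP;
  rewrite /tetra_vertex /= vec3_eqE ?n ?n' /= ?andbF // => _; exact: val_inj.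
Qed.

Lemma sum4 (F : 'I_4 -> R) : \sum_i F i = F 0 + F 1 + F 2%:R + F 3%:R.
Proof.
rewrite !big_ord_recr big_ord0 /= add0r.
by congr (F _ + F _ + F _ + F _); apply: val_inj.
Qed.

Lemma tetra_mx_tight : U^T *m U = 4%:M.
Proof.
apply/matrixP => i j; rewrite !mxE sum4.
by case: (ord3P i) => ->; case: (ord3P j) => ->; rewrite !mxE /=; ring.
Qed.

Lemma tetra_mx_balanced : (const_mx 1 : 'M_(1, 4)) *m U = 0.
Proof.
apply/matrixP => i j; rewrite !mxE sum4.
by case: (ord3P j) => ->; rewrite !mxE /=; ring.
Qed.

Lemma tetra_mx_gram : U *m U^T = 4%:M - const_mx 1.
Proof.
have o4 (k : 'I_4) : [\/ k = 0, k = 1, k = 2%:R | k = 3%:R].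
  by case: k => [[|[|[|[|k]]]] // hk]; [apply: Or41|apply: Or42|apply: Or43|apply: Or44];
    apply: val_inj.
apply/matrixP => i j; rewrite !mxE sum3.
by case: (o4 i) => ->; case: (o4 j) => ->; rewrite !mxE /=; ring.
Qed.

Lemma const_mul_perm s : (const_mx 1 : 'M[R]_(4, 4)) *m perm_mx s = const_mx 1.
Proof.
rewrite -[s]invgK -col_permE; apply/matrixP => i j; by rewrite !mxE.
Qed.

Lemma const_mx4E : (const_mx 1 : 'M[R]_(4, 4)) = (const_mx 1 : 'M_(4, 1)) *m (const_mx 1 : 'M_(1, 4)).
Proof. by apply/matrixP => i j; rewrite !mxE big_ord1 !mxE mulr1. Qed.

Lemma tetra_mx_perm s : U *m perm_rot s = perm_mx s^-1 *m U.
Proof.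
have J0 : (const_mx 1 : 'M_(4, 4)) *m U = 0.
  by rewrite const_mx4E -mulmxA tetra_mx_balanced mulmx0.
rewrite /perm_rot -scalemxAr !mulmxA tetra_mx_gram !mulmxBl const_mul_perm.
rewrite J0 subr0 mul_scalar_mx -!scalemxAl.
by rewrite scalerA mulVf ?scale1r // pnatr_eq0.
Qed.

Lemma tetra_vertex_perm s i : tetra_vertex i *m perm_rot s = tetra_vertex ((s^-1)%g i).
Proof.
have rowU k : tetra_vertex k = row k U by apply/rowP => j; rewrite !mxE.
by rewrite !rowU -row_mul tetra_mx_perm -row_permE; apply/rowP => j; rewrite !mxE.
Qed.

Lemma perm_rot_eq r s : U *m r = U *m perm_rot s -> r = perm_rot s.
Proof.
move=> /(congr1 (mulmx U^T)); rewrite !mulmxA tetra_mx_tight !mul_scalar_mx.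
by apply: scalerI; rewrite pnatr_eq0.
Qed.

Lemma perm_rotM s t : perm_rot (s * t)%g = perm_rot t *m perm_rot s.
Proof.
apply/esym/perm_rot_eq; rewrite mulmxA !tetra_mx_perm -mulmxA tetra_mx_perm.
by rewrite mulmxA -perm_mxM invMg.
Qed.

Lemma perm_rot1 : perm_rot 1%g = 1%:M.
Proof. by apply/esym/perm_rot_eq; rewrite mulmx1 tetra_mx_perm invg1 perm_mx1 mul1mx. Qed.

Lemma perm_rot_tr s : (perm_rot s)^T = perm_rot s^-1%g.
Proof.
rewrite /perm_rot linearZ /= !trmx_mul trmxK tr_perm_mx !mulmxA.
by rewrite invgK.
Qed.

Lemma perm_rot_orthogonal s : orthogonal (perm_rot s).
Proof. by rewrite /orthogonal perm_rot_tr -perm_rotM mulVg perm_rot1. Qed.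

(** Adding to [U / 2] a constant column [1 / 2] gives an orthogonal matrix
    intertwining the permutation matrix with [1 (+) perm_rot s]. *)
Lemma perm_rot_det s : \det (perm_rot s) = (-1) ^+ s.
Proof.
pose e : 'M[R]_(4, 1) := const_mx 1.
pose W : 'M[R]_(4, 1 + 3) := 2^-1 *: row_mx e U.
have WW : W *m W^T = 1%:M.
  rewrite /W linearZ /= -scalemxAl -scalemxAr scalerA tr_row_mx mul_row_col.
  rewrite tetra_mx_gram /e trmx_const -const_mx4E addrC subrK.
  rewrite -[4%:M]scalemx1 scalerA; have -> : 2^-1 * 2^-1 * 4 = 1 :> R by field.
  by rewrite scale1r.
have WP : perm_mx s^-1 *m W = W *m block_mx (1%:M : 'M_1) 0 0 (perm_rot s).
  rewrite /W -scalemxAr -scalemxAl; congr (_ *: _).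
  rewrite mul_mx_row mul_row_block !mulmx0 addr0 add0r mulmx1 tetra_mx_perm.
  congr row_mx; rewrite -row_permE; apply/matrixP => i j; by rewrite !mxE.
have dW : \det W * \det W = 1 by rewrite -{2}det_tr -det_mulmx WW det1.
have dW0 : \det W != 0.
  by apply/eqP => d0; move: dW; rewrite d0 mul0r => /eqP; rewrite eq_sym oner_eq0.
have D : \det (block_mx (1%:M : 'M_1) 0 0 (perm_rot s)) = \det (perm_rot s).
  by rewrite det_ublock det1 mul1r.
have := congr1 determinant WP; rewrite !det_mulmx mulrC => /(mulfI dW0) E.
by rewrite -(etrans E D) det_perm odd_permV.
Qed.

Lemma perm_rot_group s : ~~ odd_perm s -> rotation_group T0 (perm_rot s).
Proof.
move=> es; have [fT _ _] := finite_std.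
split; first by split; [exact: perm_rot_orthogonal|rewrite perm_rot_det (negbTE es)].
apply: mulset_inj_finite => //; first exact: perm_rot_orthogonal.
move=> _ /tetra_vertexP[i ->]; apply/tetra_vertexP.
by exists ((s^-1)%g i); exact: tetra_vertex_perm.
Qed.

Lemma perm_rot_surj r : rotation_group T0 r ->
  exists2 s, ~~ odd_perm s & r = perm_rot s.
Proof.
move=> rr; have ex i : exists j, tetra_vertex i *m r = tetra_vertex j.
  by apply/tetra_vertexP; apply: rotation_group_mem rr _; apply/tetra_vertexP; exists i.
pose p i := projT1 (cid (ex i)).
have pE i : tetra_vertex i *m r = tetra_vertex (p i) by rewrite /p; case: cid.
have pI : injective p.
  move=> i j e; apply/tetra_vertex_inj/(orthogonal_inj rr.1.1).
  by rewrite !pE e.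
have rE : r = perm_rot (perm pI)^-1%g.
  apply: perm_rot_eq; rewrite tetra_mx_perm invgK -row_permE.
  apply/row_matrixP => i; rewrite row_mul.
  have rowU k : row k U = tetra_vertex k by apply/rowP => j; rewrite !mxE.
  by rewrite rowU pE; apply/rowP => j; rewrite !mxE permE.
exists (perm pI)^-1%g => //.
have := rr.1.2; rewrite rE perm_rot_det; case: odd_perm => //=.
by rewrite expr1 => h; exfalso; clear -h; lra.
Qed.

Lemma tetrahedral_group_A4 (c : R) q : c != 0 -> is_rotation q ->
  isomorphic_to_A4 [set on_plane r | r in rotation_group (mulset T0 (c *: q))].
Proof.
move=> c0 [oq dq]; have oqT := orthogonalT oq.
have oc s : orthogonal (q^T *m perm_rot s *m q).
  by apply: orthogonalM => //; apply: orthogonalM => //; exact: perm_rot_orthogonal.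
exists (fun s => on_plane (q^T *m perm_rot s *m q)); split.
- by move=> s t _ _; rewrite perm_rotM -conj_mulmx // on_planeM.
- move=> s t _ _ /(on_plane_inj (oc s) (oc t)) /(congr1 (fun r => q *m r *m q^T)).
  rewrite !conjmxK // => e; apply: invg_inj; apply/permP => i; apply: tetra_vertex_inj.
  by rewrite -!tetra_vertex_perm e.
apply/seteqP; split=> [_ [s sA <-]|_ [r rr <-]].
  exists (q^T *m perm_rot s *m q) => //.
  apply/(rotation_group_similar _ _ c0 oq); rewrite conjmxK //.
  by apply: perm_rot_group; move: sA; rewrite /= Alt_even.
move/(rotation_group_similar _ _ c0 oq)/perm_rot_surj: rr => [s es rE].
exists s; first by rewrite /= Alt_even.
by congr on_plane; rewrite -rE conjmxKV.
Qed.

End AlternatingGroup.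

(** * The stabilizer criterion *)

Section Stabilizer.
Implicit Types (v : 'rV[R]_3) (q r : 'M[R]_3) (x : quat).
Implicit Types (alpha V : set 'rV[R]_3).

Lemma congruent_mulset V q :
  orthogonal q -> congruent (normalized V) (mulset V (sc *: q)).
Proof.
move=> oq; exists q => //; rewrite /normalized /mulset image_comp.
by apply: eq_imagel => v _ /=; rewrite -scalemxAr -scalemxAl.
Qed.

Lemma dodecahedron_over q : orthogonal q ->
  regular_dodecahedron (mulset D0 (sc *: q)) /\
  mulset T0 (sc *: q) `<=` mulset D0 (sc *: q).
Proof.
move=> oq; split; first exact: congruent_mulset.
by move=> _ [v Tv <-]; exists v => //; exact: tetra_sub_dodecahedron.
Qed.

Lemma tetrahedron_swap q : mulset T0 (sc *: (swap3 *m q)) = mulset T0 (sc *: q).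
Proof. by rewrite scalemxAr -mulsetM swap3_tetrahedron. Qed.

(** The reflection [swap3] preserves the tetrahedron and exchanges the two
    dodecahedra over it. *)
Lemma dodecahedron_frame V q : orthogonal q -> regular_dodecahedron V ->
  mulset T0 (sc *: q) `<=` V ->
  exists q', [/\ orthogonal q', V = mulset D0 (sc *: q')
    & mulset T0 (sc *: q) = mulset T0 (sc *: q')].
Proof.
move=> oq rV sub; case: (dodecahedron_position oq rV sub) => ->; first by exists q.
exists (swap3 *m q); split=> //; last by rewrite tetrahedron_swap.
by apply: orthogonalM => //; exact: swap3_orthogonal.
Qed.

Lemma lft_lapp m : ldet m = 1 -> lft (lapp m : ext_plane R -> ext_plane R).
Proof.
move=> dm; exists (la m), (lb m), (lc m), (ld m); split=> //.
by have := oner_neq0 R[i]; rewrite -dm.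
Qed.

Lemma lft_on_plane r : is_rotation r -> lft (on_plane r).
Proof.
move=> /rotation_rho[x ux <-]; rewrite -lapp_lift //; apply: lft_lapp.
exact: ldet_lift.
Qed.

Lemma lft_comp (f g : ext_plane R -> ext_plane R) : lft f -> lft g -> lft (f \o g).
Proof.
move=> /lft_lfm[m [dm ->]] /lft_lfm[n [dn ->]].
rewrite -lappM ?dn ?oner_neq0 //; apply: lft_lapp.
by rewrite ldetM dm dn mulr1.
Qed.

Lemma on_plane_image alpha r : alpha `<=` sphere ->
  on_plane r @` (stereo @` alpha) = stereo @` mulset alpha r.
Proof.
move=> as_; rewrite /mulset !image_comp; apply: eq_imagel => v av /=.
by rewrite on_plane_stereo //; exact: as_.
Qed.

Lemma stereo_image_inj alpha v : alpha `<=` sphere -> sphere v ->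
  (stereo @` alpha) (stereo v) -> alpha v.
Proof.
by move=> as_ sv [w aw e]; rewrite -(stereoK sv) -e stereoK //; exact: as_.
Qed.

Lemma lft_stabilizer_on_plane alpha r : is_rotation r -> alpha `<=` sphere ->
  mulset alpha r = alpha -> lft_stabilizer alpha (on_plane r).
Proof.
by move=> rr as_ e; split; [exact: lft_on_plane|rewrite on_plane_image // e].
Qed.

Lemma lft_stabilizer_mem alpha r v : orthogonal r -> alpha `<=` sphere ->
  lft_stabilizer alpha (on_plane r) -> alpha v -> alpha (v *m r).
Proof.
move=> or as_ [_ e] av; have sv := as_ _ av.
apply: (stereo_image_inj as_); first exact: sphereM.
by rewrite -on_plane_stereo // -e; exists (stereo v) => //; exists v.
Qed.

Lemma invariant_similar V alpha (c : R) q : c != 0 -> orthogonal q ->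
  invariant_under V (mulset alpha q^T) <-> invariant_under (mulset V (c *: q)) alpha.
Proof.
move=> c0 oq; split=> inv r v.
  move=> /(rotation_group_similar _ _ c0 oq) rr av.
  have [|w aw] := inv _ (v *m q^T) rr; first by exists v.
  rewrite !mulmxA (orthogonalKV _ oq) => /(orthogonal_inj (orthogonalT oq)) wE.
  by rewrite -wE.
move=> rr [w aw <-]; exists (w *m (q^T *m r *m q)); last first.
  by rewrite !mulmxA (orthogonalK _ oq).
by apply: inv => //; apply/(rotation_group_similar _ _ c0 oq); rewrite conjmxK.
Qed.

Lemma conj_group V q r : orthogonal q ->
  rotation_group V r <-> rotation_group (mulset V (sc *: q)) (q^T *m r *m q).
Proof. by move=> oq; rewrite (rotation_group_similar _ _ sc_neq0 oq) conjmxK. Qed.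

Lemma fifth3_not_tetrahedral : ~ rotation_group T0 fifth3.
Proof.
move=> /rotation_group_mem/(_ (let: And4 t _ _ _ := tetra_in in t)).
have [-> _ _ _ _] := fifth3_step.
by move=> /std_tetrahedronE[h _ _ _]; clear -h; lra.
Qed.

Lemma quarter3_not_tetrahedral : ~ rotation_group T0 quarter3.
Proof.
move=> /rotation_group_mem/(_ (let: And4 t _ _ _ := tetra_in in t)).
by rewrite quarter3E => /std_tetrahedronE[_ _ _ h]; clear -h; lra.
Qed.

(** A union of orbits is preserved by [g], and distinct rotations induce
    distinct maps of the plane. *)
Lemma not_union_of_orbits alpha V W v0 w m d c q g :
  orthogonal q -> regular_corner W v0 w m d c -> rotation_group W g ->
  alpha `<=` sphere ->
  lft_stabilizer alpha = [set on_plane r | r in rotation_group V] ->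
  ~ rotation_group V g -> ~ union_of_orbits W alpha.
Proof.
move=> oq C rg as_ E ng /(union_of_orbitsP C as_) inv; apply: ng.
have : lft_stabilizer alpha (on_plane g).
  apply: lft_stabilizer_on_plane => //; first exact: rg.1.
  by apply: (invariant_mulset _ rg) => r u rr au; exact: inv.
rewrite E => -[r rr /on_plane_inj e].
by rewrite -(e rr.1.1 rg.1.1).
Qed.

(** By [union_of_orbitsP] each claim is about invariance under one of the
    groups. The empty set is excluded by the third claim, so that [alpha] has a
    point to start from. *)
Lemma lft_stabilizer_tetrahedral q alpha : is_rotation q ->
  finite_set alpha -> alpha `<=` sphere ->
  let VT := mulset T0 (sc *: q) in let VO := mulset C0 (sc *: q) in
  lft_stabilizer alpha = [set on_plane r | r in rotation_group VT] <->
  [/\ union_of_orbits VT alpha,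
      (forall VI, regular_dodecahedron VI /\ VT `<=` VI -> ~ union_of_orbits VI alpha)
    & ~ union_of_orbits VO alpha].
Proof.
move=> [oq dq] fa as_ VT VO.
have s0 := sc_gt0; have sn0 := sc_neq0.
have oqT := orthogonalT oq; have rqT : is_rotation q^T by exact: is_rotationT.
have CT := corner_similar corner_tetrahedron s0 oq.
have CO := corner_similar corner_std_cube s0 oq.
have CD q1 (oq1 : orthogonal q1) :=
  corner_similar corner_std_dodecahedron s0 oq1.
split=> [E|[/(union_of_orbitsP CT as_) inv noI noO]].
  split.
  - apply/(union_of_orbitsP CT as_) => r v rr av.
    by apply: (lft_stabilizer_mem rr.1.1 as_) => //; rewrite E; exists r.
  - move=> VI [rI sub].
    have [q1 [oq1 VIE VTE]] := dodecahedron_frame oq rI sub.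
    have rg := (conj_group D0 fifth3 oq1).1 fifth3_group.
    rewrite VIE; apply: (not_union_of_orbits oq1 (CD _ oq1) rg as_ E).
    by rewrite /VT VTE -conj_group //; exact: fifth3_not_tetrahedral.
  have rg := (conj_group C0 quarter3 oq).1 (quarter3_group).
  apply: (not_union_of_orbits oq CO rg as_ E).
  by rewrite -conj_group //; exact: quarter3_not_tetrahedral.
have [v av] : exists v, alpha v.
  apply: contrapT => none; apply: noO; apply/(union_of_orbitsP CO as_) => r v _ av.
  by case: none; exists v.
have invT : invariant_under VT alpha by move=> r u rr au; exact: inv.
apply/seteqP; split=> [h [lh sh]|_ [r rr <-]]; last first.
  by apply: lft_stabilizer_on_plane => //; [exact: rr.1|exact: invariant_mulset invT rr].
pose alpha0 := mulset alpha q^T.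
have as0 : alpha0 `<=` sphere by move=> _ [u au <-]; apply: sphereM => //; exact: as_.
have K p r : orthogonal p -> orthogonal r ->
    on_plane r \o on_plane p = on_plane (p *m r) by move=> op or; rewrite on_planeM.
pose h0 := on_plane q^T \o h \o on_plane q.
have a0q : mulset alpha0 q = alpha by rewrite mulsetM (orthogonal_tr oq) mulset1.
have st0 : lft_stabilizer alpha0 h0.
  split.
    by apply: lft_comp; [apply: lft_comp|]; rewrite ?lft_on_plane //; exact: lft_on_plane.
  have imc (f g : ext_plane R -> ext_plane R) B : (f \o g) @` B = f @` (g @` B).
    by rewrite image_comp.
  rewrite (imc (on_plane q^T \o h) (on_plane q)) (imc (on_plane q^T) h).
  by rewrite on_plane_image // a0q sh on_plane_image.
have inv0 : invariant_under T0 alpha0 by apply/(invariant_similar _ _ sn0 oq).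
have av0 : alpha0 (v *m q^T) by exists v.
have [x ux [h0E sx]] := lft_stabilizer_rotation (finite_mulset _ fa) as0 av0 inv0 st0.
have hE : h = on_plane (q^T *m rho x *m q).
  have or := (rho_rotation ux).1.
  rewrite -K //; last by exact: orthogonalM.
  rewrite -K // -h0E /h0.
  have eK p : on_plane q (on_plane q^T p) = p.
    by rewrite -[LHS]/((on_plane q \o on_plane q^T) p) K // (orthogonal_tr oq) on_plane1.
  by apply/funext => p; rewrite /= !eK.
rewrite hE; exists (q^T *m rho x *m q) => //; apply: (conj_group T0 (rho x) oq).1.
apply: contrapT => nx.
case: (larger_stabilizer (finite_mulset _ fa) as0 av0 inv0 ux sx nx) => iv.
- apply: noO; apply/(union_of_orbitsP CO as_) => r u rr au.
  by have /(invariant_similar _ _ sn0 oq) := iv; apply.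
- have := dodecahedron_over oq => /noI; apply.
  apply/(union_of_orbitsP (CD _ oq) as_) => r u rr au.
  by have /(invariant_similar _ _ sn0 oq) := iv; apply.
have osq : orthogonal (swap3 *m q) by apply: orthogonalM => //; exact: swap3_orthogonal.
have [rI sI] := dodecahedron_over osq; rewrite tetrahedron_swap in sI.
apply: (noI _ (Logic.conj rI sI)).
apply/(union_of_orbitsP (CD _ osq) as_) => r u.
rewrite scalemxAr -mulsetM => rr au.
by have /(invariant_similar _ _ sn0 oq) := iv; apply.
Qed.

End Stabilizer.

(** * Labelled faces *)

Section LabelledFaces.
Implicit Types (u v w m A X : 'rV[R]_3) (q r : 'M[R]_3).
Implicit Types (V W F : set 'rV[R]_3).

Lemma scale_conj q r v : orthogonal q ->
  v *m (sc *: q) *m (q^T *m r *m q) = v *m r *m (sc *: q).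
Proof. by move=> oq; rewrite -!scalemxAr -!scalemxAl !mulmxA (orthogonalK v oq). Qed.

Lemma mul_conj q r v : orthogonal q -> v *m q *m (q^T *m r *m q) = v *m r *m q.
Proof. by move=> oq; rewrite !mulmxA (orthogonalK v oq). Qed.

Lemma conj_pow q r k : orthogonal q -> (q^T *m r *m q) ^+ k = q^T *m r ^+ k *m q.
Proof.
move=> oq; elim: k => [|k IH]; first by rewrite !expr0 mulmx1 (orthogonal_tr oq).
by rewrite exprSr IH -[_ * _]/(_ *m _) conj_mulmx // -[_ *m r]/(_ * r) -exprSr.
Qed.

Lemma dot_scale q u v : orthogonal q ->
  dot (u *m (sc *: q)) (v *m (sc *: q)) = 3^-1 * dot u v.
Proof.
move=> oq; rewrite -!scalemxAr dotZl dotZr dot_orthogonal // mulrA -expr2.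
by rewrite exprVn sqr_sqrtr.
Qed.

Lemma scale_inj q u v : orthogonal q -> u *m (sc *: q) = v *m (sc *: q) -> u = v.
Proof.
by move=> oq; rewrite -!scalemxAr => /(scalerI sc_neq0)/(orthogonal_inj oq).
Qed.

(** A tetrahedral rotation moves [A] to (1, 1, 1), and the rotations about (1,
    1, 1) permute the faces there; all of them preserve the tetrahedron and
    [W]. *)
Lemma labelled_position W w m d q F A : regular_corner W v111 w m d cyc3 ->
  (forall r, rotation_group T0 r -> rotation_group W r) -> orthogonal q ->
  is_face (mulset W (sc *: q)) F -> F A -> mulset T0 (sc *: q) A ->
  exists q', [/\ orthogonal q', mulset T0 (sc *: q') = mulset T0 (sc *: q),
    mulset W (sc *: q') = mulset W (sc *: q), A = v111 *m (sc *: q')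
    & F = mulset (support_face W m d) (sc *: q')].
Proof.
move=> C sub oq fF FA [a Ta aE].
have [r rr rE] := corner_trans corner_tetrahedron Ta.
pose q1 := r *m q; have oq1 : orthogonal q1 by exact: orthogonalM rr.1.1 oq.
have moved V s p : rotation_group V s -> mulset V (sc *: (s *m p)) = mulset V (sc *: p).
  by move=> [_ Vs]; rewrite scalemxAr -mulsetM /mulset Vs.
have AE : A = v111 *m (sc *: q1) by rewrite -aE rE -!scalemxAr mulmxA.
have C1 := corner_similar C sc_gt0 oq1.
have WE := moved _ _ q (sub _ rr); rewrite -/q1 in WE.
rewrite -WE in fF; rewrite AE in FA.
have [k FE] := face_at_corner C1 fF FA.
have [cT _ _] := cyc3_group.
have ck := rotation_groupX k cT; have ckW := rotation_groupX k (corner_rot C).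
pose q2 := cyc3 ^+ k *m q1; have oq2 : orthogonal q2 by exact: orthogonalM ck.1.1 oq1.
exists q2; split=> //.
- by rewrite (moved _ _ q1 ck) (moved _ _ q rr).
- by rewrite (moved _ _ q1 ckW).
- by rewrite AE /q2 [sc *: (cyc3 ^+ k *m q1)]scalemxAr mulmxA (corner_fixX k C).
rewrite FE (support_face_similar _ _ _ sc_gt0 oq1) mulsetM conj_pow //.
congr mulset; rewrite /q2 -scalemxAl; congr (_ *: _).
by rewrite !mulmxA oq1 mul1mx.
Qed.

Lemma edge_dot W w m d c q u v : regular_corner W v111 w m d c -> orthogonal q ->
  is_edge (mulset W (sc *: q)) (u *m (sc *: q)) (v *m (sc *: q)) ->
  dot u v = dot v111 w.
Proof.
move=> C oq /(is_edgeP (corner_similar C sc_gt0 oq))[r rr [e1 e2]].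
have : dot (u *m (sc *: q)) (v *m (sc *: q)) = 3^-1 * dot v111 w.
  by rewrite e1 e2 dot_orthogonal ?dot_scale //; exact: rr.1.1.
by rewrite dot_scale // => /mulfI; apply; rewrite invr_eq0 pnatr_eq0.
Qed.

Lemma radial_proj_scale q v : orthogonal q ->
  radial_proj (v *m (sc *: q)) = radial_proj v *m q.
Proof. by move=> oq; rewrite radial_proj_similar // sc_gt0. Qed.

Lemma radial_proj_unit v : dot v v = 1 -> radial_proj v = v.
Proof. by move=> e; rewrite /radial_proj e sqrtr1 invr1 scale1r. Qed.

Lemma centroid_scale q F : orthogonal q -> finite_set F ->
  centroid (mulset F (sc *: q)) = centroid F *m (sc *: q).
Proof. by move=> oq fF; apply: centroidM => // u v; exact: scale_inj. Qed.

Lemma tetrahedron_face_points q : orthogonal q ->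
  face_points (mulset T0 (sc *: q)) =
  rot_orbit (mulset T0 (sc *: q)) (vec3 (-1) 1 1 *m (sc *: q)).
Proof.
move=> oq; rewrite (face_pointsE (corner_similar corner_tetrahedron sc_gt0 oq)).
rewrite (support_face_similar _ _ _ sc_gt0 oq) triangle_face.
rewrite (centroid_scale oq (finite_seq _)) radial_proj_scale // centroid_face_triangle.
rewrite radial_projZ ?invr_gt0 ?ltr0n // /radial_proj dotE -scalemxAl -scalemxAr.
by have -> : -1 * -1 + 1 * 1 + 1 * 1 = 3 :> R by ring.
Qed.

Lemma tetrahedron_edge_points q : orthogonal q ->
  edge_points (mulset T0 (sc *: q)) =
  rot_orbit (mulset T0 (sc *: q)) (vec3 0 0 1 *m q).
Proof.
move=> oq; rewrite (edge_pointsE (corner_similar corner_tetrahedron sc_gt0 oq)).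
rewrite midpointM radial_proj_scale // /midpoint vec3D vec3Z radial_proj_unit.
  by congr (rot_orbit _ (_ *m _)); congr vec3; field.
by rewrite dotE; field.
Qed.

Lemma pair_orbit V W g X : (forall r, rotation_group W r <->
    rotation_group V r \/ exists2 t, rotation_group V t & r = g *m t) ->
  rot_orbit W X = rot_orbit V X `|` rot_orbit V (X *m g).
Proof.
move=> E; apply/seteqP; split=> [_ [r /E[rr|[t rt ->]] <-]|_ [[r rr <-]|[r rr <-]]].
- by left; exists r.
- by right; exists t => //; rewrite mulmxA.
- by exists r => //; apply/E; left.
- by exists (g *m r); [apply/E; right; exists r|rewrite mulmxA].
Qed.

Lemma five_orbit V W g X : (forall r, rotation_group W r <->
    exists k t, [/\ (k < 5)%N, rotation_group V t & r = g ^+ k *m t]) ->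
  rot_orbit W X = rot_orbit V X `|` rot_orbit V (X *m g) `|`
    rot_orbit V (X *m g ^+ 2) `|` rot_orbit V (X *m g ^+ 3) `|`
    rot_orbit V (X *m g ^+ 4).
Proof.
move=> E; apply/seteqP; split=> [_ [r /E[k [t [k5 rt ->]]] <-]|].
  rewrite mulmxA; case: k k5 => [|[|[|[|[|k]]]]] // _.
  - by left; left; left; left; exists t => //; rewrite expr0 mulmx1.
  - by left; left; left; right; exists t => //; rewrite expr1.
  - by left; left; right; exists t.
  - by left; right; exists t.
  - by right; exists t.
move=> _ [[[[[r rr <-]|[r rr <-]]|[r rr <-]]|[r rr <-]]|[r rr <-]].
- by exists r => //; apply/E; exists 0%N, r; rewrite expr0 mul1mx.
- by exists (g *m r); rewrite ?mulmxA //; apply/E; exists 1%N, r; rewrite expr1.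
- by exists (g ^+ 2 *m r); rewrite ?mulmxA //; apply/E; exists 2%N, r.
- by exists (g ^+ 3 *m r); rewrite ?mulmxA //; apply/E; exists 3%N, r.
- by exists (g ^+ 4 *m r); rewrite ?mulmxA //; apply/E; exists 4%N, r.
Qed.

Definition swap23 : 'M[R]_3 := mx3 1 0 0 0 0 1 0 1 0.

Lemma swap23E x y z : vec3 x y z *m swap23 = vec3 x z y.
Proof. by rewrite vec3_mul; congr vec3; ring. Qed.

Lemma swap23_orthogonal : orthogonal swap23.
Proof. by rewrite /orthogonal mx3_tr mx3_mul mx3_1; congr mx3; ring. Qed.

Lemma swap23_set : mulset T0 swap23 = T0 /\ mulset C0 swap23 = C0.
Proof.
have [fT fC _] := finite_std.
split; apply: mulset_inj_finite => //; try exact: swap23_orthogonal;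
  move=> v; have [x [y [z ->]]] := vec3P v; rewrite swap23E.
  by move=> /std_tetrahedronE[hx hy hz h]; apply/std_tetrahedronE; split=> //; ring: h.
by move=> /std_cubeE[hx hy hz]; apply/std_cubeE.
Qed.

Lemma labelled_coordinates W w m d q (l s : seq 'rV[R]_3) :
  regular_corner W v111 w m d cyc3 -> orthogonal q ->
  labelled_face (mulset W (sc *: q)) l -> [set` l] = mulset [set` s] (sc *: q) ->
  exists t, [/\ l = map (mulmxr (sc *: q)) t, {subset t <= s}, uniq t
    & path.cycle (fun u v => dot u v == dot v111 w) t].
Proof.
move=> C oq [_ ul el] lE.
have sub X : X \in l -> exists2 x, x \in s & X = x *m (sc *: q).
  move=> Xl; have : [set` l] X by [].
  by rewrite lE => -[x xs <-]; exists x.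
have {lE sub}[t lE ts] : exists2 t, l = map (mulmxr (sc *: q)) t & {subset t <= s}.
  elim: l sub {ul el lE} => [|X l IH] sub; first by exists [::].
  have [|t -> ts] := IH; first by move=> Y Yl; apply: sub; rewrite inE Yl orbT.
  have [x xs ->] := sub X (mem_head _ _); exists (x :: t) => // y.
  by rewrite inE => /orP[/eqP->|/ts].
exists t; split=> //; first by move: ul; rewrite lE => /map_uniq.
move: el; rewrite lE cycle_map; apply: sub_cycle => u v /asboolP/= e.
by apply/eqP; exact: edge_dot C oq e.
Qed.

(** The two orientations of the square differ by [swap23], a reflection that
    preserves the tetrahedron and the cube. *)
Lemma labelled_square q A B C D : orthogonal q ->
  labelled_face (mulset C0 (sc *: q)) [:: A; B; C; D] -> mulset T0 (sc *: q) A ->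
  exists q', [/\ orthogonal q', mulset T0 (sc *: q') = mulset T0 (sc *: q),
    mulset C0 (sc *: q') = mulset C0 (sc *: q)
    & [:: A; B; C; D] = map (mulmxr (sc *: q')) square].
Proof.
move=> oq lF TA; have [fF _ _] := lF; have CC := corner_std_cube.
have [q1 [oq1 T1 C1 AE FE]] := labelled_position CC (fun r rr =>
  (tetrahedron_group_sub rr).1) oq fF (mem_head _ _) TA.
rewrite -C1 in lF; rewrite square_face in FE.
have [t [lE ts ut et]] := labelled_coordinates CC oq1 lF FE.
case: t lE ts ut et => [|a [|b [|c [|e []]]]] // [aE -> -> ->] ts ut et.
have {aE}a1 : a = v111 by apply: (scale_inj oq1); rewrite -AE -aE.
have /and5P[_ bF cF eF _] : all [in square] [:: a; b; c; e] by exact/allP.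
rewrite AE; move: bF cF eF ut et {ts FE}; rewrite a1 /= !inE !negb_or => bF cF eF.
move=> /and4P[/and3P[n1 n2 n3] /andP[n4 n5] n6 _] /and4P[/eqP d1 /eqP d2 /eqP d3 _].
have fin : [\/ [/\ b = vec3 1 1 (-1), c = vec3 1 (-1) (-1) & e = vec3 1 (-1) 1]
    | [/\ b = vec3 1 (-1) 1, c = vec3 1 (-1) (-1) & e = vec3 1 1 (-1)]].
  move: bF cF eF d1 d2 d3 n1 n2 n3 n4 n5 n6.
  move=> /or4P[]/eqP-> /or4P[]/eqP-> /or4P[]/eqP->; rewrite ?dotE ?eqxx //= => d1 d2 d3 *;
    solve [by left | by right | by exfalso; clear -d1 d2 d3; lra].
case: fin => -[-> -> ->]; first by exists q1.
have os := swap23_orthogonal; have [sT sC] := swap23_set.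
exists (swap23 *m q1); split; first exact: orthogonalM.
- by rewrite scalemxAr -mulsetM sT.
- by rewrite scalemxAr -mulsetM sC.
by rewrite /= !scalemxAr !mulmxA !swap23E.
Qed.

Ltac pentagon_cases := rewrite !inE => /or4P[/eqP|/eqP|/eqP|/orP[]/eqP].

(** No reflection is available to reverse the orientation of the pentagon: it
    is the hypothesis on the middle of [BC] that rules out the reversed
    labelling. *)
Lemma labelled_pentagon q A B C D E : orthogonal q ->
  labelled_face (mulset D0 (sc *: q)) [:: A; B; C; D; E] -> mulset T0 (sc *: q) A ->
  edge_points (mulset T0 (sc *: q)) (radial_proj (midpoint B C)) ->
  exists q', [/\ orthogonal q', mulset T0 (sc *: q') = mulset T0 (sc *: q),
    mulset D0 (sc *: q') = mulset D0 (sc *: q)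
    & [:: A; B; C; D; E] = map (mulmxr (sc *: q')) pentagon].
Proof.
move=> oq lF TA mid; have [fF _ _] := lF; have CC := corner_std_dodecahedron.
have [q1 [oq1 T1 C1 AE FE]] := labelled_position CC (fun r rr =>
  (tetrahedron_group_sub rr).2) oq fF (mem_head _ _) TA.
rewrite -C1 in lF; rewrite pentagon_face in FE.
have [t [lE ts ut et]] := labelled_coordinates CC oq1 lF FE.
case: t lE ts ut et => [|a [|b [|c [|d [|e []]]]]] // [aE bE cE -> ->] ts ut et.
have /and5P[_ bF cF dF /andP[eF _]] : all [in pentagon] [:: a; b; c; d; e] by exact/allP.
have {aE}a1 : a = v111 by apply: (scale_inj oq1); rewrite -AE -aE.
exists q1; split=> //; rewrite AE bE cE.
move: ut et {ts FE}; rewrite a1 /= !inE !negb_or.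
move=> /and5P[/and4P[n1 n2 n3 n4] /and3P[n5 n6 n7] /andP[n8 n9] n10 _].
move=> /and5P[/eqP d1 /eqP d2 /eqP d3 /eqP d4 _].
have g := golden_sqr; have /andP[b1 b2] := golden_bounds.
(* A point of the edge orbit has products of the same absolute value with all
   vertices of the tetrahedron. *)
have nmid : ~ (b = vec3 phi 0 (phi - 1) /\ c = vec3 1 (-1) 1).
  move=> [b0 c0]; move: mid; rewrite -T1 (tetrahedron_edge_points oq1) bE cE b0 c0.
  rewrite midpointM radial_proj_scale // => -[r rr xE].
  have sq v : T0 v -> dot (radial_proj (midpoint (vec3 phi 0 (phi - 1)) (vec3 1 (-1) 1))) v ^+ 2 = 1.
    move=> Tv; rewrite -(dot_orthogonal _ _ oq1) -xE dot_mulmx_tr.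
    have := rotation_group_mem (rotation_groupT rr) (_ : mulset T0 (sc *: q1) (v *m (sc *: q1))).
    case=> [|u Tu]; first by exists v.
    rewrite -!scalemxAr -scalemxAl => /(scalerI sc_neq0) <-.
    rewrite dot_orthogonal //; move: Tu; have [x [y [z ->]]] := vec3P u.
    by move=> /std_tetrahedronE[_ _ hz _]; rewrite dotE !mul0r !add0r mul1r.
  have [t1 t2 _ _] := tetra_in.
  have := sq _ t1; have := sq _ t2; rewrite /radial_proj !dotZl /midpoint vec3D vec3Z !dotE.
  set k := (X in X * _) => h1 h2.
  have k1 : k ^+ 2 = 1 by rewrite -[RHS]h1; field.
  have h3 : phi ^+ 2 = 1 by rewrite -[RHS]h2 [RHS]exprMn k1; field.
  by rewrite g in h3; clear -b1 h3; lra.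
clear mid.
have bad x y z x' y' z' : dot (vec3 x y z) (vec3 x' y' z') = dot v111 (vec3 phi 0 (phi - 1)) ->
    x * x' + y * y' + z * z' = 2 * phi - 1.
  by rewrite !dotE => ->; ring.
clear bE cE AE fF lF.
move: bF; pentagon_cases => xE; subst b.
all: try (by exfalso; move: n1; rewrite eqxx).
all: try (by exfalso; move: d1 => /bad d1; clear -d1 b1 b2 g; lra).
- move: cF; pentagon_cases => xE; subst c.
  all: try (by exfalso; move: n2 n5; rewrite ?eqxx).
  all: try (by exfalso; move: d2 => /bad d2; clear -d2 b1 b2 g; lra).
  move: dF; pentagon_cases => xE; subst d.
  all: try (by exfalso; move: n3 n6 n8; rewrite ?eqxx).
  all: try (by exfalso; move: d3 => /bad d3; clear -d3 b1 b2 g; lra).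
  move: eF; pentagon_cases => xE; subst e.
  all: try (by exfalso; move: n4 n7 n9 n10; rewrite ?eqxx).
  all: try (by exfalso; move: d4 => /bad d4; clear -d4 b1 b2 g; lra).
  by [].
move: cF; pentagon_cases => xE; subst c.
all: try (by exfalso; move: n2 n5; rewrite ?eqxx).
all: try (by exfalso; move: d2 => /bad d2; clear -d2 b1 b2 g; lra).
by case: nmid.
Qed.

End LabelledFaces.

(** * Orbits as unions of tetrahedral orbits *)

Section Decompositions.
Implicit Types (x y z : R) (u v w m p X : 'rV[R]_3) (q r t : 'M[R]_3).
Implicit Types (V W F : set 'rV[R]_3).

Definition half3 : 'M[R]_3 := diag3 (-1) (-1) 1.

Lemma half3E x y z : vec3 x y z *m half3 = vec3 (- x) (- y) z.
Proof. by rewrite diag3E; congr vec3; ring. Qed.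

Lemma cyc3_tetra : rotation_group T0 cyc3.
Proof. by have [] := cyc3_group. Qed.

Lemma half3_tetra : rotation_group T0 half3.
Proof. by have [] := @diag3_group (-1) (-1) 1 ltac:(ring) ltac:(ring) ltac:(ring) ltac:(ring). Qed.

Lemma orbit_tetra q t p : orthogonal q -> rotation_group T0 t ->
  rot_orbit (mulset T0 (sc *: q)) (p *m t *m q) = rot_orbit (mulset T0 (sc *: q)) (p *m q).
Proof.
by move=> oq rt; rewrite -mul_conj // rot_orbitM //; exact: (conj_group _ _ oq).1.
Qed.

Lemma orbit_tetra_scale q t p : orthogonal q -> rotation_group T0 t ->
  rot_orbit (mulset T0 (sc *: q)) (p *m t *m (sc *: q)) =
  rot_orbit (mulset T0 (sc *: q)) (p *m (sc *: q)).
Proof.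
by move=> oq rt; rewrite -scale_conj // rot_orbitM //; exact: (conj_group _ _ oq).1.
Qed.

Lemma orbit_tetra_midpoint q t u v : orthogonal q -> rotation_group T0 t ->
  rot_orbit (mulset T0 (sc *: q))
    (radial_proj (midpoint (u *m t *m (sc *: q)) (v *m t *m (sc *: q)))) =
  rot_orbit (mulset T0 (sc *: q)) (radial_proj (midpoint (u *m (sc *: q)) (v *m (sc *: q)))).
Proof.
move=> oq rt; rewrite !midpointM !radial_proj_scale // radial_proj_orthogonal.
  exact: orbit_tetra.
exact: rt.1.1.
Qed.

Lemma conj_group_exists q r : orthogonal q -> exists r0, r = q^T *m r0 *m q.
Proof. by move=> oq; exists (q *m r *m q^T); rewrite conjmxKV. Qed.

Lemma cube_group_conj q r : orthogonal q ->
  rotation_group (mulset C0 (sc *: q)) r <->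
  rotation_group (mulset T0 (sc *: q)) r \/
  exists2 t, rotation_group (mulset T0 (sc *: q)) t & r = q^T *m quarter3 *m q *m t.
Proof.
move=> oq; have [r0 ->] := conj_group_exists r oq; rewrite -!conj_group // cube_groupP.
split=> -[rT|[t rt E]]; [by left| |by left|]; right.
  exists (q^T *m t *m q); last by rewrite E conj_mulmx.
  by rewrite -conj_group.
have [t0 tE] := conj_group_exists t oq; rewrite tE -conj_group // in rt.
exists t0 => //; rewrite tE conj_mulmx // in E.
by have := congr1 (fun s => q *m s *m q^T) E; rewrite !conjmxK.
Qed.

Lemma dodecahedron_group_conj q r : orthogonal q ->
  rotation_group (mulset D0 (sc *: q)) r <->
  exists k t, [/\ (k < 5)%N, rotation_group (mulset T0 (sc *: q)) t
    & r = (q^T *m fifth3 *m q) ^+ k *m t].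
Proof.
move=> oq; have [r0 ->] := conj_group_exists r oq; rewrite -conj_group // dodecahedron_groupP.
split=> -[k [t [k5 rt E]]]; exists k.
  exists (q^T *m t *m q); split=> //; first by rewrite -conj_group.
  by rewrite conj_pow // E conj_mulmx.
have [t0 tE] := conj_group_exists t oq; rewrite tE -conj_group // in rt.
exists t0; split=> //; rewrite tE conj_pow // conj_mulmx // in E.
by have := congr1 (fun s => q *m s *m q^T) E; rewrite !conjmxK.
Qed.

Lemma mulset_scale_inj q V W : orthogonal q ->
  mulset V (sc *: q) = mulset W (sc *: q) -> V = W.
Proof.
move=> oq e; apply/seteqP; split=> v Vv.
  have : mulset V (sc *: q) (v *m (sc *: q)) by exists v.
  by rewrite e => -[w Ww /(scale_inj oq) <-].
have : mulset W (sc *: q) (v *m (sc *: q)) by exists v.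
by rewrite -e => -[w Ww /(scale_inj oq) <-].
Qed.

Lemma face_rotation_std (s : seq 'rV[R]_3) (k : R) m v v' r0 q g : orthogonal q ->
  centroid [set` s] = k *: m -> k != 0 -> cross v m != 0 ->
  is_rotation r0 -> mulset [set` s] r0 = [set` s] ->
  v *m r0 = v' ->
  face_rotation (map (mulmxr (sc *: q)) s) (v *m (sc *: q)) (v' *m (sc *: q)) g ->
  g = q^T *m r0 *m q.
Proof.
move=> oq cE k0 vm rr0 sr0 <- [rg sg vg].
have oqT := orthogonalT oq.
have rg' : is_rotation (q *m g *m q^T) by have := is_rotation_conj oqT rg; rewrite trmxK.
have [g0 gE] := conj_group_exists g oq.
rewrite gE conjmxK // in rg'; rewrite gE; congr (_ *m _ *m _).
apply: (face_rotation_eq cE k0 vm rg' _ rr0 sr0).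
  have sg' : mulset (mulset [set` s] (sc *: q)) g = mulset [set` s] (sc *: q).
    by rewrite mulset_seq; exact: sg.
  apply: (mulset_scale_inj oq); rewrite -[RHS]sg' gE !mulsetM; congr mulset.
  by rewrite -scalemxAl -scalemxAr !mulmxA oq mul1mx.
by move: vg; rewrite gE scale_conj // => /(scale_inj oq).
Qed.

(** Each orbit consists of the tetrahedral orbits of [X] and [X *m gO]; for the
    special points these are compared by means of a half turn and a turn of
    order three of the tetrahedron. *)
Lemma cube_decomposition q A B C D gO : orthogonal q ->
  let VT := mulset T0 (sc *: q) in let VO := mulset C0 (sc *: q) in
  labelled_face VO [:: A; B; C; D] -> VT A -> face_rotation [:: A; B; C; D] A B gO ->
  [/\ VO = VT `|` face_points VT,
      face_points VO = edge_points VT,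
      edge_points VO = rot_orbit VT (radial_proj (midpoint A B))
    & forall X, generic_point VO X ->
        rot_orbit VO X = rot_orbit VT X `|` rot_orbit VT (X *m gO)].
Proof.
move=> oq0 VT VO lF TA fr.
have [q' [oq TE CE sE]] := labelled_square oq0 lF TA.
rewrite /VT /VO -TE -CE {VT VO TE CE TA lF oq0 q}.
move: sE fr => /= [-> -> -> ->]; move: q' oq => q oq fr.
set VT := mulset T0 _; set VO := mulset C0 _.
have C1 := corner_similar corner_std_cube sc_gt0 oq.
have CT := corner_similar corner_tetrahedron sc_gt0 oq.
have [_ cx _] := cross_v111.
have sF : mulset [set` square] quarter3 = [set` square] :> set 'rV[R]_3.
  rewrite -square_face (mulset_support _ _ quarter3_group).
  by congr support_face; rewrite quarter3E; congr vec3; ring.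
have cE : centroid [set` square] = 1 *: vec3 1 0 0 :> 'rV[R]_3.
  by rewrite scale1r centroid_face_square.
have e1 : vec3 1 1 1 *m quarter3 = vec3 1 1 (-1) :> 'rV[R]_3 by exact: quarter3E.
have gE := face_rotation_std oq cE (oner_neq0 R) cx quarter3_rotation sF e1 fr.
rewrite gE {fr gE gO}; set g := q^T *m quarter3 *m q.
have orb X : rot_orbit VO X = rot_orbit VT X `|` rot_orbit VT (X *m g).
  by apply: pair_orbit => r; exact: cube_group_conj.
split=> //.
- rewrite [LHS](verticesE C1) orb -(verticesE CT) tetrahedron_face_points //.
  congr (_ `|` _).
  by rewrite /g scale_conj // quarter3E -(cyc3E 1 1 (-1)) (orbit_tetra_scale _ oq cyc3_tetra).
- rewrite (face_pointsE C1) (support_face_similar _ _ _ sc_gt0 oq) square_face.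
  rewrite (centroid_scale oq (finite_seq _)) radial_proj_scale // centroid_face_square.
  rewrite radial_proj_unit ?dotE; last by ring.
  rewrite orb /g mul_conj // quarter3E oppr0 setUid tetrahedron_edge_points //.
  by rewrite -(cyc3E 0 1 0) -(cyc3E 1 0 0) !(orbit_tetra _ oq cyc3_tetra).
rewrite (edge_pointsE C1) orb -[RHS]setUid; congr (_ `|` _).
rewrite midpointM radial_proj_scale // /g mul_conj // -radial_proj_orthogonal; last first.
  exact: quarter3_rotation.1.
rewrite -midpointM !quarter3E -!radial_proj_scale // -!midpointM.
(* half3, cyc3, half3 carry the middle of the edge from (1,1,-1) to (1,-1,-1)
   to that of the edge from (1,1,-1) to (1,1,1). *)
rewrite -(orbit_tetra_midpoint _ _ oq half3_tetra) -(orbit_tetra_midpoint _ _ oq cyc3_tetra).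
rewrite -(orbit_tetra_midpoint _ _ oq half3_tetra) !half3E !cyc3E !half3E !opprK.
by rewrite midpointC.
Qed.

(** Each orbit consists of the tetrahedral orbits of the five images of a point
    under the powers of [gI]. For a vertex or the middle of an edge these run
    around the pentagon, and a half turn and a turn of order three of the
    tetrahedron identify some of them. *)
Lemma dodecahedron_decomposition q A B C D E gI : orthogonal q ->
  let VT := mulset T0 (sc *: q) in let VI := mulset D0 (sc *: q) in
  labelled_face VI [:: A; B; C; D; E] -> VT A ->
  edge_points VT (radial_proj (midpoint B C)) ->
  face_rotation [:: A; B; C; D; E] A B gI ->
  let N := radial_proj (centroid [set` [:: A; B; C; D; E]]) in
  let Q := radial_proj (midpoint A B) in
  let R' := radial_proj (midpoint D E) in
  let BT := rot_orbit VT in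
  [/\ VI = VT `|` face_points VT `|` BT B,
      face_points VI = BT N,
      edge_points VI = edge_points VT `|` BT Q `|` BT R'
    & forall X, generic_point VI X ->
        rot_orbit VI X =
          BT X `|` BT (X *m gI) `|` BT (X *m gI ^+ 2) `|`
          BT (X *m gI ^+ 3) `|` BT (X *m gI ^+ 4)].
Proof.
move=> oq0 VT VI lF TA mid fr.
have [q' [oq TE CE sE]] := labelled_pentagon oq0 lF TA mid.
rewrite /VT /VI -TE -CE; rewrite /VT -TE in mid; rewrite {VT VI TE CE TA lF oq0 q} in mid *.
have setE : [set` [:: A; B; C; D; E]] = mulset [set` pentagon] (sc *: q').
  by rewrite sE mulset_seq.
rewrite setE {setE}; move: sE mid fr => /= [-> -> -> -> ->]; move: q' oq => q oq mid fr.
set VT := mulset T0 _ in mid *; set VI := mulset D0 _; set N := radial_proj _.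
have C1 := corner_similar corner_std_dodecahedron sc_gt0 oq.
have CT := corner_similar corner_tetrahedron sc_gt0 oq.
have [_ _ cx] := cross_v111.
have [f1 f2 f3 f4 f5] := fifth3_step.
have /andP[b1 b2] := golden_bounds.
have sF : mulset [set` pentagon] fifth3 = [set` pentagon] :> set 'rV[R]_3.
  by have [] := pentagon_fifth3 1; rewrite expr1.
have k0 : (phi + 2) / 5 != 0 by rewrite gt_eqF //; lra.
have gE := face_rotation_std oq (centroid_face_pentagon) k0 cx fifth3_rotation sF f1 fr.
rewrite gE {fr gE gI}; set g := q^T *m fifth3 *m q.
have orb X : rot_orbit VI X = rot_orbit VT X `|` rot_orbit VT (X *m g) `|`
    rot_orbit VT (X *m g ^+ 2) `|` rot_orbit VT (X *m g ^+ 3) `|` rot_orbit VT (X *m g ^+ 4).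
  by apply: five_orbit => r; exact: dodecahedron_group_conj.
have gS X k : X *m g ^+ k.+1 = X *m g *m g ^+ k.
  by rewrite exprS -[g * _]/(g *m _) mulmxA.
have gs v : v *m (sc *: q) *m g = v *m fifth3 *m (sc *: q) by rewrite /g scale_conj.
have gm u v : radial_proj (midpoint u v) *m g = radial_proj (midpoint (u *m g) (v *m g)).
  rewrite midpointM radial_proj_orthogonal //.
  by have [] := is_rotation_conj oq (fifth3_rotation).
split=> //.
- rewrite [LHS](verticesE C1) orb -(verticesE CT) tetrahedron_face_points //.
  rewrite !gS expr0 !mulmx1 !gs f1 f2 f3 f4.
  have -> : vec3 0 (- (phi - 1)) phi = vec3 0 (phi - 1) phi *m half3.
    by rewrite half3E oppr0.
  rewrite -(cyc3E 0 (phi - 1) phi) -(cyc3E (-1) 1 1) (orbit_tetra_scale _ oq half3_tetra).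
  rewrite !(orbit_tetra_scale _ oq cyc3_tetra).
  set S1 := rot_orbit _ _; set S2 := rot_orbit _ _.
  by apply/seteqP; split=> x; rewrite /setU /=; tauto.
- have NE : face_points VI = rot_orbit VI N.
    rewrite (face_pointsE C1) (support_face_similar _ _ _ sc_gt0 oq).
    by rewrite pentagon_face.
  have Ng : N *m g = N.
    rewrite /N (centroid_scale oq (finite_seq _)) centroid_face_pentagon.
    have kpos : 0 < (phi + 2) / 5 by lra.
    rewrite radial_proj_scale // (radial_projZ _ kpos) mul_conj //.
    by rewrite -(radial_proj_orthogonal _ (fifth3_rotation).1) fifth3_normal.
  by rewrite NE orb !gS expr0 !mulmx1 !Ng !setUid.
have EA := edge_pointsE C1.
rewrite EA midpointC; set P := radial_proj _.
have PQ : P *m g = radial_proj (midpoint (vec3 1 1 1 *m (sc *: q)) (vec3 0 (phi - 1) phi *m (sc *: q))).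
  by rewrite /P gm !gs f5 f1.
have rg : rotation_group VI g by apply: (conj_group _ _ oq).1; exact: fifth3_group.
rewrite -(rot_orbitM P rg) PQ orb !gS expr0 !mulmx1.
rewrite !gm !gs f1 f2 f3 f4 f5.
have -> : rot_orbit VT (radial_proj (midpoint (vec3 0 (phi - 1) phi *m (sc *: q))
    (vec3 0 (- (phi - 1)) phi *m (sc *: q)))) = edge_points VT.
  rewrite (edge_pointsE CT); apply/esym/rot_orbit_mem.
  by rewrite -(edge_pointsE CT).
have -> : rot_orbit VT (radial_proj (midpoint (vec3 phi 0 (phi - 1) *m (sc *: q))
    (vec3 1 1 1 *m (sc *: q)))) = rot_orbit VT (radial_proj (midpoint
    (vec3 1 1 1 *m (sc *: q)) (vec3 0 (phi - 1) phi *m (sc *: q)))).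
  by rewrite -[RHS](orbit_tetra_midpoint _ _ oq cyc3_tetra) !cyc3E midpointC.
have -> : rot_orbit VT (radial_proj (midpoint (vec3 0 (- (phi - 1)) phi *m (sc *: q))
    (vec3 1 (-1) 1 *m (sc *: q)))) = rot_orbit VT (radial_proj (midpoint
    (vec3 1 (-1) 1 *m (sc *: q)) (vec3 phi 0 (phi - 1) *m (sc *: q)))).
  rewrite -2![RHS](orbit_tetra_midpoint _ _ oq cyc3_tetra).
  by rewrite -[RHS](orbit_tetra_midpoint _ _ oq half3_tetra) !cyc3E !half3E opprK oppr0 midpointC.
set S1 := rot_orbit _ _; set S2 := rot_orbit _ _.
by apply/seteqP; split=> x; rewrite /setU /=; tauto.
Qed.

End Decompositions.

End TetrahedralSymmetry.

Theorem theorem11 (R : realType) (VT VO : set 'rV[R]_3)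
  (hT : regular_tetrahedron VT) (hO : regular_cube VO) (hTO : VT `<=` VO) :
  let G := [set on_plane r | r in rotation_group VT] in
  let FT := face_points VT in
  let ET := edge_points VT in
  let BT := rot_orbit VT in
  let dodecahedron_over_T VI := regular_dodecahedron VI /\ VT `<=` VI in
  [/\ isomorphic_to_A4 G,
      (forall alpha : set 'rV[R]_3, finite_set alpha -> alpha `<=` sphere ->
        (lft_stabilizer alpha = G <->
         [/\ union_of_orbits VT alpha,
             (forall VI, dodecahedron_over_T VI -> ~ union_of_orbits VI alpha)
           & ~ union_of_orbits VO alpha])),
      (forall (VI : set 'rV[R]_3) (A B C D E : 'rV[R]_3) (gI : 'M[R]_3),
        dodecahedron_over_T VI ->
        labelled_face VI [:: A; B; C; D; E] ->
        VT A -> ET (radial_proj (midpoint B C)) ->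
        face_rotation [:: A; B; C; D; E] A B gI ->
        let N := radial_proj (centroid [set` [:: A; B; C; D; E]]) in
        let Q := radial_proj (midpoint A B) in
        let R' := radial_proj (midpoint D E) in
        [/\ VI = VT `|` FT `|` BT B,
            face_points VI = BT N,
            edge_points VI = ET `|` BT Q `|` BT R'
          & forall X, generic_point VI X ->
              rot_orbit VI X =
                BT X `|` BT (X *m gI) `|` BT (X *m gI ^+ 2) `|`
                BT (X *m gI ^+ 3) `|` BT (X *m gI ^+ 4)])
    & (forall (A B C D : 'rV[R]_3) (gO : 'M[R]_3),
        labelled_face VO [:: A; B; C; D] ->
        VT A ->
        face_rotation [:: A; B; C; D] A B gO ->
        let P := radial_proj (midpoint A B) in
        [/\ VO = VT `|` FT,
            face_points VO = ET,
            edge_points VO = BT P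
          & forall X, generic_point VO X ->
              rot_orbit VO X = BT X `|` BT (X *m gO)])].
Proof.
move=> G FT ET BT over.
have [q [rq VTE]] := tetrahedron_position hT; have oq := rq.1.
have VOE : VO = mulset std_cube ((Num.sqrt 3)^-1 *: q).
  by apply: (cube_position oq hO); rewrite -VTE.
split.
- rewrite /G VTE; apply: (tetrahedral_group_A4 _ rq).
  by rewrite gt_eqF // sc_gt0.
- move=> alpha fa as_; have := lft_stabilizer_tetrahedral rq fa as_.
  by rewrite -VTE -VOE.
- move=> VI A B C D E gI [rI sub] lF TA mid fr.
  have [|q' [oq' VIE VTE']] := dodecahedron_frame oq rI; first by rewrite -VTE.
  rewrite -VTE in VTE'; rewrite /ET VTE' in mid; rewrite VTE' VIE in lF TA *.
  by rewrite /BT /FT /ET VTE'; exact: (dodecahedron_decomposition oq' lF TA mid fr).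
move=> A B C D gO lF TA fr; rewrite VOE in lF *; rewrite /FT /ET /BT VTE in TA *.
exact: (cube_decomposition oq lF TA fr).
Qed.
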